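(* For $n\in\mathbb{Z}$ let $\mathsf{V}_n=\{\Delta(2^nx)h(x): h\in\mathsf{H}^2(\mathbb{R})\}$, and for $n,j\in\mathbb{Z}$ let $$\phi_{n,j}(x)=2^{n/2}\,\phi(2^nx-j)\,\Delta(2^nx),$$ with $\phi$ and $\Delta$ as defined in the context. Then $(\mathsf{V}_n)_{n\in\mathbb{Z}}$ is a decreasing sequence of subspaces of $\mathsf{H}^2(\mathbb{R})$ with $\bigcap_{n\in\mathbb{Z}}\mathsf{V}_n=\{0\}$ and $\bigcup_{n\in\mathbb{Z}}\mathsf{V}_n$ dense in $\mathsf{H}^2(\mathbb{R})$; for every $n\in\mathbb{Z}$, $(\phi_{n,j})_{j\in\mathbb{Z}}$ is an orthonormal basis of $\mathsf{V}_n\ominus\mathsf{V}_{n+1}$; and $(\phi_{n,j})_{n,j\in\mathbb{Z}}$ is an orthonormal basis of $\mathsf{H}^2(\mathbb{R})$.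
   Context: $\mathsf{H}^2(\mathbb{R})$ is the Hardy space of analytic functions $f$ on the upper half plane $\{x+iy: y>0\}$ with $\sup_{y>0}\|f(\cdot+iy)\|_{L^2(\mathbb{R})}<\infty$, identified through boundary values with the functions in $L^2(\mathbb{R})$ whose Fourier transform vanishes on $(-\infty,0)$; the inner product is $\langle f,g\rangle=\int_{\mathbb{R}}f(x)\overline{g(x)}\,\mathrm{d}x$. The symbol $\mathsf{V}\ominus\mathsf{W}$ denotes the orthogonal complement of $\mathsf{W}$ in $\mathsf{V}$. Define $$\phi(x)=\frac{\Gamma(x-1+i)}{\sqrt{\pi}\,\Gamma(x-i)},\qquad G(x)=\prod_{j\in\mathbb{Z}}\frac{j-i}{j+i}\cdot\frac{x-j-i}{x-j+i},\qquad \Delta(x)=\prod_{j<0}G(2^jx),$$ where both infinite products converge ($\Gamma$ is Euler's Gamma function, $i=\sqrt{-1}$, and the product defining $\Delta$ is over negative integers $j$). *)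

(* Defs.v *)
From HB Require Import structures.
From mathcomp Require Import all_boot all_order all_algebra.
From mathcomp Require Import complex.
From mathcomp Require Import all_classical all_reals all_analysis.

Set Implicit Arguments.
Unset Strict Implicit.
Unset Printing Implicit Defensive.

Import Order.TTheory GRing.Theory Num.Theory.
Import numFieldNormedType.Exports.

Local Open Scope classical_set_scope.
Local Open Scope ring_scope.
Local Open Scope complex_scope.

Local Notation Re := (@complex.Re _).
Local Notation Im := (@complex.Im _).

Section Functions.
Context {R : realType}.

(* The topology and the normed-space structure of the complex plane are those
   of the regular module R[i]^o. *)
Definition cseqlim (u : nat -> R[i]) : R[i] := lim ((u : nat -> R[i]^o) @ \oo).

Definition iprod (u : nat -> R[i]) : R[i] :=
  cseqlim (fun n => \prod_(k < n) u k).

(* A product over the integers is the product of its two halves, over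
   0, 1, 2, ... and over -1, -2, ...; recall that Negz k is -(k + 1). *)
Definition zprod (u : int -> R[i]) : R[i] :=
  iprod (fun k => u (Posz k)) * iprod (fun k => u (Negz k)).

Definition cexp (z : R[i]) : R[i] :=
  (expR (Re z))%:C * (cos (Im z) +i* sin (Im z)).

(* Euler's limit n! n^z / (z (z + 1) ... (z + n)), valid on the whole plane
   except at the poles 0, -1, -2, ... *)
Definition Gamma (z : R[i]) : R[i] :=
  cseqlim (fun n => n`!%:R * cexp (z * (ln n%:R)%:C)
                    / \prod_(k < n.+1) (z + k%:R)).

Definition phi (z : R[i]) : R[i] :=
  Gamma (z - 1 + 'i%C) / ((Num.sqrt pi)%:C * Gamma (z - 'i%C)).

Definition G (z : R[i]) : R[i] :=
  zprod (fun j => (j%:~R - 'i%C) / (j%:~R + 'i%C)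
                  * ((z - j%:~R - 'i%C) / (z - j%:~R + 'i%C))).

Definition Delta (z : R[i]) : R[i] := iprod (fun k => G (2 ^ Negz k * z)).

End Functions.

Section Hardy.
Context {R : realType}.
Implicit Types (f g : R -> R[i]) (V W : set (R -> R[i])).

Notation mu := (@lebesgue_measure R).

Definition L2norm f : \bar R := 'N[mu]_2%:E[EFin \o (fun x => Re `|f x|%R)]%E.

(* Elements of L^2 are represented by Borel functions; two of them are the
   same element when they agree almost everywhere. *)
Definition L2 : set (R -> R[i]) :=
  [set f | [/\ measurable_fun setT (fun x => Re (f x)),
               measurable_fun setT (fun x => Im (f x))
             & (L2norm f < +oo)%E]].

Definition inner f g : R[i] :=
  (\int[mu]_x Re (f x * (g x)^*%C)) +i* (\int[mu]_x Im (f x * (g x)^*%C)).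

(* Over the scalars R[i], derivability in the direction 1 is complex
   differentiability.  The values of F outside the upper half plane are
   irrelevant. *)
Definition hardy_uhp (F : R[i] -> R[i]) : Prop :=
  (forall z, 0 < Im z -> derivable (F : R[i]^o -> R[i]^o) z 1) /\
  (ereal_sup [set L2norm (fun x => F (x +i* y)) | y in [set y | (0 < y)%R]]
     < +oo)%E.

(* Boundary values are taken in the L^2 sense; for functions in the Hardy space
   they agree almost everywhere with the pointwise limits. *)
Definition boundary_value (F : R[i] -> R[i]) f : Prop :=
  L2norm (fun x => F (x +i* y) - f x) @[y --> 0^'+] --> 0%E.

(* The Hardy space, identified with the space of its boundary functions. *)
Definition H2 : set (R -> R[i]) :=
  [set f | L2 f /\ exists2 F, hardy_uhp F & boundary_value F f].

Definition dense_in V W : Prop :=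
  forall f, W f -> forall e : R, 0 < e ->
    exists2 g, V g & (L2norm (fun x => f x - g x)%R < e%:E)%E.

(* Subspaces of a Hilbert space are closed. *)
Definition closed_subspace V W : Prop :=
  [/\ V `<=` W, V (fun=> 0),
      forall (a : R[i]) f g, V f -> V g -> V (fun x => a * f x + g x)
    & forall f, W f -> dense_in V [set f] -> V f].

Definition orthocompl V W : set (R -> R[i]) :=
  [set f | V f /\ forall g, W g -> inner f g = 0].

Definition lin_span (I : Type) (b : I -> R -> R[i]) : set (R -> R[i]) :=
  [set f | exists (s : seq I) (c : I -> R[i]),
             f = (fun x => \sum_(k <- s) c k * b k x)].

Definition orthonormal_basis (I : eqType) (b : I -> R -> R[i]) V : Prop :=
  [/\ forall k, V (b k),
      forall k l, inner (b k) (b l) = (k == l)%:R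
    & dense_in (lin_span b) V].

Definition Vspace (n : int) : set (R -> R[i]) :=
  [set (fun x => Delta (2 ^ n * x)%:C * h x) | h in H2].

Definition phinj (n j : int) (x : R) : R[i] :=
  (2 `^ (n%:~R / 2))%:C * phi (2 ^ n * x - j%:~R)%:C * Delta (2 ^ n * x)%:C.

End Hardy.

Notation "V ⊖ W" := (orthocompl V W) (at level 50, left associativity).

(* Main.v *)
Require Import Defs.
From HB Require Import structures.
From mathcomp Require Import all_boot all_order all_algebra.
From mathcomp Require Import complex.
From mathcomp Require Import all_classical all_reals all_analysis.
From mathcomp Require Import measurable_realfun ring lra.

Set Implicit Arguments.
Unset Strict Implicit.
Unset Printing Implicit Defensive.

Import Order.TTheory GRing.Theory Num.Theory.
Import numFieldNormedType.Exports.
Import Normc.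

Local Open Scope classical_set_scope.
Local Open Scope ring_scope.
Local Open Scope complex_scope.

Local Notation Re := (@complex.Re _).
Local Notation Im := (@complex.Im _).
Local Notation normc := (@Normc.normc _).

(** On the upper half plane $G$ is the Blaschke product with zeros $j+i$, $j\in\mathbb{Z}$,
    normalised by $G(0)=1$, and $\Delta(2z)=G(z)\Delta(z)$. So passing from $V_n$ to $V_{n+1}$
    multiplies the generating inner function $\Delta(2^nz)$ by one more row $G(2^nz)$ of Blaschke
    factors, with zeros $\lambda_{n,j}=(j+1+i)/2^n$ ([lam]). The Gamma quotient is, up to a
    unimodular constant, the product of the factors of $G$ of index at most 0, divided by
    $\sqrt\pi\,(x-1+i)$ ([phi_eq]). Hence
    $\phi_{n,j}(x)=K\,\Theta_{n,j}(x)/(x-\overline{\lambda_{n,j}})$, where $\Theta_{n,j}$ is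
    $\Delta(2^nz)$ times the factors of row $n$ that precede $\lambda_{n,j}$ ([phinj_eq]). This is a
    Takenaka-Malmquist system, its zeros ordered by scale and then by position.

    Orthonormality: on the line $|\Theta_{n,j}|=1$, so a function $\Theta_{n,j}\,b\,h$, with $b$ the
    Blaschke factor at $\lambda_{n,j}$ and $h$ in the Hardy space, pairs with $\phi_{n,j}$ to a
    multiple of $\int h(x)/(x-\overline{\lambda_{n,j}})\,dx=0$ ([inner_phinj_blaschke]). Every later
    function of the row and every element of $V_{n+1}$ has this form ([phinj_row_orth],
    [Vspace_orth]).

    Completeness: the identity $1-|b_\lambda(w)|^2=4\,\Im w\,\Im\lambda/|w-\bar\lambda|^2$ turns
    $|\phi_{n,j}(w)|^2$ into a difference ([normc_CI_phinj]). Row $n$ sums to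
    $(|\Delta(2^nw)|^2-|\Delta(2^{n+1}w)|^2)/(4\pi\Im w)$, and $\Delta(2^nw)$ tends to 1 at
    $-\infty$ and to 0 at $+\infty$; so the total is $1/(4\pi\Im w)$, the squared norm of the
    reproducing kernel ([kernel_sum]). By Bessel's identity the residual of an expansion then tends
    to 0 at each point, and Fatou's lemma on a horizontal line upgrades this to norm density
    ([main_density]). The statements on intersection, union and rows follow from density and
    orthogonality.

    The Hardy space is reached through Cauchy integrals. Goursat's theorem ([goursat_except]) and a
    limiting contour ([line_cauchy]) show that the analytic extension of a boundary function [f] is
    its Cauchy integral [CI f] ([hardy_CI]). With the bound [CI_energy_le] this gives the working
    description [H2P] and the closedness [hardy_closed]. Blaschke products act as multipliers in the
    sense of [inner_mult], a notion stable under products and pointwise limits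
    ([inner_mult_lim]). *)

(** * Components and modulus of complex numbers *)

Section ComplexBasics.
Context {R : realType}.
Implicit Types (z w : R[i]) (x y : R).

Lemma ReD z w : Re (z + w) = Re z + Re w. Proof. by case: z w => a b [c d]. Qed.
Lemma ImD z w : Im (z + w) = Im z + Im w. Proof. by case: z w => a b [c d]. Qed.
Lemma ReN z : Re (- z) = - Re z. Proof. by case: z. Qed.
Lemma ImN z : Im (- z) = - Im z. Proof. by case: z. Qed.
Lemma ReB z w : Re (z - w) = Re z - Re w. Proof. by rewrite ReD ReN. Qed.
Lemma ImB z w : Im (z - w) = Im z - Im w. Proof. by rewrite ImD ImN. Qed.
Lemma ReM z w : Re (z * w) = Re z * Re w - Im z * Im w.
Proof. by case: z w => a b [c d]. Qed.
Lemma ImM z w : Im (z * w) = Re z * Im w + Im z * Re w.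
Proof. by case: z w => a b [c d]. Qed.
Lemma ReJ z : Re z^*%C = Re z. Proof. by case: z. Qed.
Lemma ImJ z : Im z^*%C = - Im z. Proof. by case: z. Qed.
Lemma ReC x : Re x%:C = x. Proof. by []. Qed.
Lemma ImC x : Im x%:C = 0. Proof. by []. Qed.
Lemma ReK x y : Re (x +i* y) = x. Proof. by []. Qed.
Lemma ImK x y : Im (x +i* y) = y. Proof. by []. Qed.
Definition ReImE := (ReK, ImK, ReD, ImD, ReN, ImN, ReM, ImM, ReJ, ImJ, ReC, ImC).

Lemma complex_ext z w : Re z = Re w -> Im z = Im w -> z = w.
Proof. by case: z w => a b [c d] /= -> ->. Qed.

Lemma normc_sqr z : normc z ^+ 2 = Re z ^+ 2 + Im z ^+ 2.
Proof. by case: z => a b /=; rewrite sqr_sqrtr// addr_ge0// sqr_ge0. Qed.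

Lemma normcE_C z : `|z| = (normc z)%:C. Proof. by []. Qed.

Lemma normc_ge0 z : 0 <= normc z.
Proof. by case: z => a b /=; rewrite sqrtr_ge0. Qed.
Hint Resolve normc_ge0 : core.

Lemma normc_eq0 z : (normc z == 0) = (z == 0).
Proof.
apply/eqP/eqP => [/eq0_normc//|->]; exact: normc0.
Qed.

Lemma normc_gt0 z : (0 < normc z) = (z != 0).
Proof. by rewrite lt_def normc_eq0 normc_ge0 andbT. Qed.

Lemma normcD z w : normc (z + w) <= normc z + normc w.
Proof. exact: le_normcD. Qed.

Lemma normcB z w : normc (z - w) = normc (w - z).
Proof. by rewrite -opprB normcN. Qed.

Lemma normcBl z w : normc z - normc w <= normc (z - w).
Proof. by rewrite lerBlDr (le_trans _ (normcD _ _))// subrK. Qed.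

Lemma normc_real x : normc x%:C = `|x|.
Proof. by rewrite /= expr0n /= addr0 sqrtr_sqr. Qed.

Lemma normcJ_ z : normc z^*%C = normc z.
Proof. by case: z => a b /=; rewrite sqrrN. Qed.

Lemma normc_i : normc ('i%C : R[i]) = 1.
Proof. by rewrite /= expr0n add0r expr1n sqrtr1. Qed.

Lemma normc_mulJ z : z * z^*%C = (normc z ^+ 2)%:C.
Proof.
by rewrite normc_sqr; apply: complex_ext; rewrite !ReImE /=; ring.
Qed.

Lemma normc_Re z : `|Re z| <= normc z.
Proof.
rewrite -(ler_pXn2r (n := 2)) ?nnegrE// real_normK ?num_real// normc_sqr.
by rewrite lerDl sqr_ge0.
Qed.

Lemma normc_Im z : `|Im z| <= normc z.
Proof.
rewrite -(ler_pXn2r (n := 2)) ?nnegrE// real_normK ?num_real// normc_sqr.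
by rewrite lerDr sqr_ge0.
Qed.

Lemma normc_leReIm z : normc z <= `|Re z| + `|Im z|.
Proof.
rewrite -(ler_pXn2r (n := 2)) ?nnegrE ?addr_ge0// normc_sqr sqrrD.
rewrite !real_normK ?num_real//.
have : 0 <= `|Re z| * `|Im z| by rewrite mulr_ge0.
by lra.
Qed.

Lemma conjcD z w : conjc (z + w) = conjc z + conjc w. Proof. exact: rmorphD. Qed.
Lemma conjcN z : conjc (- z) = - conjc z. Proof. exact: rmorphN. Qed.
Lemma conjcB z w : conjc (z - w) = conjc z - conjc w. Proof. exact: rmorphB. Qed.
Lemma conjcM z w : conjc (z * w) = conjc z * conjc w. Proof. exact: rmorphM. Qed.

Lemma normc_div z w : normc (z / w) = normc z / normc w.
Proof. by rewrite normcM normcV. Qed.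

Lemma normcX z n : normc (z ^+ n) = normc z ^+ n.
Proof. by elim: n => [|n IH]; rewrite ?expr0 ?normc1// !exprS normcM IH. Qed.

Lemma normc_prod (I : Type) (s : seq I) (F : I -> R[i]) :
  normc (\prod_(i <- s) F i) = \prod_(i <- s) normc (F i).
Proof.
by elim/big_ind2 : _ => //; [rewrite normc1|move=> a b c d <- <-; rewrite normcM].
Qed.

End ComplexBasics.
#[global] Hint Extern 0 (is_true (@Order.le _ _ _ (Normc.normc _))) => (exact: normc_ge0) : core.

(** * Convergence and differentiability in the complex plane *)

Section ComplexTopology.
Context {R : realType}.
Implicit Types (z w l : R[i]).

(** The order on [R[i]] compares only numbers with equal imaginary parts, so every radius or
    tolerance of the normed module [R[i]^o] is a real one. *)
Lemma ltc0_real (e : R[i]) : 0 < e -> exists2 r : R, 0 < r & e = r%:C.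
Proof.
case: e => a b; rewrite ltcE /= => /andP[/eqP ->] a0.
by exists a.
Qed.

Lemma ccvgP {T : Type} (F : set_system T) {FF : Filter F} (u : T -> R[i]) l :
  (u : T -> R[i]^o) @ F --> (l : R[i]^o) <->
  normc (u x - l) @[x --> F] --> (0 : R).
Proof.
split=> [/cvgrPdist_lt ul|/cvgrPdist_lt ul]; apply/cvgrPdist_lt => e e0.
- have e0' : (0 : R[i]) < e%:C by rewrite ltcR.
  near=> x.
  have : `|l - u x| < e%:C by near: x; exact: ul.
  by rewrite normcE_C ltcR sub0r normrN ger0_norm// normcB.
- have [r r0 ->] := ltc0_real e0.
  near=> x.
  have : `|0 - normc (u x - l)| < r by near: x; exact: ul.
  by rewrite sub0r normrN ger0_norm// normcB -ltcR.
Unshelve. all: by end_near. Qed.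

Lemma cvg_normc0P {T : Type} (F : set_system T) {FF : Filter F} (v : T -> R[i]) :
  normc (v x) @[x --> F] --> (0 : R) <->
  forall e : R, 0 < e -> \forall x \near F, normc (v x) < e.
Proof.
split=> [/cvgrPdist_lt h e e0|h].
  by near=> x; rewrite -(ger0_norm (normc_ge0 (v x))) -normrN -sub0r; near: x; exact: h.
apply/cvgrPdist_lt => e e0; near=> x.
by rewrite sub0r normrN ger0_norm//; near: x; exact: h.
Unshelve. all: by end_near. Qed.

Lemma ccvg_ReIm {T : Type} (F : set_system T) {FF : Filter F} (u : T -> R[i]) l :
  (u : T -> R[i]^o) @ F --> (l : R[i]^o) <->
  (Re (u x) @[x --> F] --> Re l /\ Im (u x) @[x --> F] --> Im l).
Proof.
rewrite ccvgP; split=> [/cvg_normc0P ul|[/cvgrPdist_lt ul /cvgrPdist_lt vl]].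
- split; apply/cvgrPdist_lt => e e0; near=> x; rewrite distrC.
  + rewrite -ReB (le_lt_trans (normc_Re _))//; near: x; exact: ul.
  + rewrite -ImB (le_lt_trans (normc_Im _))//; near: x; exact: ul.
- apply/cvg_normc0P => e e0.
  have e2 : 0 < e / 2 by rewrite divr_gt0.
  near=> x.
  rewrite (le_lt_trans (normc_leReIm _))// (splitr e) ReB ImB ltrD//.
  + by rewrite distrC; near: x; exact: ul.
  + by rewrite distrC; near: x; exact: vl.
Unshelve. all: by end_near. Qed.

Lemma cseqlim_eq (u : nat -> R[i]) l :
  (u : nat -> R[i]^o) @ \oo --> (l : R[i]^o) -> cseqlim u = l.
Proof. exact: (@cvg_lim R[i]^o (@norm_hausdorff _ _) _ _ _ u l). Qed.

Lemma cvg_normc {T : Type} (F : set_system T) {FF : Filter F} (u : T -> R[i]) l :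
  (u : T -> R[i]^o) @ F --> (l : R[i]^o) -> normc (u x) @[x --> F] --> normc l.
Proof.
move=> /ccvgP /cvg_normc0P ul; apply/cvgrPdist_lt => e e0; near=> x.
suff : `|normc l - normc (u x)| <= normc (u x - l).
  by move/le_lt_trans; apply; near: x; exact: ul.
by rewrite ler_norml lerNl opprB normcBl normcB normcBl.
Unshelve. all: by end_near. Qed.

(** Complex differentiability with derivative [L], multiplied out: there is no division, so [h = 0]
    is allowed, and the remainder bound is the form that Goursat's argument consumes. *)
Definition cdiff (F : R[i] -> R[i]) z L := forall e : R, 0 < e ->
  exists2 d : R, 0 < d & forall h, normc h < d ->
    normc (F (z + h) - F z - L * h) <= e * normc h.

Lemma derivable_cdiff (F : R[i] -> R[i]) z :
  derivable (F : R[i]^o -> R[i]^o) z 1 <-> exists L, cdiff F z L.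
Proof.
split=> [dF|[L dF]].
- exists ('D_1 (F : R[i]^o -> R[i]^o) z) => e e0.
  move: dF; rewrite /derivable -/(derive (F : R[i]^o -> R[i]^o) z 1).
  move=> /cvgrPdist_le /(_ e%:C); rewrite ltcR => /(_ e0).
  move=> /nbhs_ballP[/= d' /ltc0_real[d d0 ->]] H.
  exists d => // h hd.
  have [->|h0] := eqVneq h 0.
    by rewrite addr0 mulr0 subrr subrr normc0 mulr0.
  have /= := H h.
  rewrite /ball /= sub0r normrN normcE_C ltcR => /(_ hd h0).
  rewrite normcE_C lecR => Hh.
  have hh : F (z + h) - F z - 'D_1 (F : R[i]^o -> R[i]^o) z * h =
    - ('D_1 (F : R[i]^o -> R[i]^o) z - h^-1 * (F (h * 1 + z) - F z)) * h.
    by rewrite mulr1 (addrC h) opprB mulrBl mulrAC mulVf// mul1r.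
  by rewrite hh normcM normcN ler_pM2r// normc_gt0.
- apply/cvg_ex; exists L; apply/cvgrPdist_le => e' /ltc0_real[e e0 ->].
  have [d d0 H] := dF _ e0.
  apply/nbhs_ballP; exists d%:C => /=; first by rewrite ltcR.
  move=> h /=; rewrite /ball /= sub0r normrN normcE_C ltcR => hd h0.
  rewrite normcE_C lecR -(ler_pM2r (x := normc h)) ?normc_gt0// -normcM.
  apply: le_trans (H _ hd).
  rewrite -normcN le_eqVlt; apply/orP; left; apply/eqP; congr normc.
  by rewrite mulrBl opprB /GRing.scale /= mulr1 (addrC h) mulrAC mulVf// mul1r.
Qed.

Lemma cdiffM F G z L M : cdiff F z L -> cdiff G z M ->
  cdiff (fun x => F x * G x) z (L * G z + F z * M).
Proof.
move=> dF dG e e0.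
pose C := normc (G z) + normc M + 2 + normc (F z) + normc L.
have C0 : 0 < C.
  rewrite /C -!addrA; apply: (lt_le_trans (_ : 0 < 2)) => //.
  have := normc_ge0 (G z); have := normc_ge0 M; have := normc_ge0 (F z).
  have := normc_ge0 L; lra.
have e1 : 0 < Num.min 1 (e / (C *+ 2)) by rewrite lt_min ltr01 divr_gt0// pmulrn_lgt0.
have [d1 d10 H1] := dF _ e1; have [d2 d20 H2] := dG _ e1.
exists (Num.min (Num.min d1 d2) (Num.min 1 (e / (C ^+ 2 *+ 2)))).
  by rewrite !lt_min d10 d20 ltr01 divr_gt0// pmulrn_lgt0// exprn_gt0.
move=> h; rewrite !lt_min => /andP[/andP[hd1 hd2] /andP[h1 hC]].
have {H1} := H1 _ hd1; have {H2} := H2 _ hd2.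
set f := F (z + h) - _ - _; set g := G (z + h) - _ - _ => gh fh.
(* The first two terms carry a remainder [f] or [g]; the last one is of second order in [h] and is
   absorbed by the bound on [normc h]. *)
have -> : F (z + h) * G (z + h) - F z * G z - (L * G z + F z * M) * h =
  f * (G z + M * h + g) + F z * g + L * h * (M * h + g).
  by rewrite /f /g; ring.
have m1 : Num.min 1 (e / (C *+ 2)) <= 1 by rewrite ge_min lexx.
have m2 : Num.min 1 (e / (C *+ 2)) <= e / (C *+ 2) by rewrite ge_min lexx orbT.
set m := Num.min 1 _ in e1 gh fh m1 m2.
have nh := normc_ge0 h.
have gh1 : normc g <= normc h by rewrite (le_trans gh)// ler_piMl.
rewrite (le_trans (normcD _ _))// (le_trans (lerD (normcD _ _) (lexx _)))//.
rewrite !normcM.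
have A1 : normc (G z + M * h + g) <= C.
  rewrite (le_trans (normcD _ _))// (le_trans (lerD (normcD _ _) (lexx _)))// normcM.
  have : normc M * normc h <= normc M by rewrite ler_piMr// ltW.
  have := normc_ge0 (F z); have := normc_ge0 L.
  rewrite /C; lra.
have A2 : normc (M * h + g) <= C * normc h.
  rewrite (le_trans (normcD _ _))// normcM.
  have := normc_ge0 (F z); have := normc_ge0 L; have := normc_ge0 (G z).
  rewrite /C; nra.
have LC : normc L <= C.
  have := normc_ge0 (F z); have := normc_ge0 (G z); have := normc_ge0 M; rewrite /C; lra.
have B1 : normc f * normc (G z + M * h + g) + normc (F z) * normc g <= m * normc h * C.
  have -> : m * normc h * C = m * normc h * (C - normc (F z)) + normc (F z) * (m * normc h) by ring.
  apply: lerD; last by rewrite ler_wpM2l.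
  apply: ler_pM => //.
  rewrite (le_trans (normcD _ _))// (le_trans (lerD (normcD _ _) (lexx _)))// normcM.
  have : normc M * normc h <= normc M by rewrite ler_piMr// ltW.
  have := normc_ge0 L; rewrite /C; lra.
have B2 : normc L * normc h * normc (M * h + g) <= (C ^+ 2 * normc h) * normc h.
  have -> : C ^+ 2 * normc h * normc h = C * normc h * (C * normc h) by ring.
  by apply: ler_pM => //; [exact: mulr_ge0|exact: ler_wpM2r].
have B3 : m * normc h * C <= e / 2 * normc h.
  rewrite mulrAC ler_wpM2r//.
  have -> : e / 2 = e / (C *+ 2) * C by rewrite -mulr_natr; field; rewrite gt_eqF.
  by rewrite ler_wpM2r// ltW.
have B4 : (C ^+ 2 * normc h) * normc h <= e / 2 * normc h.
  rewrite ler_wpM2r//.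
  have -> : e / 2 = C ^+ 2 * (e / (C ^+ 2 *+ 2)) by rewrite -mulr_natr; field; rewrite gt_eqF.
  by rewrite ler_wpM2l ?sqr_ge0// ltW.
lra.
Qed.

End ComplexTopology.

Arguments Normc.normc : simpl never.

(** * Square-integrable functions and their energy *)

Section L2theory.
Context {R : realType}.
Notation mu := (@lebesgue_measure R).
Implicit Types (f g : R -> R[i]).
Local Open Scope ereal_scope.

(** The square of [L2norm], kept as a plain integral with values in the extended reals, so that
    monotonicity, Tonelli and Fatou apply without roots. *)
Definition energy f : \bar R := \int[mu]_x (normc (f x) ^+ 2)%:E.
Definition cmeas f := measurable_fun setT (fun x => Re (f x)) /\
                      measurable_fun setT (fun x => Im (f x)).

Lemma energy_ge0 f : 0 <= energy f.
Proof. by apply: integral_ge0 => x _; rewrite lee_fin sqr_ge0. Qed.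

Lemma L2normE f : L2norm f `^ 2 = energy f.
Proof.
rewrite /L2norm poweR_Lnorm ?pnatr_eq0//; apply: eq_integral => x _ /=.
by rewrite ger0_norm// powR_mulrn.
Qed.

Lemma L2norm_ge0 f : 0 <= L2norm f. Proof. exact: Lnorm_ge0. Qed.

Lemma L2norm_lty f : (L2norm f < +oo) = (energy f < +oo).
Proof.
rewrite -L2normE; have := L2norm_ge0 f; case: (L2norm f) => [r r0|_|//].
  by rewrite !ltry.
by rewrite poweRyr ?pnatr_eq0.
Qed.

Lemma L2norm_lt f (e : R) : (0 < e)%R -> (L2norm f < e%:E) = (energy f < (e ^+ 2)%:E).
Proof.
rewrite -L2normE => e0; have := L2norm_ge0 f; case: (L2norm f) => [r r0|_|//].
  rewrite poweR_EFin !lte_fin powR_mulrn// ltr_pXn2r// nnegrE.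
  exact: ltW.
by rewrite poweRyr ?pnatr_eq0// !ltNge !leey.
Qed.

Lemma L2norm_le f (e : R) : (0 <= e)%R -> (L2norm f <= e%:E) = (energy f <= (e ^+ 2)%:E).
Proof.
rewrite -L2normE => e0; have := L2norm_ge0 f; case: (L2norm f) => [r r0|_|//].
  by rewrite poweR_EFin !lee_fin powR_mulrn// ler_pXn2r// nnegrE.
by rewrite poweRyr ?pnatr_eq0//.
Qed.

Lemma L2P f : L2 f <-> cmeas f /\ energy f < +oo.
Proof. by rewrite /L2 /= L2norm_lty /cmeas; split=> [[]|[[]]]. Qed.

Lemma cmeasD f g : cmeas f -> cmeas g -> cmeas (f \+ g)%R.
Proof.
move=> [f1 f2] [g1 g2]; split.
  by under eq_fun do rewrite ReD; exact: measurable_funD.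
by under eq_fun do rewrite ImD; exact: measurable_funD.
Qed.

Lemma cmeasM f g : cmeas f -> cmeas g -> cmeas (f \* g)%R.
Proof.
move=> [f1 f2] [g1 g2]; split.
  under eq_fun do rewrite ReM.
  by apply: measurable_funB; exact: measurable_funM.
under eq_fun do rewrite ImM.
by apply: measurable_funD; exact: measurable_funM.
Qed.

Lemma cmeasJ f : cmeas f -> cmeas (fun x => (f x)^*%C).
Proof.
move=> [f1 f2]; split; first by under eq_fun do rewrite ReJ.
by under eq_fun do rewrite ImJ; exact: measurableT_comp.
Qed.

Lemma cmeas_cst (c : R[i]) : cmeas (fun=> c).
Proof. by split; exact: measurable_cst. Qed.

Lemma cmeasZ (c : R[i]) f : cmeas f -> cmeas (fun x => c * f x)%R.
Proof. by move=> mf; apply: (cmeasM (cmeas_cst c) mf). Qed.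

Lemma cmeasN f : cmeas f -> cmeas (fun x => - f x)%R.
Proof.
by move=> /(cmeasZ (-1)%R); under eq_fun do rewrite mulN1r.
Qed.

Lemma cmeasB f g : cmeas f -> cmeas g -> cmeas (fun x => f x - g x)%R.
Proof. by move=> mf /cmeasN mg; exact: cmeasD. Qed.

Lemma cmeas_sqr f : cmeas f -> measurable_fun setT (fun x => normc (f x) ^+ 2)%R.
Proof.
move=> [f1 f2]; under eq_fun do rewrite normc_sqr.
by apply: measurable_funD; exact: measurable_funX.
Qed.

Lemma cmeas_normc f : cmeas f -> measurable_fun setT (fun x => normc (f x))%R.
Proof.
move=> /cmeas_sqr mf.
rewrite (_ : (fun x => _) = (fun x => Num.sqrt (normc (f x) ^+ 2))); last first.
  by apply/funext => x; rewrite sqrtr_sqr ger0_norm.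
exact: measurableT_comp (continuous_measurable_fun (@sqrt_continuous R)) mf.
Qed.

Lemma cmeas_cvg (u : nat -> R -> R[i]) f : (forall n, cmeas (u n)) ->
  (forall x, (u ^~ x : nat -> R[i]^o) @ \oo --> (f x : R[i]^o)) -> cmeas f.
Proof.
move=> mu_ uf; split.
- apply: (@measurable_realfun.measurable_fun_cvg _ _ _ _ (fun n x => Re (u n x))).
    by move=> m; case: (mu_ m).
  by move=> x _; have /ccvg_ReIm[] := uf x.
- apply: (@measurable_realfun.measurable_fun_cvg _ _ _ _ (fun n x => Im (u n x))).
    by move=> m; case: (mu_ m).
  by move=> x _; have /ccvg_ReIm[] := uf x.
Qed.

Lemma measurable_energy f : cmeas f -> measurable_fun setT (fun x => (normc (f x) ^+ 2)%:E).
Proof. by move=> /cmeas_sqr mf; exact/measurable_EFinP. Qed.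

Lemma normc_sqrD (a b : R[i]) :
  ((normc (a + b)) ^+ 2 <= 2 * (normc a) ^+ 2 + 2 * (normc b) ^+ 2)%R.
Proof.
have h : (normc (a + b) ^+ 2 <= (normc a + normc b) ^+ 2)%R.
  by rewrite ler_pXn2r ?nnegrE ?addr_ge0 ?normcD.
have := sqr_ge0 (normc a - normc b)%R.
move: h; set s := normc (a + b)%R; set p := normc a; set q := normc b.
by rewrite sqrrB sqrrD; lra.
Qed.

Lemma le_energy f g : cmeas f -> cmeas g ->
  (forall x, (normc (f x) <= normc (g x))%R) -> energy f <= energy g.
Proof.
move=> mf mg fg; apply: ge0_le_integral => //.
- by move=> x _; rewrite lee_fin sqr_ge0.
- exact: measurable_energy.
- exact: measurable_energy.
- by move=> x _; rewrite lee_fin ler_pXn2r// nnegrE.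
Qed.

(** The inequality $|a+b|^2\le 2|a|^2+2|b|^2$, integrated. It stands in for the triangle inequality
    in the later estimates, where only the smallness of energies matters. *)
Lemma energyD f g : cmeas f -> cmeas g ->
  energy (f \+ g)%R <= 2%:E * energy f + 2%:E * energy g.
Proof.
move=> mf mg.
rewrite -!ge0_integralZl//; last 4 first.
- exact: measurable_energy.
- by move=> x _; rewrite lee_fin sqr_ge0.
- exact: measurable_energy.
- by move=> x _; rewrite lee_fin sqr_ge0.
rewrite -ge0_integralD//.
- apply: ge0_le_integral => //.
  + by move=> x _; rewrite lee_fin sqr_ge0.
  + by apply: measurable_energy; exact: cmeasD.
  + by apply: emeasurable_funD; apply: measurable_funeM; exact: measurable_energy.
  + by move=> x _; rewrite -!EFinM -EFinD lee_fin normc_sqrD.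
- by move=> x _; rewrite -!EFinM lee_fin mulr_ge0// sqr_ge0.
- by apply: measurable_funeM; exact: measurable_energy.
- by move=> x _; rewrite -!EFinM lee_fin mulr_ge0// sqr_ge0.
- by apply: measurable_funeM; exact: measurable_energy.
Qed.

Lemma energyZ (c : R[i]) f : cmeas f ->
  energy (fun x => c * f x)%R = (normc c ^+ 2)%:E * energy f.
Proof.
move=> mf; rewrite -ge0_integralZl//.
- by apply: eq_integral => x _; rewrite normcM exprMn EFinM.
- exact: measurable_energy.
- by move=> x _; rewrite lee_fin sqr_ge0.
- by rewrite lee_fin sqr_ge0.
Qed.

Lemma energyN f : energy (fun x => - f x)%R = energy f.
Proof. by apply: eq_integral => x _; rewrite normcN. Qed.

Lemma energyJ f : energy (fun x => (f x)^*%C) = energy f.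
Proof. by apply: eq_integral => x _; rewrite normcJ_. Qed.

Lemma energyC f g : energy (fun x => f x - g x)%R = energy (fun x => g x - f x)%R.
Proof. by apply: eq_integral => x _; rewrite normcB. Qed.

Lemma energyB_le f g h : cmeas f -> cmeas g -> cmeas h ->
  energy (fun x => f x - h x)%R <=
  2%:E * energy (fun x => f x - g x)%R + 2%:E * energy (fun x => g x - h x)%R.
Proof.
move=> mf mg mh.
have -> : (fun x => f x - h x)%R = ((fun x => f x - g x) \+ (fun x => g x - h x))%R.
  by apply/funext => x /=; rewrite addrA subrK.
by apply: energyD; exact: cmeasB.
Qed.

Lemma L2_cmeas f : L2 f -> cmeas f. Proof. by case/L2P. Qed.

Lemma L2_energy f : L2 f -> energy f = (fine (energy f))%:E.
Proof. by case/L2P => _ h; rewrite fineK// ge0_fin_numE// energy_ge0. Qed.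

Lemma fine_energy_ge0 f : (0 <= fine (energy f))%R.
Proof. by rewrite fine_ge0// energy_ge0. Qed.

Lemma L2D f g : L2 f -> L2 g -> L2 (f \+ g)%R.
Proof.
move=> /L2P[mf Ef] /L2P[mg Eg]; apply/L2P; split; first exact: cmeasD.
apply: le_lt_trans (energyD mf mg) _.
by apply: lte_add_pinfty; apply: lte_mul_pinfty.
Qed.

Lemma L2Z (c : R[i]) f : L2 f -> L2 (fun x => c * f x)%R.
Proof.
move=> /L2P[mf Ef]; apply/L2P; split; first exact: cmeasZ.
by rewrite energyZ//; apply: lte_mul_pinfty => //; rewrite lee_fin sqr_ge0.
Qed.

Lemma L2N f : L2 f -> L2 (fun x => - f x)%R.
Proof. by move=> /L2P[mf Ef]; apply/L2P; split; [exact: cmeasN|rewrite energyN]. Qed.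

Lemma L2B f g : L2 f -> L2 g -> L2 (fun x => f x - g x)%R.
Proof. by move=> L2f /L2N L2g; exact: L2D. Qed.

Lemma L2J f : L2 f -> L2 (fun x => (f x)^*%C).
Proof. by move=> /L2P[mf Ef]; apply/L2P; split; [exact: cmeasJ|rewrite energyJ]. Qed.

Lemma L2_0 : @L2 R (fun=> 0%R).
Proof.
apply/L2P; split; first exact: cmeas_cst.
rewrite /energy; under eq_integral do rewrite normc0 expr0n.
by rewrite integral0 ltry.
Qed.

Lemma L2_le f g : cmeas f -> L2 g -> (forall x, (normc (f x) <= normc (g x))%R) -> L2 f.
Proof.
move=> mf /L2P[mg Eg] fg; apply/L2P; split => //.
exact: le_lt_trans (le_energy mf mg fg) Eg.
Qed.

Lemma L2_sum (I : Type) (s : seq I) (F : I -> R -> R[i]) :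
  (forall i, L2 (F i)) -> L2 (fun x => \sum_(i <- s) F i x)%R.
Proof.
move=> mF; elim: s => [|i s IH].
  by under eq_fun do rewrite big_nil; exact: L2_0.
by under eq_fun do rewrite big_cons; exact: L2D.
Qed.

End L2theory.

(** * Complex integrals and the inner product *)

Section CIntegral.
Context {R : realType}.
Notation mu := (@lebesgue_measure R).
Implicit Types (f g h : R -> R[i]).

Definition cint h : R[i] := (\int[mu]_x Re (h x)) +i* (\int[mu]_x Im (h x)).
Definition cintegrable h := mu.-integrable setT (fun x => (Re (h x))%:E) /\
                            mu.-integrable setT (fun x => (Im (h x))%:E).

Lemma cintegrable_cmeas h : cintegrable h -> cmeas h.
Proof.
move=> [/measurable_int/measurable_EFinP h1 /measurable_int/measurable_EFinP h2].
by split.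
Qed.

Lemma cintegrable_dom h (g : R -> R) : cmeas h ->
  (forall x, normc (h x) <= g x) -> mu.-integrable setT (fun x => (g x)%:E) ->
  cintegrable h.
Proof.
move=> [m1 m2] hg ig; split.
- apply: le_integrable ig => //; first exact/measurable_EFinP.
  move=> x _ /=; rewrite lee_fin (le_trans (normc_Re _))//.
  by rewrite (le_trans (hg x))// ler_norm.
- apply: le_integrable ig => //; first exact/measurable_EFinP.
  move=> x _ /=; rewrite lee_fin (le_trans (normc_Im _))//.
  by rewrite (le_trans (hg x))// ler_norm.
Qed.

Lemma cintegrable_normc h : cintegrable h -> mu.-integrable setT (fun x => (normc (h x))%:E).
Proof.
move=> hh; have mh := cintegrable_cmeas hh; have [h1 h2] := hh.
have h3 : mu.-integrable setT (fun x => (`|Re (h x)| + `|Im (h x)|)%:E).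
  by under eq_fun do rewrite EFinD -!abse_EFin; apply: integrableD => //; exact: integrable_abse.
apply: le_integrable h3 => //.
  by apply/measurable_EFinP; exact: cmeas_normc.
move=> x _; rewrite !abse_EFin lee_fin ger0_norm//.
by rewrite (le_trans (normc_leReIm _))// ler_norm.
Qed.

Lemma cintegrable_lty h : cmeas h -> (\int[mu]_x (normc (h x))%:E < +oo)%E -> cintegrable h.
Proof.
move=> mh hy; apply: (@cintegrable_dom h (fun x => normc (h x))) => //.
apply/integrableP; split; first by apply/measurable_EFinP; exact: cmeas_normc.
by under eq_integral do rewrite gee0_abs ?lee_fin ?normc_ge0//.
Qed.

Lemma cintegrable_int_lty h : cintegrable h -> (\int[mu]_x (normc (h x))%:E < +oo)%E.
Proof. by move=> /cintegrable_normc; exact: integrable_lty. Qed.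

Lemma cintegrableD f g : cintegrable f -> cintegrable g -> cintegrable (fun x => f x + g x).
Proof.
move=> [f1 f2] [g1 g2]; split.
- by under eq_fun do rewrite ReD EFinD; exact: integrableD.
- by under eq_fun do rewrite ImD EFinD; exact: integrableD.
Qed.

Lemma cintD f g : cintegrable f -> cintegrable g ->
  cint (fun x => f x + g x) = cint f + cint g.
Proof.
move=> [f1 f2] [g1 g2]; apply: complex_ext; rewrite ReImE /cint /=.
- by rewrite -RintegralD//; apply: eq_Rintegral => x _; rewrite ReD.
- by rewrite -RintegralD//; apply: eq_Rintegral => x _; rewrite ImD.
Qed.

Lemma cintegrableZ (c : R[i]) f : cintegrable f -> cintegrable (fun x => c * f x).
Proof.
move=> cf; have mf := cintegrable_cmeas cf.
apply: (@cintegrable_dom _ (fun x => normc c * normc (f x))); first exact: cmeasZ.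
  by move=> x; rewrite normcM.
by under eq_fun do rewrite EFinM; apply: integrableZl => //; exact: cintegrable_normc.
Qed.

Lemma cintZ (c : R[i]) f : cintegrable f -> cint (fun x => c * f x) = c * cint f.
Proof.
move=> [f1 f2].
have iZ (r : R) (u : R -> R) : mu.-integrable setT (fun x => (u x)%:E) ->
   mu.-integrable setT (EFin \o (fun x => r * u x)).
  by move=> iu; rewrite /comp; under eq_fun do rewrite EFinM; exact: integrableZl.
apply: complex_ext; [rewrite ReM|rewrite ImM]; rewrite /cint /=.
- rewrite -!RintegralZl// -RintegralB//; [|exact: iZ|exact: iZ].
  by apply: eq_Rintegral => x _; rewrite ReM.
- rewrite -!RintegralZl// -RintegralD//; [|exact: iZ|exact: iZ].
  by apply: eq_Rintegral => x _; rewrite ImM.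
Qed.

Lemma cintegrableN f : cintegrable f -> cintegrable (fun x => - f x).
Proof. by move=> /(cintegrableZ (-1)); under eq_fun do rewrite mulN1r. Qed.

Lemma cintegrableB f g : cintegrable f -> cintegrable g -> cintegrable (fun x => f x - g x).
Proof. by move=> cf /cintegrableN; exact: cintegrableD. Qed.

Lemma cintN f : cintegrable f -> cint (fun x => - f x) = - cint f.
Proof. by move=> cf; rewrite -mulN1r -cintZ//; congr cint; apply/funext => x; rewrite mulN1r. Qed.

Lemma cintB f g : cintegrable f -> cintegrable g ->
  cint (fun x => f x - g x) = cint f - cint g.
Proof. by move=> cf cg; rewrite cintD// ?cintN//; exact: cintegrableN. Qed.

Lemma eq_cint f g : f =1 g -> cint f = cint g.
Proof. by move=> /funext ->. Qed.

Lemma cintJ f : cintegrable f -> cint (fun x => (f x)^*%C) = (cint f)^*%C.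
Proof.
move=> [f1 f2]; apply: complex_ext; [rewrite ReJ|rewrite ImJ]; rewrite /cint /=.
- by apply: eq_Rintegral => x _; rewrite ReJ.
- rewrite -[RHS]mulN1r -RintegralZl//.
  by apply: eq_Rintegral => x _; rewrite ImJ mulN1r.
Qed.

Lemma cint_real (u : R -> R) : cint (fun x => (u x)%:C) = (\int[mu]_x u x)%:C.
Proof.
apply: complex_ext; rewrite ?ReC ?ImC /cint /=; first exact: eq_Rintegral.
by rewrite /= Rintegral_cst//= ?mul0r.
Qed.

(** The real and imaginary parts are each bounded by [M], whence the factor 2; it reappears squared
    as the 4 of [cauchy_schwarz4]. *)
Lemma normc_cint_le h (M : R) : cmeas h ->
  (\int[mu]_x (normc (h x))%:E <= M%:E)%E -> normc (cint h) <= 2 * M.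
Proof.
move=> mh hM; have hy : (\int[mu]_x (normc (h x))%:E < +oo)%E.
  exact: le_lt_trans hM (ltry _).
have [h1 h2] := cintegrable_lty mh hy; have ih := cintegrable_normc (conj h1 h2).
have bnd (u : R -> R) : mu.-integrable setT (fun x => (u x)%:E) ->
    (forall x, `|u x| <= normc (h x)) -> `|\int[mu]_x u x| <= M.
  move=> iu uh; rewrite (le_trans (le_normr_Rintegral _ _))//.
  rewrite -lee_fin (le_trans _ hM)// /Rintegral fineK; last first.
    apply: integrable_fin_num => //; exact: (integrable_abse iu).
  apply: ge0_le_integral => //.
  - by have /integrable_abse/measurable_int := iu.
  - exact: measurable_int ih.
  - by move=> x _; rewrite lee_fin.
rewrite (le_trans (normc_leReIm _))// mulr_natl mulr2n lerD//= bnd// => x.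
  exact: normc_Re.
exact: normc_Im.
Qed.

(** The weighted inequality $ab\le \frac{s}{2}a^2+\frac{1}{2s}b^2$, integrated. The free weight [s]
    lets the share of one factor be made negligible, and its optimisation gives a Cauchy-Schwarz
    bound. *)
Lemma int_normcM_le f g (s : R) : 0 < s -> cmeas f -> cmeas g ->
  (\int[mu]_x (normc (f x * g x))%:E <=
   (s / 2)%:E * energy f + (2 * s)^-1%:E * energy g)%E.
Proof.
move=> s0 mf mg.
have s2 : 0 <= s / 2 by rewrite divr_ge0// ltW.
have s3 : 0 <= (2 * s)^-1 by rewrite invr_ge0 mulr_ge0// ltW.
have e1 := measurable_energy mf; have e2 := measurable_energy mg.
have p1 (x : R) : (0 <= (normc (f x) ^+ 2)%:E)%E by rewrite lee_fin sqr_ge0.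
have p2 (x : R) : (0 <= (normc (g x) ^+ 2)%:E)%E by rewrite lee_fin sqr_ge0.
rewrite -!ge0_integralZl// -ge0_integralD//.
- apply: ge0_le_integral => //.
  + by move=> x _; rewrite lee_fin.
  + by apply/measurable_EFinP; apply: cmeas_normc; exact: cmeasM.
  + by apply: emeasurable_funD; exact: measurable_funeM.
  + move=> x _; rewrite -!EFinM -EFinD lee_fin normcM.
    set a := normc (f x); set b := normc (g x).
    have : 0 <= (s * a - b) ^+ 2 / (2 * s) by rewrite divr_ge0 ?sqr_ge0// mulr_ge0// ltW.
    rewrite sqrrB.
    have -> : ((s * a) ^+ 2 - s * a * b *+ 2 + b ^+ 2) / (2 * s) =
      s / 2 * a ^+ 2 + (2 * s)^-1 * b ^+ 2 - a * b.
      by rewrite -mulr_natr; field; rewrite gt_eqF.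
    by rewrite subr_ge0.
- by move=> x _; rewrite mule_ge0.
- exact: measurable_funeM.
- by move=> x _; rewrite mule_ge0.
- exact: measurable_funeM.
Qed.

Lemma L2M_integrable f g : L2 f -> L2 g -> cintegrable (fun x => f x * g x).
Proof.
move=> Lf Lg; have mf := L2_cmeas Lf; have mg := L2_cmeas Lg.
apply: cintegrable_lty; first exact: cmeasM.
apply: le_lt_trans (int_normcM_le ltr01 mf mg) _.
by rewrite (L2_energy Lf) (L2_energy Lg) -!EFinM -EFinD ltry.
Qed.

Lemma normc_cintM f g (s : R) : 0 < s -> L2 f -> L2 g ->
  normc (cint (fun x => f x * g x)) <= s * fine (energy f) + s^-1 * fine (energy g).
Proof.
move=> s0 Lf Lg; have mf := L2_cmeas Lf; have mg := L2_cmeas Lg.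
have -> : s * fine (energy f) + s^-1 * fine (energy g) =
  2 * (s / 2 * fine (energy f) + (2 * s)^-1 * fine (energy g)).
  by field; rewrite gt_eqF.
apply: normc_cint_le; first exact: cmeasM.
rewrite EFinD !EFinM -L2_energy// -L2_energy//; exact: int_normcM_le.
Qed.

Lemma inner_cint f g : inner f g = cint (fun x => f x * (g x)^*%C).
Proof. by []. Qed.

Lemma inner_integrable f g : L2 f -> L2 g -> cintegrable (fun x => f x * (g x)^*%C).
Proof. by move=> Lf Lg; apply: L2M_integrable => //; exact: L2J. Qed.

Lemma innerDl f1 f2 g : L2 f1 -> L2 f2 -> L2 g ->
  inner (fun x => f1 x + f2 x) g = inner f1 g + inner f2 g.
Proof.
move=> L1 L2_ Lg; rewrite !inner_cint -cintD//; try exact: inner_integrable.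
by apply: eq_cint => x; rewrite mulrDl.
Qed.

Lemma innerZl (c : R[i]) f g : L2 f -> L2 g ->
  inner (fun x => c * f x) g = c * inner f g.
Proof.
move=> L1 Lg; rewrite !inner_cint -cintZ//; last exact: inner_integrable.
by apply: eq_cint => x; rewrite mulrA.
Qed.

Lemma innerJ f g : L2 f -> L2 g -> inner g f = (inner f g)^*%C.
Proof.
move=> L1 Lg; rewrite !inner_cint -cintJ//; last exact: inner_integrable.
by apply: eq_cint => x; rewrite conjcM conjcK mulrC.
Qed.

Lemma innerDr f1 f2 g : L2 f1 -> L2 f2 -> L2 g ->
  inner g (fun x => f1 x + f2 x) = inner g f1 + inner g f2.
Proof.
move=> L1 L2_ Lg; rewrite innerJ//; last exact: L2D.
by rewrite innerDl// conjcD -!innerJ.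
Qed.

Lemma inner0l g : L2 g -> inner (fun=> 0) g = 0.
Proof.
move=> Lg; rewrite -[RHS](mul0r (inner g g)) -innerZl//; congr inner.
by apply/funext => x; rewrite mul0r.
Qed.

Lemma innerBl f1 f2 g : L2 f1 -> L2 f2 -> L2 g ->
  inner (fun x => f1 x - f2 x) g = inner f1 g - inner f2 g.
Proof.
move=> L1 L2_ Lg; have := innerDl L1 (L2Z (-1) L2_) Lg; rewrite innerZl// mulN1r => <-.
by congr inner; apply/funext => x; rewrite mulN1r.
Qed.

Lemma inner_suml (I : Type) (s : seq I) (c : I -> R[i]) (F : I -> R -> R[i]) g :
  (forall i, L2 (F i)) -> L2 g ->
  inner (fun x => \sum_(i <- s) c i * F i x) g = \sum_(i <- s) c i * inner (F i) g.
Proof.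
move=> LF Lg; elim: s => [|i s IH].
  rewrite big_nil (_ : (fun x => _) = (fun=> 0)) ?inner0l//.
  by apply/funext => x; rewrite big_nil.
rewrite big_cons -IH -innerZl// -innerDl//; last 2 first.
- exact: L2Z.
- by apply: L2_sum => j; exact: L2Z.
by congr inner; apply/funext => x; rewrite big_cons.
Qed.

Lemma inner_energy f : L2 f -> inner f f = (fine (energy f))%:C.
Proof.
move=> Lf; rewrite inner_cint; under eq_cint do rewrite normc_mulJ.
by rewrite cint_real.
Qed.

Lemma inner_small f (e : R) : L2 f -> 0 < e -> exists2 d : R, 0 < d &
  forall g, L2 g -> fine (energy g) < d -> normc (cint (fun x => f x * g x)) < e.
Proof.
move=> Lf e0; pose s := e / (2 * (fine (energy f) + 1)).
have Ef := fine_energy_ge0 f.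
have s0 : 0 < s by rewrite divr_gt0// mulr_gt0// ltr_wpDl.
exists (s * e / 2); first by rewrite divr_gt0// mulr_gt0.
move=> g Lg gd; apply: le_lt_trans (normc_cintM s0 Lf Lg) _.
rewrite (splitr e) ler_ltD//.
  rewrite /s mulrAC ler_pdivrMr ?mulr_gt0 ?ltr_wpDl//.
  have -> : e / 2 * (2 * (fine (energy f) + 1)) = e * (fine (energy f) + 1) by field.
  by rewrite ler_pM2l// lerDl.
rewrite mulrC ltr_pdivrMr//.
by have -> : e / 2 * s = s * e / 2 by field.
Qed.

Lemma energyDo f g : L2 f -> L2 g -> inner f g = 0 ->
  fine (energy (fun x => f x + g x)) = fine (energy f) + fine (energy g).
Proof.
move=> Lf Lg fg; apply: complexI.
rewrite -inner_energy; last exact: L2D.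
rewrite innerDl ?innerDr//; [|exact: L2D].
by rewrite fg (innerJ Lf Lg) fg conjc0 addr0 add0r !inner_energy// rmorphD.
Qed.

End CIntegral.

(** * Goursat's theorem on rectangles *)

Section SegmentIntegral.
Context {R : realType}.
Notation mu := (@lebesgue_measure R).
Implicit Types (u v : R -> R) (a b : R).

Definition sint u a b : R := \int[mu]_(x in `[a, b]) u x.
Definition icont u a b := forall x, a <= x <= b -> {for x, continuous u}.

Lemma icont_integrable u a b : icont u a b -> mu.-integrable `[a, b] (EFin \o u).
Proof.
move=> cu; apply: continuous_compact_integrable; first exact: segment_compact.
apply: continuous_in_subspaceT => x; rewrite inE /= in_itv /=; exact: cu.
Qed.

Lemma sint_split u a m b : a <= m -> m <= b -> icont u a b ->
  sint u a b = sint u a m + sint u m b.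
Proof.
move=> am mb cu; have iu := icont_integrable cu.
have := @Rintegral_itvB R u (BLeft a) (BRight b) m iu; rewrite !bnd_simp => /(_ am mb).
rewrite Rintegral_itv_obnd_cbnd; last first.
  apply: integrableS iu => //; apply: subset_itvr; rewrite bnd_simp; exact: am.
by move/eqP; rewrite subr_eq addrC => /eqP.
Qed.

Lemma sint_bound u a b k (M : R) : a <= b -> icont u a b ->
  (forall x, a <= x <= b -> `|u x - k| <= M) ->
  `|sint u a b - k * (b - a)| <= M * (b - a).
Proof.
move=> ab cu uM.
have muab : fine (mu `[a, b]) = b - a.
  rewrite lebesgue_measure_itv /=; case: ltP => // ba.
  have -> : a = b by apply/eqP; rewrite eq_le ab -lee_fin.
  by rewrite subrr.
have ic c : mu.-integrable `[a, b] (EFin \o (fun=> c : R)).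
  by apply: icont_integrable => x _; exact: cst_continuous.
have e1 : sint u a b <= (k + M) * (b - a).
  rewrite -muab -Rintegral_cst//; apply: le_Rintegral => //.
    exact: icont_integrable.
  move=> x /=; rewrite in_itv/= => /uM; rewrite ler_norml => /andP[_]; lra.
have e2 : (k - M) * (b - a) <= sint u a b.
  rewrite -muab -Rintegral_cst//; apply: le_Rintegral => //.
    exact: icont_integrable.
  move=> x /=; rewrite in_itv/= => /uM; rewrite ler_norml => /andP[+ _]; lra.
rewrite ler_norml; apply/andP; split; lra.
Qed.

End SegmentIntegral.

Section Bisection.
Context {R : realType}.
Variable (J : R -> R -> R -> R -> R).

Let quad (s : R * R * R * R) (i j : bool) :=
  let: (a, b, c, d) := s in let m := (a + b) / 2 in let n := (c + d) / 2 in
  (if i then m else a, if i then b else m, if j then n else c, if j then d else n).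
Let JJ (s : R * R * R * R) := let: (a, b, c, d) := s in J a b c d.
Let good s i j := `|JJ s| <= 4 * `|JJ (quad s i j)|.
Let step s := if good s false false then quad s false false
  else if good s false true then quad s false true
  else if good s true false then quad s true false else quad s true true.
Let xl (s : R * R * R * R) := s.1.1.1.
Let xr (s : R * R * R * R) := s.1.1.2.
Let yl (s : R * R * R * R) := s.1.2.
Let yr (s : R * R * R * R) := s.2.

Lemma nat_pow2_gt (x : R) : exists n, x < 2 ^+ n.
Proof.
exists (Num.truncn x).+1; apply: (lt_le_trans (truncnS_gt x)).
by rewrite -natrX ler_nat ltnW// ltn_expl.
Qed.

Lemma nested_point (l r : nat -> R) :
  (forall n, l n <= l n.+1) -> (forall n, r n.+1 <= r n) -> (forall n, l n <= r n) ->
  exists p, forall n, l n <= p <= r n.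
Proof.
move=> lS rS lr.
have /nondecreasing_seqP lm := lS; have /nonincreasing_seqP rm := rS.
have lrmn m n : l m <= r n.
  by rewrite (le_trans (lm _ _ (leq_maxl m n)))// (le_trans (lr _))// rm// leq_maxr.
exists (sup [set l n | n in setT]) => n; apply/andP; split.
  apply: ub_le_sup; last by exists n.
  by exists (r 0%N) => _ [m _ <-].
by apply: ge_sup; [exists (l 0%N), 0%N|move=> _ [m _ <-]].
Qed.

(** Goursat's bisection in the abstract: [J] is a function of rectangles, additive under vertical
    and horizontal cuts. Repeated quartering keeps a quarter that carries at least a fourth of
    $|J|$; the quarters shrink to a point, where $|J|$ is negligible against the squared size, and
    this forces $J=0$. *)
Lemma bisection a b c d : a < b -> c < d ->
  (forall a' m b' c' d', a <= a' -> a' < m -> m < b' -> b' <= b ->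
     c <= c' -> c' < d' -> d' <= d ->
     J a' b' c' d' = J a' m c' d' + J m b' c' d') ->
  (forall a' b' c' m d', a <= a' -> a' < b' -> b' <= b ->
     c <= c' -> c' < m -> m < d' -> d' <= d ->
     J a' b' c' d' = J a' b' c' m + J a' b' m d') ->
  (forall px py, a <= px <= b -> c <= py <= d -> forall e, 0 < e ->
    exists2 del, 0 < del & forall a' b' c' d', a <= a' -> a' < b' -> b' <= b ->
     c <= c' -> c' < d' -> d' <= d -> a' <= px <= b' -> c' <= py <= d' ->
     b' - a' < del -> d' - c' < del ->
     `|J a' b' c' d'| <= e * ((b' - a') + (d' - c')) ^+ 2) ->
  J a b c d = 0.
Proof.
move=> ab cd addx addy loc.
pose s n := iter n step (a, b, c, d).
have inv n : [/\ a <= xl (s n), xl (s n) < xr (s n), xr (s n) <= b &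
   [/\ c <= yl (s n), yl (s n) < yr (s n) & yr (s n) <= d]].
  elim: n => [|n IH]; first by rewrite /s /= /xl /xr /yl /yr /=.
  rewrite /s iterS -/(s n); move: IH; case: (s n) => [[[a' b'] c'] d'].
  rewrite /xl /xr /yl /yr /= => -[h1 h2 h3 [h4 h5 h6]].
  by rewrite /step /quad; do ! case: ifP => _; rewrite /=; (split; [lra..|split; lra]).
(* If the first three quarters tested all fail, the triangle inequality leaves at least a fourth to
   the last one. *)
have gd n : `|JJ (s n)| <= 4 * `|JJ (s n.+1)|.
  rewrite {2}/s iterS -/(s n); move: (inv n); case: (s n) => [[[a' b'] c'] d'].
  rewrite /xl /xr /yl /yr /= => -[h1 h2 h3 [h4 h5 h6]].
  rewrite /step /good /JJ /quad; case: ifPn => //; rewrite -ltNge => g1.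
  case: ifPn => //; rewrite -ltNge => g2.
  case: ifPn => //; rewrite -ltNge => g3.
  move: g1 g2 g3; rewrite /= => g1 g2 g3.
  have e : J a' b' c' d' = J a' ((a' + b') / 2) c' ((c' + d') / 2) +
    J a' ((a' + b') / 2) ((c' + d') / 2) d' +
    (J ((a' + b') / 2) b' c' ((c' + d') / 2) + J ((a' + b') / 2) b' ((c' + d') / 2) d').
    rewrite (addx a' ((a' + b') / 2) b' c' d'); [|lra..].
    by congr (_ + _); apply: addy; lra.
  have := ler_normD (J a' ((a' + b') / 2) c' ((c' + d') / 2) +
    J a' ((a' + b') / 2) ((c' + d') / 2) d')
    (J ((a' + b') / 2) b' c' ((c' + d') / 2) + J ((a' + b') / 2) b' ((c' + d') / 2) d').
  rewrite -e.
  have := ler_normD (J a' ((a' + b') / 2) c' ((c' + d') / 2)) (J a' ((a' + b') / 2) ((c' + d') / 2) d').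
  have := ler_normD (J ((a' + b') / 2) b' c' ((c' + d') / 2)) (J ((a' + b') / 2) b' ((c' + d') / 2) d').
  lra.
have gn n : `|J a b c d| <= 4 ^+ n * `|JJ (s n)|.
  elim: n => [|n IH]; first by rewrite expr0 mul1r.
  rewrite (le_trans IH)// exprSr -mulrA ler_wpM2l// exprn_ge0//.
have wd n : (xr (s n) - xl (s n) = (b - a) / 2 ^+ n) /\ (yr (s n) - yl (s n) = (d - c) / 2 ^+ n).
  elim: n => [|n [IH1 IH2]]; first by rewrite expr0 !divr1.
  have -> : (b - a) / 2 ^+ n.+1 = (xr (s n) - xl (s n)) / 2.
    by rewrite IH1 exprSr invfM mulrA.
  have -> : (d - c) / 2 ^+ n.+1 = (yr (s n) - yl (s n)) / 2.
    by rewrite IH2 exprSr invfM mulrA.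
  rewrite /s iterS -/(s n); case: (s n) => [[[a' b'] c'] d'].
  by rewrite /xl /xr /yl /yr /= /step /quad; do ! case: ifP => _; rewrite /=; split; field.
have mon n : [/\ xl (s n) <= xl (s n.+1), xr (s n.+1) <= xr (s n),
    yl (s n) <= yl (s n.+1) & yr (s n.+1) <= yr (s n)].
  have -> : s n.+1 = step (s n) by [].
  move: (inv n); case: (s n) => [[[a' b'] c'] d'].
  rewrite /xl /xr /yl /yr /= => -[h1 h2 h3 [h4 h5 h6]].
  by rewrite /step /quad; do ! case: ifP => _; rewrite /=; split; lra.
have [px hpx] : exists p, forall n, xl (s n) <= p <= xr (s n).
  by apply: nested_point => n; [case: (mon n)|case: (mon n)|apply: ltW; case: (inv n)].
have [py hpy] : exists p, forall n, yl (s n) <= p <= yr (s n).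
  by apply: nested_point => n; [case: (mon n)|case: (mon n)|apply: ltW; case: (inv n) => _ _ _ []].
apply/eqP; rewrite -normr_eq0; apply/negPn/negP => J0.
have {}J0 : 0 < `|J a b c d| by rewrite lt_def J0 normr_ge0.
pose L := (b - a) + (d - c).
have L0 : 0 < L by rewrite /L; lra.
(* After [n] quarterings the size is $L/2^n$, so this tolerance bounds $|J|$ by $4^n\cdot
   e\,(L/2^n)^2=|J|/2$, a contradiction. *)
have e0 : 0 < `|J a b c d| / (2 * L ^+ 2) by rewrite divr_gt0// mulr_gt0// exprn_gt0.
have [del del0 H] := loc px py (hpx 0%N) (hpy 0%N) _ e0.
have [n nL] := nat_pow2_gt (L / del).
have small : L / 2 ^+ n < del.
  by rewrite ltr_pdivrMr ?exprn_gt0// mulrC -ltr_pdivrMr.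
have [i1 i2 i3 [i4 i5 i6]] := inv n.
have [w1 w2] := wd n.
have p0 : 0 < (2 : R) ^+ n by rewrite exprn_gt0.
have sm1 : xr (s n) - xl (s n) < del.
  by rewrite w1 (le_lt_trans _ small)// ler_pM2r ?invr_gt0// /L; lra.
have sm2 : yr (s n) - yl (s n) < del.
  by rewrite w2 (le_lt_trans _ small)// ler_pM2r ?invr_gt0// /L; lra.
have := H _ _ _ _ i1 i2 i3 i4 i5 i6 (hpx n) (hpy n) sm1 sm2.
rewrite w1 w2.
rewrite -mulrDl -/L exprMn.
have -> : J (xl (s n)) (xr (s n)) (yl (s n)) (yr (s n)) = JJ (s n).
  by case: (s n) => [[[]]].
move=> hh; have := gn n; rewrite leNgt => /negP; apply.
apply: (@le_lt_trans _ _ (`|J a b c d| / 2)); last by lra.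
rewrite (le_trans (ler_wpM2l _ hh)) ?exprn_ge0//.
have -> : (4 : R) ^+ n = 2 ^+ n ^+ 2 by rewrite -exprM mulnC exprM; congr (_ ^+ _); ring.
rewrite le_eqVlt; apply/orP; left; apply/eqP; field.
by rewrite !gt_eqF.
Qed.

End Bisection.

Section Goursat.
Context {R : realType}.
Notation mu := (@lebesgue_measure R).
Implicit Types (F : R[i] -> R[i]) (z w p : R[i]).

Definition ccont F z := forall e : R, 0 < e ->
  exists2 d : R, 0 < d & forall h, normc h < d -> normc (F (z + h) - F z) < e.

Lemma cdiff_ccont F z L : cdiff F z L -> ccont F z.
Proof.
move=> dF e e0; have [d d0 H] := dF _ ltr01.
exists (Num.min d (e / (2 + normc L))).
  by rewrite lt_min d0 divr_gt0// ltr_wpDr.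
move=> h; rewrite lt_min => /andP[/H hd].
rewrite ltr_pdivlMr ?ltr_wpDr// => he.
have -> : F (z + h) - F z = (F (z + h) - F z - L * h) + L * h by rewrite subrK.
rewrite (le_lt_trans (normcD _ _))// normcM.
have := normc_ge0 h; have := normc_ge0 L; move: hd; nra.
Qed.

Lemma ccont_line F z w : normc w = 1 -> ccont F z -> forall e : R, 0 < e ->
  exists2 d : R, 0 < d & forall t : R, `|t| < d -> normc (F (z + t%:C * w) - F z) < e.
Proof.
move=> w1 cF e /cF[d d0 H]; exists d => // t td; apply: H.
by rewrite normcM normc_real w1 mulr1.
Qed.

Lemma continuous_hline F (a b c : R) : (forall x : R, a <= x <= b -> ccont F (x +i* c)) ->
  icont (fun x => Re (F (x +i* c))) a b /\ icont (fun x => Im (F (x +i* c))) a b.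
Proof.
move=> cF; suff H x : a <= x <= b -> forall e : R, 0 < e ->
    \forall y \near x, normc (F (y +i* c) - F (x +i* c)) < e.
  split=> x xab; apply/cvgrPdist_lt => e e0; near=> y; rewrite distrC.
    by rewrite -ReB (le_lt_trans (normc_Re _))//; near: y; exact: H.
  by rewrite -ImB (le_lt_trans (normc_Im _))//; near: y; exact: H.
move=> xab e e0; have [d d0 hd] := ccont_line (normc1 R) (cF x xab) e0.
near=> y; have -> : y +i* c = x +i* c + (y - x)%:C * 1.
  by apply: complex_ext; rewrite mulr1 !ReImE /=; lra.
apply: hd; rewrite distrC; near: y; exact: (nbhsx_ballx x d d0).
Unshelve. all: by end_near. Qed.

Lemma continuous_vline F (a b c : R) : (forall x : R, a <= x <= b -> ccont F (c +i* x)) ->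
  icont (fun x => Re (F (c +i* x))) a b /\ icont (fun x => Im (F (c +i* x))) a b.
Proof.
move=> cF; suff H x : a <= x <= b -> forall e : R, 0 < e ->
    \forall y \near x, normc (F (c +i* y) - F (c +i* x)) < e.
  split=> x xab; apply/cvgrPdist_lt => e e0; near=> y; rewrite distrC.
    by rewrite -ReB (le_lt_trans (normc_Re _))//; near: y; exact: H.
  by rewrite -ImB (le_lt_trans (normc_Im _))//; near: y; exact: H.
move=> xab e e0; have [d d0 hd] := ccont_line (normc_i (R := R)) (cF x xab) e0.
near=> y; have -> : c +i* y = c +i* x + (y - x)%:C * 'i%C.
  by apply: complex_ext; rewrite !ReImE /=; lra.
apply: hd; rewrite distrC; near: y; exact: (nbhsx_ballx x d d0).
Unshelve. all: by end_near. Qed.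

(* The real part of the integral of F along the boundary of [a, b] x [c, d]. *)
Definition Jrect F a b c d : R :=
  sint (fun x => Re (F (x +i* c))) a b - sint (fun x => Re (F (x +i* d))) a b
  - sint (fun y => Im (F (b +i* y))) c d + sint (fun y => Im (F (a +i* y))) c d.

Lemma Jrect_splitx F a m b c d : a <= m -> m <= b -> c <= d ->
  (forall x y : R, a <= x <= b -> c <= y <= d -> ccont F (x +i* y)) ->
  Jrect F a b c d = Jrect F a m c d + Jrect F m b c d.
Proof.
move=> am mb cd cF; rewrite /Jrect.
rewrite (sint_split am mb); last by case: (@continuous_hline F a b c) => // x xab; apply: cF => //; rewrite lexx.
rewrite (@sint_split _ (fun x => Re (F (x +i* d))) a m b am mb); last by case: (@continuous_hline F a b d) => // x xab; apply: cF => //; rewrite lexx andbT.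
ring.
Qed.

Lemma Jrect_splity F a b c m d : a <= b -> c <= m -> m <= d ->
  (forall x y : R, a <= x <= b -> c <= y <= d -> ccont F (x +i* y)) ->
  Jrect F a b c d = Jrect F a b c m + Jrect F a b m d.
Proof.
move=> ab cm md cF; rewrite /Jrect.
rewrite (@sint_split _ (fun y => Im (F (b +i* y))) c m d cm md); last by case: (@continuous_vline F c d b) => // x xab; apply: cF => //; rewrite lexx andbT.
rewrite (@sint_split _ (fun y => Im (F (a +i* y))) c m d cm md); last by case: (@continuous_vline F c d a) => // x xab; apply: cF => //; rewrite lexx.
ring.
Qed.

Lemma sint_diff_bound u v (a b k M : R) : a <= b -> icont u a b -> icont v a b ->
  (forall x, a <= x <= b -> `|u x - v x - k| <= M) ->
  `|sint u a b - sint v a b - k * (b - a)| <= M * (b - a).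
Proof.
move=> ab cu cv H.
have <- : sint (fun x => u x - v x) a b = sint u a b - sint v a b.
  by apply: RintegralB => //; exact: icont_integrable.
apply: sint_bound => // x xab; apply: cvgB; [exact: cu|exact: cv].
Qed.

(** By [bisection] only small rectangles around a point matter. There $F$ is affine up to a
    remainder; the affine part integrates to 0 around a rectangle, and the remainder contributes at
    most [e] times the squared size. *)
Theorem goursat F a b c d : a < b -> c < d ->
  (forall x y : R, a <= x <= b -> c <= y <= d -> exists L, cdiff F (x +i* y) L) ->
  Jrect F a b c d = 0.
Proof.
move=> ab cd dF.
have cF x y : a <= x <= b -> c <= y <= d -> ccont F (x +i* y).
  by move=> xab ycd; have [L] := dF x y xab ycd; exact: cdiff_ccont.
apply: (bisection ab cd).
- move=> a' m b' c' d' *; apply: Jrect_splitx; [lra..|].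
  by move=> x y ? ?; apply: cF; lra.
- move=> a' b' c' m d' *; apply: Jrect_splity; [lra..|].
  by move=> x y ? ?; apply: cF; lra.
move=> px py hx hy e e0; have [L dL] := dF px py hx hy.
have e2 : 0 < e / 2 by lra.
have [del del0 H] := dL _ e2.
exists (del / 2); first by lra.
move=> a' b' c' d' h1 h2 h3 h4 h5 h6 hpx hpy sx sy.
set s := (b' - a') + (d' - c').
have s0 : 0 < s by rewrite /s; lra.
pose r x y := F (x +i* y) - F (px +i* py) - L * ((x - px) +i* (y - py)).
have rb x y : a' <= x <= b' -> c' <= y <= d' -> normc (r x y) <= e / 2 * s.
  move=> hx' hy'; have hs : normc ((x - px) +i* (y - py)) <= s.
    rewrite (le_trans (normc_leReIm _))//= /s lerD// ler_norml; lra.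
  have -> : r x y = F (px +i* py + ((x - px) +i* (y - py))) - F (px +i* py) - L * ((x - px) +i* (y - py)).
    by rewrite /r; congr (F _ - _ - _); apply: complex_ext; rewrite !ReImE /=; lra.
  apply: le_trans (H _ _) _; first by apply: le_lt_trans hs _; rewrite /s; lra.
  by rewrite ler_wpM2l// ltW.
have cF' x y : a' <= x <= b' -> c' <= y <= d' -> ccont F (x +i* y).
  by move=> ? ?; apply: cF; lra.
have ha : a' <= a' <= b' by lra.
have hb : a' <= b' <= b' by lra.
have hc : c' <= c' <= d' by lra.
have hd : c' <= d' <= d' by lra.
have FE x y : F (x +i* y) = F (px +i* py) + L * ((x - px) +i* (y - py)) + r x y.
  by rewrite /r; ring.
(* Each of the two pairs of opposite sides gets $\Im L$ times the area from the affine part; in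
   [Jrect] the two contributions cancel. *)
have B1 : `|sint (fun x => Re (F (x +i* c'))) a' b' - sint (fun x => Re (F (x +i* d'))) a' b'
   - (Im L * (d' - c')) * (b' - a')| <= (e * s) * (b' - a').
  apply: sint_diff_bound; first by lra.
  - by apply: (@continuous_hline F a' b' c' _).1 => x hx'; exact: cF'.
  - by apply: (@continuous_hline F a' b' d' _).1 => x hx'; exact: cF'.
  move=> x hx'.
  have -> : Re (F (x +i* c')) - Re (F (x +i* d')) - Im L * (d' - c') =
    Re (r x c') - Re (r x d').
    by rewrite (FE x c') (FE x d') !ReImE /=; ring.
  have -> : e * s = e / 2 * s + e / 2 * s by field.
  rewrite (le_trans (ler_normB _ _))// lerD//.
    by rewrite (le_trans (normc_Re _))// rb.
  by rewrite (le_trans (normc_Re _))// rb.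
have B2 : `|sint (fun y => Im (F (b' +i* y))) c' d' - sint (fun y => Im (F (a' +i* y))) c' d'
   - (Im L * (b' - a')) * (d' - c')| <= (e * s) * (d' - c').
  apply: sint_diff_bound; first by lra.
  - by apply: (@continuous_vline F c' d' b' _).2 => x hx'; exact: cF'.
  - by apply: (@continuous_vline F c' d' a' _).2 => x hx'; exact: cF'.
  move=> y hy'.
  have -> : Im (F (b' +i* y)) - Im (F (a' +i* y)) - Im L * (b' - a') =
    Im (r b' y) - Im (r a' y).
    by rewrite (FE b' y) (FE a' y) !ReImE /=; ring.
  have -> : e * s = e / 2 * s + e / 2 * s by field.
  rewrite (le_trans (ler_normB _ _))// lerD//.
    by rewrite (le_trans (normc_Im _))// rb.
  by rewrite (le_trans (normc_Im _))// rb.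
rewrite /Jrect; move: B1 B2.
set S1 := sint _ a' b'; set S2 := sint _ a' b'; set S3 := sint _ c' d'; set S4 := sint _ c' d'.
have -> : e * s ^+ 2 = e * s * (b' - a') + e * s * (d' - c') by rewrite /s; ring.
have -> : S1 - S2 - S3 + S4 = (S1 - S2 - Im L * (d' - c') * (b' - a')) -
  (S3 - S4 - Im L * (b' - a') * (d' - c')) by ring.
by move=> B1 B2; rewrite (le_trans (ler_normB _ _))// lerD.
Qed.

Lemma Jrect_bound F a b c d (M : R) : a <= b -> c <= d ->
  (forall x y : R, a <= x <= b -> c <= y <= d -> ccont F (x +i* y)) ->
  (forall x y : R, a <= x <= b -> c <= y <= d -> normc (F (x +i* y)) <= M) ->
  `|Jrect F a b c d| <= 2 * M * ((b - a) + (d - c)).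
Proof.
move=> ab cd cF FM.
have ha : a <= a <= b by lra.
have hb : a <= b <= b by lra.
have hc : c <= c <= d by lra.
have hd : c <= d <= d by lra.
have P1 y : c <= y <= d -> `|sint (fun x => Re (F (x +i* y))) a b| <= M * (b - a).
  move=> hy; have := @sint_bound _ (fun x => Re (F (x +i* y))) a b 0 M ab.
  rewrite mul0r subr0; apply.
    by apply: (@continuous_hline F a b y _).1 => x hx'; exact: cF.
  by move=> x hx; rewrite subr0 (le_trans (normc_Re _))// FM.
have P2 x : a <= x <= b -> `|sint (fun y => Im (F (x +i* y))) c d| <= M * (d - c).
  move=> hy; have := @sint_bound _ (fun y => Im (F (x +i* y))) c d 0 M cd.
  rewrite mul0r subr0; apply.
    by apply: (@continuous_vline F c d x _).2 => y hy'; exact: cF.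
  by move=> y hx; rewrite subr0 (le_trans (normc_Im _))// FM.
have := P1 c hc; have := P1 d hd; have := P2 a ha; have := P2 b hb.
rewrite /Jrect !ler_norml; lra.
Qed.

(** A point where $F$ is merely continuous is harmless: the four surrounding rectangles vanish by
    [goursat], and the remaining square of side $2t$ contributes $O(t)$ because $F$ is bounded
    there. This serves difference quotients at their base point. *)
Theorem goursat_except F p a b c d : a < Re p < b -> c < Im p < d ->
  (forall x y : R, a <= x <= b -> c <= y <= d -> ccont F (x +i* y)) ->
  (forall x y : R, a <= x <= b -> c <= y <= d -> x +i* y != p ->
     exists L, cdiff F (x +i* y) L) ->
  Jrect F a b c d = 0.
Proof.
case: p => px py /= hx hy cF dF.
have dF' x y : a <= x <= b -> c <= y <= d -> x != px \/ y != py ->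
    exists L, cdiff F (x +i* y) L.
  by move=> h1 h2 h; apply: dF => //; rewrite eq_complex /= negb_and; apply/orP.
have [del del0 H] := cF px py ltac:(lra) ltac:(lra) _ ltr01.
pose M := normc (F (px +i* py)) + 1.
have M0 : 0 < M by rewrite ltr_wpDl.
apply/eqP; rewrite -normr_le0; apply/ler_addgt0Pr => e e0; rewrite add0r.
(* The terms keep the square inside the rectangle and inside the disc where $|F|\le M$;
   [e / (8 * M)] matches the bound $2M(2t+2t)$ of [Jrect_bound]. *)
pose t := Num.min (Num.min (del / 4) (e / (8 * M))) (Num.min (Num.min ((px - a)/2) ((b - px)/2)) (Num.min ((py - c)/2) ((d - py)/2))).
have t0 : 0 < t.
  rewrite /t !lt_min; do ! (apply/andP; split); try lra.
  by rewrite divr_gt0// mulr_gt0.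
have : t <= t by [].
rewrite {2}/t !le_min => /andP[/andP[t1 t2] /andP[/andP[t3 t4] /andP[t5 t6]]].
clearbody t.
rewrite (@Jrect_splitx F a (px - t) b c d); [|lra..|by []].
rewrite (@goursat F a (px - t) c d); [|lra..|]; last first.
  by move=> x y h1 h2; apply: dF'; [lra|lra|left; rewrite lt_eqF//; lra].
rewrite (@Jrect_splitx F (px - t) (px + t) b c d); [|lra..|]; last first.
  by move=> x y h1 h2; apply: cF; lra.
rewrite (@goursat F (px + t) b c d); [|lra..|]; last first.
  by move=> x y h1 h2; apply: dF'; [lra|lra|left; rewrite gt_eqF//; lra].
rewrite (@Jrect_splity F (px - t) (px + t) c (py - t) d); [|lra..|]; last first.
  by move=> x y h1 h2; apply: cF; lra.
rewrite (@goursat F (px - t) (px + t) c (py - t)); [|lra..|]; last first.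
  by move=> x y h1 h2; apply: dF'; [lra|lra|right; rewrite lt_eqF//; lra].
rewrite (@Jrect_splity F (px - t) (px + t) (py - t) (py + t) d); [|lra..|]; last first.
  by move=> x y h1 h2; apply: cF; lra.
rewrite (@goursat F (px - t) (px + t) (py + t) d); [|lra..|]; last first.
  by move=> x y h1 h2; apply: dF'; [lra|lra|right; rewrite gt_eqF//; lra].
rewrite !(add0r, addr0).
apply: (@le_trans _ _ (2 * M * ((px + t - (px - t)) + (py + t - (py - t))))).
  apply: Jrect_bound; [lra|lra|by move=> x y h1 h2; apply: cF; lra|].
  move=> x y h1 h2; rewrite /M -lerBlDl (le_trans (normcBl _ _))// ltW//.
  have -> : x +i* y = px +i* py + ((x - px) +i* (y - py)).
    by apply: complex_ext; rewrite !ReImE /=; lra.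
  apply: H; rewrite (le_lt_trans (normc_leReIm _))//=.
  apply: (@le_lt_trans _ _ (t + t)); last by lra.
  by rewrite lerD// ler_norml; lra.
move: t2; rewrite ler_pdivlMr ?mulr_gt0//; lra.
Qed.

End Goursat.

(** * Cauchy's theorem along a horizontal line *)

Section LineTools.
Context {R : realType}.
Notation mu := (@lebesgue_measure R).

(** A function measurable in [x] and continuous in [y] is the limit of step functions in [y] on the
    grid of mesh $1/(n+1)$; the indicator leaves finitely many cells. The joint measurability is
    needed for Tonelli on the vertical sides. *)
Lemma joint_measurable (g : R -> R -> R) (N : nat) :
  (forall y, 0 <= y -> measurable_fun setT (g ^~ y)) ->
  (forall x y, 0 <= y -> forall e, 0 < e -> exists2 d, 0 < d &
     forall y', 0 <= y' -> `|y' - y| < d -> `|g x y' - g x y| < e) ->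
  measurable_fun setT (fun p : R * R => g p.1 p.2 * \1_(`[0, N%:R[ : set R) p.2).
Proof.
move=> mg cg.
pose I (n k : nat) : set R := `[k%:R / n.+1%:R, k.+1%:R / n.+1%:R[%classic.
pose f (n : nat) (p : R * R) := \sum_(k < N * n.+1)
  g p.1 (k%:R / n.+1%:R) * \1_(I n k) p.2.
apply: (@measurable_realfun.measurable_fun_cvg _ _ _ _ f).
  move=> n; apply: measurable_sum => k.
  apply: measurable_funM.
    have : measurable_fun setT (g ^~ (k%:R / n.+1%:R)) by apply: mg; rewrite divr_ge0.
    by move=> /measurableT_comp; apply; exact: measurable_fst.
  have : measurable_fun setT (\1_(I n k) : R -> R).
    by apply: measurable_indic; exact: measurable_itv.
  by move=> /measurableT_comp; apply; exact: measurable_snd.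
move=> [x y] _ /=.
have [y0|y0] := boolP (0 <= y < N%:R); last first.
  rewrite [X in _ --> X](_ : _ = 0); last by rewrite indicE memNset ?mulr0//= in_itv/=; apply/negP.
  rewrite (_ : (fun n => _) = cst 0); first exact: cvg_cst.
  apply/funext => n /=; rewrite /f big1// => k _.
  rewrite indicE memNset ?mulr0// /I /= in_itv/= => /andP[ky yk].
  move/negP : y0; apply; rewrite (le_trans _ ky) ?divr_ge0//=.
  rewrite (lt_le_trans yk)// ler_pdivrMr// -natrM ler_nat; exact: ltn_ord.
have /andP[y1 y2] := y0.
rewrite indicE mem_set ?mulr1//= ?in_itv//=.
apply/cvgrPdist_lt => e e0; have [d d0 H] := cg x y y1 _ e0.
near=> n.
have n0 : (0 : R) < n.+1%:R by [].
pose k := Num.truncn (y * n.+1%:R).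
have /andP[k1 k2] : k%:R <= y * n.+1%:R < k.+1%:R.
  by apply: truncn_itv; rewrite mulr_ge0.
have kN : (k < N * n.+1)%N.
  by rewrite -(ltr_nat R) (le_lt_trans k1)// natrM ltr_pM2r.
have -> : f n (x, y) = g x (k%:R / n.+1%:R).
  rewrite /f (bigD1 (Ordinal kN))//= indicE mem_set ?mulr1; last first.
    by rewrite /I /= in_itv/= ler_pdivrMr// k1/= ltr_pdivlMr.
  rewrite big1 ?addr0// => j jk; rewrite indicE memNset ?mulr0//.
  rewrite /I /= in_itv/= ler_pdivrMr// ltr_pdivlMr// => /andP[j1 j2].
  move/eqP: jk; apply; apply: val_inj => /=; apply/eqP; rewrite eqn_leq.
  by rewrite -(ltnS j) -(ltnS k) -!(ltr_nat R) (le_lt_trans j1 k2) (le_lt_trans k1 j2).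
rewrite distrC; apply: H; first by rewrite divr_ge0.
have e1 : y - k%:R / n.+1%:R = (y * n.+1%:R - k%:R) / n.+1%:R.
  by rewrite mulrBl mulfK// gt_eqF.
have e2 : `|y - k%:R / n.+1%:R| <= n.+1%:R^-1.
  rewrite e1 normrM ger0_norm ?subr_ge0// ger0_norm ?invr_ge0//.
  by rewrite ler_piMl ?invr_ge0// lerBlDl ltW// natr1.
rewrite distrC; apply: le_lt_trans e2 _.
near: n; exact: near_infty_natSinv_lt (PosNum d0).
Unshelve. all: by end_near. Qed.

(** Dominated convergence makes the integral of $|u|$ off $[-n,n]$ small; the two end points may
    then move independently beyond [n]. *)
Lemma integral_cvg_line (u : R -> R) : mu.-integrable setT (EFin \o u) ->
  forall e, 0 < e -> exists X0, forall X X', X0 <= X -> X0 <= X' ->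
    `|\int[mu]_x u x - sint u (- X') X| <= e.
Proof.
move=> iu e e0.
have mu_ : measurable_fun setT u by apply/measurable_EFinP; exact: measurable_int iu.
pose A n : set R := ~` `[- n%:R, n%:R]%classic.
have mA n : measurable (A n) by apply: measurableC; exact: measurable_itv.
pose f n (x : R) : \bar R := (`|u x| * \1_(A n) x)%:E.
have mf n : measurable_fun setT (f n).
  apply/measurable_EFinP; apply: measurable_funM; first exact: measurableT_comp.
  exact: measurable_indic.
have f0 x : f^~ x @ \oo --> 0%E.
  apply: cvg_near_cst; near=> n; rewrite /f indicE memNset ?mulr0// /A /= in_itv/= => h; apply: h.
  rewrite -ler_norml; near: n; exact: nbhs_infty_ger.
have cf : (\int[mu]_x f n x)%E @[n --> \oo] --> (\int[mu]_(x in setT) (cst 0 x))%E.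
  apply: (@dominated_cvg _ _ _ mu setT _ f (cst 0%E) (fun x => `|(u x)%:E|%E)) => //.
  - exact: integrable_abse.
  - move=> n x _; rewrite /f abse_EFin lee_fin normrM normr_id ler_piMr//.
    by rewrite indicE; case: (_ \in _) => /=; rewrite ?normr1 ?normr0.
rewrite integral_cst//= mul0e in cf.
have /fine_cvgP[fin /cvgrPdist_le/(_ _ e0) ce] := cf.
near \oo => n.
have fn : (\int[mu]_x f n x)%E \is a fin_num by near: n; exact: fin.
have ce' : `|0 - fine (\int[mu]_x f n x)%E| <= e by near: n; exact: ce.
exists n%:R => X X' nX nX'.
have mI : measurable `[- X', X]%classic by exact: measurable_itv.
have -> : \int[mu]_x u x - sint u (- X') X = \int[mu]_(x in ~` `[- X', X]) u x.
  rewrite -[setT](setUv `[- X', X]%classic) Rintegral_setU//.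
  - by rewrite /sint addrAC subrr add0r.
  - exact: measurableC.
  - by rewrite setUv.
  - by apply/disj_setPS; rewrite setICr.
have iuC : mu.-integrable (~` `[- X', X]) (EFin \o u).
  by apply: integrableS iu => //; exact: measurableC.
rewrite (le_trans (le_normr_Rintegral _ iuC))//; first exact: measurableC.
rewrite sub0r normrN in ce'; apply: le_trans ce'; rewrite ger0_norm; last first.
  by apply: fine_ge0; apply: integral_ge0 => x _; rewrite lee_fin mulr_ge0.
rewrite /Rintegral fine_le//.
  apply: integrable_fin_num; first exact: measurableC.
  exact: (integrable_abse iuC).
rewrite [leLHS]integral_mkcond; apply: ge0_le_integral => //.
- by move=> x _; rewrite patchE; case: ifP => // _; rewrite lee_fin.
- have [+ _] := measurable_restrictT (fun x => `|u x|%:E) (measurableC mI); apply.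
  by apply/measurable_EFinP; apply: measurableT_comp => //; exact: measurable_funTS.
- exact: mf.
move=> x _; rewrite patchE /f; case: ifPn => [xI|_]; last first.
  by rewrite lee_fin mulr_ge0.
rewrite indicE mem_set ?mulr1// /A /= => h; move: xI; rewrite inE /=; apply.
move: h; rewrite !in_itv/= => /andP[h2 h3]; apply/andP; split; lra.
Unshelve. all: by end_near. Qed.

End LineTools.

Section LineCauchy.
Context {R : realType}.
Notation mu := (@lebesgue_measure R).
Implicit Types (g : R[i] -> R[i]) (z w p : R[i]).

Lemma continuous_cmeas g (c : R) : (forall x : R, ccont g (x +i* c)) ->
  cmeas (fun x => g (x +i* c)).
Proof.
move=> cg; have H (x : R) := @continuous_hline R g x x c (fun y _ => cg y).
have xx (x : R) : x <= x <= x by rewrite lexx.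
by split; apply: continuous_measurable_fun => x; [exact: (H x).1|exact: (H x).2].
Qed.

Lemma le_sint_abs (u : R -> R) (v : R -> R) (a b e : R) : icont u a b ->
  measurable_fun setT v ->
  (forall x, a <= x <= b -> `|u x| <= v x) -> (forall x, 0 <= v x) ->
  (\int[mu]_x (v x)%:E <= e%:E)%E -> `|sint u a b| <= e.
Proof.
move=> cu mv uv v0 ve; have iu := icont_integrable cu.
rewrite (le_trans (le_normr_Rintegral _ iu))//.
rewrite -lee_fin (le_trans _ ve)// /Rintegral fineK; last first.
  by apply: integrable_fin_num => //; exact: (integrable_abse iu).
apply: (@le_trans _ _ (\int[mu]_(x in `[a, b]) (v x)%:E)%E).
  apply: ge0_le_integral => //.
  - by have /integrable_abse/measurable_int := iu.
  - by apply/measurable_EFinP; exact: measurable_funTS.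
by apply: ge0_subset_integral => //; [apply/measurable_EFinP|move=> x _; rewrite lee_fin].
Qed.

Lemma side_measurable g (N : nat) : (forall z, 0 <= Im z -> ccont g z) ->
  measurable_fun setT (fun q : R * R => (normc (g (q.1 +i* q.2)) * \1_(`[0%R, N%:R[ : set R) q.2)%:E).
Proof.
move=> cg.
apply/measurable_EFinP; apply: (@joint_measurable _ (fun x y => normc (g (x +i* y)))).
  by move=> y y0; apply: cmeas_normc; apply: continuous_cmeas => x; exact: cg.
move=> x y y0 e e0; have [d d0 H] := ccont_line (normc_i (R := R)) (cg (x +i* y) y0) e0.
exists d => // y' y'0 yy'.
have := H _ yy'; rewrite (_ : x +i* y + _ = x +i* y'); last first.
  by apply: complex_ext; rewrite !ReImE; lra.
apply: le_lt_trans; rewrite ler_norml lerNl opprB.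
by rewrite normcB normcBl normcB normcBl.
Qed.

(** Tonelli: integrating the vertical sides over all abscissae is integrating the horizontal lines
    over heights below [N], and each of these is at most [M]. *)
Lemma side_integral g (N : nat) (M : R) :
  (forall z, 0 <= Im z -> ccont g z) ->
  (forall y : R, 0 <= y -> (\int[mu]_x (normc (g (x +i* y)))%:E <= M%:E)%E) ->
  measurable_fun setT (fun X => \int[mu]_y (normc (g (X +i* y)) * \1_(`[0%R, N%:R[ : set R) y)%:E)%E /\
  (\int[mu]_X \int[mu]_y (normc (g (X +i* y)) * \1_(`[0%R, N%:R[ : set R) y)%:E <= (M * N%:R)%:E)%E.
Proof.
move=> cg gM.
pose f (q : R * R) := (normc (g (q.1 +i* q.2)) * \1_(`[0%R, N%:R[ : set R) q.2)%:E.
have mf : measurable_fun setT f := side_measurable N cg.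
have f0 q : (0 <= f q)%E by rewrite lee_fin mulr_ge0.
split; first exact: (@measurable_fun_fubini_tonelli_F _ _ _ _ R mu f mf f0).
rewrite (@fubini_tonelli _ _ _ _ R mu mu f mf f0).
apply: (@le_trans _ _ (\int[mu]_y (M%:E * (\1_(`[0%R, N%:R[ : set R) y)%:E))%E).
  have mG := @measurable_fun_fubini_tonelli_G _ _ _ _ R mu f mf f0.
  apply: ge0_le_integral => //.
  - by move=> y _; exact: integral_ge0.
  - by apply/measurable_EFinP; apply: measurable_funM => //; exact: measurable_indic.
  move=> y _; rewrite /f /= indicE; have [yN|yN] := boolP (y \in _).
    under eq_integral do rewrite mulr1.
    rewrite mule1; apply: gM.
    by move: yN; rewrite inE /= in_itv/= => /andP[].
  under eq_integral do rewrite mulr0.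
  by rewrite integral0 mule0.
have M0 : 0 <= M.
  by rewrite -lee_fin (le_trans _ (gM 0 (lexx 0)))//; apply: integral_ge0 => x _; rewrite lee_fin.
rewrite ge0_integralZl//.
- rewrite integral_indic// setIT /= lebesgue_measure_itv /=.
  case: ifPn => _; first by rewrite sube0 EFinM.
  by rewrite mule0 lee_fin mulr_ge0.
- by apply/measurable_EFinP; exact: measurable_indic.
Qed.

(** If every side over [D] had integral above [e], their total would be infinite, against
    [side_integral]. Thus the contour can be closed far away on the strength of integral bounds
    alone. *)
Lemma side_small g (N : nat) (M e : R) (D : set R) :
  (forall z, 0 <= Im z -> ccont g z) ->
  (forall y : R, 0 <= y -> (\int[mu]_x (normc (g (x +i* y)))%:E <= M%:E)%E) ->
  measurable D -> mu D = +oo%E -> 0 < e ->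
  exists2 X, D X & (\int[mu]_y (normc (g (X +i* y)) * \1_(`[0%R, N%:R[ : set R) y)%:E <= e%:E)%E.
Proof.
move=> cg gM mD Doo e0; have [mS iS] := side_integral N cg gM.
apply: contrapT => /forall2NP H.
move: iS; rewrite leNgt => /negP; apply.
apply: (@lt_le_trans _ _ (\int[mu]_(X in D) (cst e%:E X))%E).
  by rewrite integral_cst//= Doo mulry gtr0_sg// mul1e ltry.
apply: (@le_trans _ _ (\int[mu]_(X in D) \int[mu]_y (normc (g (X +i* y)) * \1_(`[0%R, N%:R[ : set R) y)%:E)%E).
  apply: ge0_le_integral => //.
  - by move=> x _; rewrite lee_fin ltW.
  - exact: measurable_funTS.
  by move=> x Dx; have [//|/negP] := H x; rewrite -ltNge => /ltW.
apply: ge0_subset_integral => //.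
by move=> x _; apply: integral_ge0 => y _; rewrite lee_fin mulr_ge0.
Qed.

(** Goursat on a tall, wide rectangle standing on the line: the top is small by the decay
    hypothesis, the vertical sides are picked by [side_small], and the bottom differs little from
    the whole line. Each of the four errors is at most [e / 4]. *)
Theorem line_cauchy_Re g p (M : R) : 0 < Im p ->
  (forall z, 0 <= Im z -> ccont g z) ->
  (forall z, 0 <= Im z -> z != p -> exists L, cdiff g z L) ->
  (forall y : R, 0 <= y -> (\int[mu]_x (normc (g (x +i* y)))%:E <= M%:E)%E) ->
  (forall e : R, 0 < e -> exists N0 : nat, forall N : nat, (N0 <= N)%N ->
     (\int[mu]_x (normc (g (x +i* N%:R)))%:E <= e%:E)%E) ->
  \int[mu]_x Re (g (x +i* 0)) = 0.
Proof.
move=> p0 cg dg gM gN.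
have m0 := continuous_cmeas (fun x => cg (x +i* 0) (lexx 0)).
have ig : cintegrable (fun x => g (x +i* 0)).
  by apply: cintegrable_lty => //; apply: le_lt_trans (gM 0 (lexx 0)) _; rewrite ltry.
apply/eqP; rewrite -normr_le0; apply/ler_addgt0Pr => e e0; rewrite add0r.
have e4 : 0 < e / 4 by lra.
have [N0 HN0] := gN _ e4.
pose N := maxn N0 (Num.truncn (Im p)).+1.
have NIm : Im p < N%:R.
  by rewrite (lt_le_trans (truncnS_gt _))// ler_nat leq_maxr.
have N0' : (0 : R) <= N%:R by [].
have top := HN0 N (leq_maxl _ _).
have [X0 HX0] := integral_cvg_line ig.1 e4.
pose X1 := Num.max X0 (`|Re p| + 1).
(* The indicator is that of a half-open interval, so [N.+1] is used to cover the closed side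
   $[0,N]$. *)
have [X XX1 sX] : exists2 X, `[X1, +oo[%classic X &
   (\int[mu]_y (normc (g (X +i* y)) * \1_(`[0%R, N.+1%:R[ : set R) y)%:E <= (e / 4)%:E)%E.
  apply: side_small cg gM _ _ e4 => //.
  by rewrite lebesgue_measure_itv /= ltry.
have [X' XX1' sX'] : exists2 X, `]-oo, - X1]%classic X &
   (\int[mu]_y (normc (g (X +i* y)) * \1_(`[0%R, N.+1%:R[ : set R) y)%:E <= (e / 4)%:E)%E.
  apply: side_small cg gM _ _ e4 => //.
  by rewrite lebesgue_measure_itv /= ltNyr.
move: XX1; rewrite /= in_itv/= andbT ge_max => /andP[X0X pX].
move: XX1'; rewrite /= in_itv/= lerNr ge_max => /andP[X0X' pX'].
have /andP[np1 np2] : - `|Re p| <= Re p <= `|Re p| by rewrite -ler_norml.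
have J0 : Jrect g X' X 0 N%:R = 0.
  apply: (@goursat_except _ g p); [lra|by rewrite p0 NIm|..].
  - by move=> x y _ /andP[y0 _]; exact: cg.
  - by move=> x y _ /andP[y0 _]; exact: dg.
have T : `|sint (fun x => Re (g (x +i* N%:R))) X' X| <= e / 4.
  apply: le_sint_abs top => //.
  - by apply: (@continuous_hline _ g X' X _ _).1 => x _; exact: cg.
  - by apply: cmeas_normc; apply: continuous_cmeas => x; exact: cg.
  - by move=> x _; exact: normc_Re.
have S Y : (\int[mu]_y (normc (g (Y +i* y)) * \1_(`[0%R, N.+1%:R[ : set R) y)%:E <= (e / 4)%:E)%E ->
   `|sint (fun y => Im (g (Y +i* y))) 0 N%:R| <= e / 4.
  move=> sY; apply: le_sint_abs sY => //.
  - by apply: (@continuous_vline _ g 0 N%:R _ _).2 => x /andP[x0 _]; exact: cg.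
  - apply/measurable_EFinP.
    exact: (measurableT_comp (side_measurable N.+1 cg) (pair1_measurable Y)).
  - move=> y /andP[y0 yN]; rewrite indicE mem_set ?mulr1; first exact: normc_Im.
    by rewrite /= in_itv/= y0 (le_lt_trans yN)// ltr_nat.
  - by move=> y; rewrite mulr_ge0.
have L := HX0 X (- X') X0X X0X'; rewrite opprK in L.
move: J0 L T (S _ sX) (S _ sX'); rewrite /Jrect.
set I0 := sint _ X' X; set I1 := sint _ X' X; set I2 := sint _ 0 _; set I3 := sint _ 0 _.
by set I4 := Rintegral _ _ _; rewrite !ler_norml; lra.
Qed.

Theorem line_cauchy g p (M : R) : 0 < Im p ->
  (forall z, 0 <= Im z -> ccont g z) ->
  (forall z, 0 <= Im z -> z != p -> exists L, cdiff g z L) ->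
  (forall y : R, 0 <= y -> (\int[mu]_x (normc (g (x +i* y)))%:E <= M%:E)%E) ->
  (forall e : R, 0 < e -> exists N0 : nat, forall N : nat, (N0 <= N)%N ->
     (\int[mu]_x (normc (g (x +i* N%:R)))%:E <= e%:E)%E) ->
  cint (fun x => g (x +i* 0)) = 0.
Proof.
move=> p0 cg dg gM gN; apply: complex_ext; first exact: (@line_cauchy_Re g p M).
(* Multiplication by $-i$ turns the imaginary part into a real part. *)
pose g' z := - 'i%C * g z.
have ng z : normc (g' z) = normc (g z) by rewrite /g' normcM normcN normc_i mul1r.
have -> : Im (cint (fun x => g (x +i* 0))) = \int[mu]_x Re (g' (x +i* 0)).
  by apply: eq_Rintegral => x _; rewrite /g' !ReImE; lra.
apply: (@line_cauchy_Re g' p M p0).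
- move=> z z0 e e0; have [d d0 H] := cg z z0 e e0; exists d => // h hd.
  by rewrite /g' -mulrBr normcM normcN normc_i mul1r H.
- move=> z z0 zp; have [L dL] := dg z z0 zp; exists (- 'i%C * L) => e e0.
  have [d d0 H] := dL e e0; exists d => // h hd.
  by rewrite /g' -mulrA -!mulrBr normcM normcN normc_i mul1r H.
- by move=> y y0; under eq_integral do rewrite ng; exact: gM.
- move=> e e0; have [N0 H] := gN e e0; exists N0 => N NN0.
  by under eq_integral do rewrite ng; exact: H.
Qed.

End LineCauchy.

(** * The integral of the Poisson kernel *)

Section PoissonIntegral.
Context {R : realType}.
Notation mu := (@lebesgue_measure R).

Lemma pois_gt0 (a b x : R) : 0 < b -> 0 < (x - a) ^+ 2 + b ^+ 2.
Proof. by move=> b0; rewrite ltr_wpDl ?sqr_ge0// exprn_gt0. Qed.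

Lemma continuous_pois (a b : R) : 0 < b -> continuous (fun x : R => ((x - a) ^+ 2 + b ^+ 2)^-1).
Proof.
move=> b0 x; apply: cvgV; first by rewrite gt_eqF// pois_gt0.
apply: cvgD; last exact: cvg_cst.
rewrite expr2; under eq_fun do rewrite expr2.
by apply: cvgM; apply: cvgB; [exact: cvg_id|exact: cvg_cst|exact: cvg_id|exact: cvg_cst].
Qed.

(** The antiderivative is $b^{-1}\arctan((x-a)/b)$. *)
Lemma pois_half (a b : R) : 0 < b ->
  (\int[mu]_(x in `[a, +oo[) (((x - a) ^+ 2 + b ^+ 2)^-1)%:E = (pi / (2 * b))%:E)%E.
Proof.
move=> b0; pose F (x : R) := b^-1 * atan (b^-1 * (x - a)).
have dF (x : R) : is_derive x (1 : R) F (((x - a) ^+ 2 + b ^+ 2)^-1).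
  have d0 : is_derive x (1 : R) (fun x : R => x - a) 1 := is_derive_shift x 1 (- a).
  have d1 := @is_deriveZ R _ _ _ b^-1 x 1 _ d0.
  have d2 := @is_derive1_comp R (@atan R) _ x _ _ (is_derive1_atan _) d1.
  have d3 := @is_deriveZ R _ _ _ b^-1 x 1 _ d2.
  apply: (is_derive_eq d3); rewrite /= /GRing.scale /=.
  have := pois_gt0 a x b0; move=> p0.
  field; rewrite !gt_eqF//.
rewrite (@ge0_continuous_FTC2y _ _ F a (pi / (2 * b))).
- by rewrite /F subrr mulr0 atan0 mulr0 sube0.
- by move=> x _; rewrite invr_ge0 ltW// pois_gt0.
- by apply: continuous_subspaceT; exact: continuous_pois.
- have -> : pi / (2 * b) = b^-1 * (pi / 2) :> R by field; rewrite gt_eqF.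
  apply: cvgMr; apply: (cvg_comp _ _ _ (@cvgy_atan R)).
  apply: gt0_cvgMry; first by rewrite invr_gt0.
  apply/cvgryPge => A; near=> x; rewrite lerBrDr; near: x; exact: nbhs_pinfty_ge.
- by move=> x _; case: (dF x).
- apply: cvg_at_right_filter; apply: differentiable_continuous.
  by apply/derivable1_diffP; case: (dF a).
- by move=> x _; rewrite derive1E; case: (dF x).
Unshelve. all: by end_near. Qed.

Lemma pois_int (a b : R) : 0 < b ->
  (\int[mu]_x (((x - a) ^+ 2 + b ^+ 2)^-1)%:E = (pi / b)%:E)%E.
Proof.
move=> b0; have p0 (x : R) : (0 <= (((x - a) ^+ 2 + b ^+ 2)^-1)%:E)%E.
  by rewrite lee_fin invr_ge0 ltW// pois_gt0.
have mp : measurable_fun setT (fun x : R => (((x - a) ^+ 2 + b ^+ 2)^-1)%:E).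
  by apply/measurable_EFinP; apply: continuous_measurable_fun; exact: continuous_pois.
have -> : setT = `]-oo, a[%classic `|` `[a, +oo[%classic :> set R.
  apply/seteqP; split=> x //= _; rewrite !in_itv/= andbT.
  by case: (ltP x a); [left|right].
rewrite ge0_integral_setU//; last 2 first.
- exact: measurable_funTS.
- apply/disj_setPS => x /=; rewrite !in_itv/= andbT; lra.
rewrite pois_half// integral_itv_bndo_bndc; last exact: measurable_funTS.
(* The reflection $x\mapsto -x$ carries the left half to a right half with centre [- a]. *)
have := @ge0_integration_by_substitutionNy R (fun x => ((x - a) ^+ 2 + b ^+ 2)^-1) (- a).
rewrite opprK => ->.
- under eq_integral => x _.
    rewrite /=; rewrite (_ : (- x - a) ^+ 2 = (x - - a) ^+ 2); last by ring.
  over.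
  by rewrite pois_half// -EFinD; congr EFin; field; rewrite gt_eqF.
- by apply: continuous_subspaceT; exact: continuous_pois.
- by move=> x _; rewrite invr_ge0 ltW// pois_gt0.
Qed.

End PoissonIntegral.

(** * Cauchy kernels and the Poisson representation of Hardy functions *)

Section HardyCauchy.
Context {R : realType}.
Notation mu := (@lebesgue_measure R).
Implicit Types (F g : R[i] -> R[i]) (f : R -> R[i]) (z w p : R[i]).

Lemma hardy_uhpP F : hardy_uhp F <->
  (forall z, 0 < Im z -> exists L, cdiff F z L) /\
  (exists M : R, forall y : R, 0 < y -> (energy (fun x => F (x +i* y)) <= M%:E)%E).
Proof.
split=> [[dF sF]|[dF [M FM]]]; split.
- by move=> z z0; apply/derivable_cdiff; exact: dF.
- set S := ereal_sup _ in sF.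
  have S0 : (0 <= S)%E.
    apply: le_trans (L2norm_ge0 (fun x => F (x +i* 1))) _.
    by apply: ereal_sup_ubound; exists 1 => /=.
  exists (fine S ^+ 2) => y y0.
  rewrite -L2norm_le; last exact: fine_ge0.
  rewrite fineK; last by rewrite ge0_fin_numE.
  by apply: ereal_sup_ubound; exists y.
- by move=> z z0; apply/derivable_cdiff; exact: dF.
- apply: (@le_lt_trans _ _ (Num.sqrt `|M|)%:E); last exact: ltry.
  apply: ub_ereal_sup => _ [y /= y0 <-].
  rewrite L2norm_le// sqr_sqrtr// (le_trans (FM y y0))// lee_fin; exact: ler_norm.
Qed.

Lemma boundary_valueP F f : boundary_value F f <->
  forall e : R, 0 < e -> exists2 d : R, 0 < d & forall y, 0 < y < d ->
    (energy (fun x => F (x +i* y) - f x)%R < e%:E)%E.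
Proof.
split=> [H e e0|H].
- have e1 : (0 : R) < Num.sqrt e by rewrite sqrtr_gt0.
  have {}H : \forall y \near 0^'+, (L2norm (fun x => F (x +i* y) - f x)%R < (Num.sqrt e)%:E)%E.
    have /fine_cvgP[fin /cvgrPdist_lt/(_ _ e1) cv] := H; near=> y.
    rewrite -[ltLHS]fineK ?lte_fin; last by near: y; exact: fin.
    rewrite -[ltLHS]ger0_norm ?fine_ge0 ?L2norm_ge0// -normrN -sub0r.
    by near: y; exact: cv.
  have [d d0 Hd] := H.
  exists d => // y /andP[y0 yd]; rewrite -(sqr_sqrtr (ltW e0)) -L2norm_lt//.
  by apply: Hd => //=; rewrite sub0r normrN gtr0_norm.
- apply/fine_cvgP; split.
    have [d d0 Hd] := H 1 ltr01; exists d => //= y /=.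
    rewrite sub0r normrN => yd y0; rewrite ge0_fin_numE ?L2norm_ge0// L2norm_lty.
    rewrite gtr0_norm// in yd.
    by apply: (lt_trans (Hd y _)); rewrite ?ltry// y0.
  apply/cvgrPdist_lt => e e0; have e2 : 0 < e ^+ 2 by rewrite exprn_gt0.
  have [d d0 Hd] := H _ e2; exists d => //= y /=.
  rewrite sub0r normrN => yd y0; rewrite gtr0_norm// in yd.
  rewrite sub0r normrN ger0_norm ?fine_ge0 ?L2norm_ge0//.
  have h := Hd y; rewrite y0 yd -L2norm_lt// in h.
  rewrite -lte_fin fineK; first exact: h.
  by rewrite ge0_fin_numE ?L2norm_ge0//; apply: lt_trans (h isT) _; rewrite ltry.
Unshelve. all: by end_near. Qed.

Lemma cdiff_shift F z w L : cdiff F (z + w) L -> cdiff (fun x => F (x + w)) z L.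
Proof.
move=> dF e e0; have [d d0 H] := dF e e0; exists d => // h hd.
by rewrite (addrAC z h w) H.
Qed.

Lemma cdiff_cst (c : R[i]) z : cdiff (fun=> c) z 0.
Proof.
by move=> e e0; exists 1 => // h _; rewrite subrr mul0r subrr normc0 mulr_ge0// ltW.
Qed.

Lemma cdiff_subr (c : R[i]) z : cdiff (fun x => x - c) z 1.
Proof.
move=> e e0; exists 1 => // h _.
rewrite (_ : z + h - c - (z - c) - 1 * h = 0); last by ring.
by rewrite normc0 mulr_ge0// ltW.
Qed.

Lemma cdiff_inv (c : R[i]) z : z != c -> cdiff (fun x => (x - c)^-1) z (- (z - c) ^- 2).
Proof.
rewrite -subr_eq0; set a := z - c => a0 e e0.
have n0 : 0 < normc a by rewrite normc_gt0.
exists (Num.min (normc a / 2) (e * normc a ^+ 3 / 2)).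
  by rewrite lt_min !divr_gt0// mulr_gt0// exprn_gt0.
move=> h; rewrite lt_min => /andP[h1 h2].
have na : normc a / 2 <= normc (a + h).
  have := normcBl a (- h); rewrite opprK normcN; lra.
have ah0 : a + h != 0 by rewrite -normc_gt0; lra.
rewrite (_ : z + h - c = a + h); last by rewrite /a; ring.
have -> : (a + h)^-1 - a^-1 - - a ^- 2 * h = h ^+ 2 / (a ^+ 2 * (a + h)).
  by field; rewrite ?a0 ?ah0.
rewrite normc_div (normcM (a ^+ 2)) !normcX (expr2 (normc h)) -mulrA mulrC ler_wpM2r//.
rewrite ler_pdivrMr ?mulr_gt0 ?exprn_gt0 ?normc_gt0//.
have : e * normc a ^+ 3 / 2 <= e * (normc a ^+ 2 * normc (a + h)).
  rewrite -mulrA ler_pM2l// exprSr -mulrA ler_wpM2l// exprn_ge0//.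
lra.
Qed.

Lemma ccontM F g z : ccont F z -> ccont g z -> ccont (fun x => F x * g x) z.
Proof.
move=> cF cg e e0.
pose C := normc (F z) + normc (g z) + 1.
have C0 : 0 < C by rewrite ltr_wpDl// addr_ge0.
have e1 : 0 < Num.min 1 (e / (2 * C)) by rewrite lt_min ltr01 divr_gt0// mulr_gt0.
have [d1 d10 H1] := cF _ e1; have [d2 d20 H2] := cg _ e1.
exists (Num.min d1 d2); first by rewrite lt_min d10.
move=> h; rewrite lt_min => /andP[/H1 + /H2]; rewrite !lt_min => /andP[h1 h2] /andP[h3 h4].
have -> : F (z + h) * g (z + h) - F z * g z =
  (F (z + h) - F z) * (g (z + h) - g z) + (F (z + h) - F z) * g z + F z * (g (z + h) - g z).
  by ring.
move: h1 h2 h3 h4; set u := F (z + h) - F z; set v := g (z + h) - g z.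
rewrite !ltr_pdivlMr ?mulr_gt0// => h1 h2 h3 h4.
rewrite (le_lt_trans (normcD _ _))// (le_lt_trans (lerD (normcD _ _) (lexx _)))// !normcM.
have := normc_ge0 u; have := normc_ge0 v; have := normc_ge0 (F z); have := normc_ge0 (g z).
move: h1 h2 h3 h4; rewrite /C.
move: (normc u) (normc v) (normc (F z)) (normc (g z)) => a b p q *.
nra.
Qed.

(** The Cauchy kernel with pole [w]. With its pole above the line it computes extensions; with its
    pole below, it is itself a Hardy function ([H2_ker]). *)
Definition ker w (x : R) : R[i] := (x%:C - w)^-1.

Lemma normc_ker_sqr w x : normc (ker w x) ^+ 2 = ((x - Re w) ^+ 2 + Im w ^+ 2)^-1.
Proof. by rewrite normcV exprVn normc_sqr !ReImE sub0r sqrrN. Qed.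

Lemma cmeasV f : cmeas f -> cmeas (fun x => (f x)^-1).
Proof.
move=> mf; have [m1 m2] := mf; have m3 := cmeas_sqr mf.
have mi : measurable_fun setT (fun x => (normc (f x) ^+ 2)^-1).
  rewrite (_ : (fun x => _) = (fun x => (normc (f x) ^+ 2) `^ (-1))); last first.
    by apply/funext => x; rewrite powR_inv1 ?sqr_ge0.
  by have := @measurable_powR R (-1) => /measurableT_comp; apply.
have E z : z^-1 = ((normc z ^+ 2)^-1)%:C * z^*%C.
  have [->|z0] := eqVneq z 0; first by rewrite invr0 normc0 expr0n /= invr0 mul0r.
  apply: (mulfI z0); rewrite mulfV// mulrCA normc_mulJ -rmorphM mulVf//.
  by rewrite expf_neq0// normc_eq0.
split.
- under eq_fun do rewrite E !ReImE mul0r subr0.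
  exact: measurable_funM.
- under eq_fun do rewrite E !ReImE mul0r addr0.
  by apply: measurable_funM => //; exact: measurableT_comp.
Qed.

Lemma cmeas_real : cmeas (fun x : R => x%:C).
Proof. by split=> /=; [exact: measurable_id|exact: measurable_cst]. Qed.

Lemma cmeas_ker w : cmeas (ker w).
Proof. by apply: cmeasV; apply: cmeasB; [exact: cmeas_real|exact: cmeas_cst]. Qed.

Lemma energy_ker w : Im w != 0 -> energy (ker w) = (pi / `|Im w|)%:E.
Proof.
move=> w0; rewrite /energy; under eq_integral do rewrite normc_ker_sqr.
rewrite -(@pois_int R (Re w) `|Im w|) ?normr_gt0//.
by apply: eq_integral => x _; rewrite real_normK ?num_real.
Qed.

Lemma L2_ker w : Im w != 0 -> L2 (ker w).
Proof. by move=> w0; apply/L2P; split; [exact: cmeas_ker|rewrite energy_ker// ltry]. Qed.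

End HardyCauchy.

Section HardyRep.
Context {R : realType}.
Notation mu := (@lebesgue_measure R).
Implicit Types (F g : R[i] -> R[i]) (f : R -> R[i]) (z w p l : R[i]).

Definition holo_uhp F := forall z, 0 < Im z -> exists L, cdiff F z L.

Lemma line_L2 F (M y : R) : holo_uhp F -> 0 < y ->
  (forall y : R, 0 < y -> (energy (fun x => F (x +i* y)) <= M%:E)%E) ->
  L2 (fun x => F (x +i* y)).
Proof.
move=> dF y0 FM; apply/L2P; split; last exact: le_lt_trans (FM y y0) (ltry _).
by apply: continuous_cmeas => x; have [L] := dF (x +i* y) y0; exact: cdiff_ccont.
Qed.

Lemma subr_real_neq0 (x y : R) w : y != Im w -> x +i* y - w != 0.
Proof.
by apply: contra => /eqP/(congr1 Im); rewrite ImB /= => /eqP; rewrite subr_eq0.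
Qed.

Lemma kernel_shift (x y : R) w : (x +i* y - w)^-1 = ker (w - y *i) x.
Proof.
by rewrite /ker; congr (_^-1); apply: complex_ext; rewrite !ReImE /=; ring.
Qed.

(** The function $F(z+ie)/(z-\bar l)$ is analytic on the closed half plane, its pole being below the
    line. The energies of the two factors bound its integrals over horizontal lines, and the kernel
    energy $\pi/(\Im l+y)$ at height $y$ makes them decay. *)
Lemma vanish_line F (M e : R) l : holo_uhp F -> 0 < e -> 0 < Im l ->
  (forall y : R, 0 < y -> (energy (fun x => F (x +i* y)) <= M%:E)%E) ->
  cint (fun x => F (x +i* e) * ker l^*%C x) = 0.
Proof.
move=> dF e0 l0 FM.
pose g z := F (z + e *i) * (z - l^*%C)^-1.
have M0 : 0 <= M by rewrite -lee_fin (le_trans _ (FM 1 ltr01))// energy_ge0.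
have gE (x y : R) : g (x +i* y) = F (x +i* (y + e)) * ker (l^*%C - y *i) x.
  by rewrite /g kernel_shift; congr (F _ * _); apply: complex_ext; rewrite !ReImE /=; ring.
have -> : (fun x => F (x +i* e) * ker l^*%C x) = (fun x => g (x +i* 0)).
  apply/funext => x; rewrite gE add0r; congr (_ * ker _ _).
  by apply: complex_ext; rewrite !ReImE /=; ring.
have dg z : 0 <= Im z -> exists L, cdiff g z L.
  move=> z0; have [L dL] : exists L, cdiff F (z + e *i) L by apply: dF; rewrite ImD /=; lra.
  eexists; apply: cdiffM; first exact: cdiff_shift dL.
  apply: cdiff_inv; rewrite -subr_eq0; case: z z0 {dL} => a b /= b0.
  by apply: subr_real_neq0; rewrite ImJ; lra.
have B (s y : R) : 0 < s -> 0 <= y ->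
    (\int[mu]_x (normc (g (x +i* y)))%:E <= (s / 2 * M + (2 * s)^-1 * (pi / (Im l + y)))%:E)%E.
  move=> s0 y0; under eq_integral do rewrite gE.
  have mF : cmeas (fun x => F (x +i* (y + e))).
    by apply: L2_cmeas; apply: (line_L2 dF _ FM); lra.
  apply: le_trans (int_normcM_le s0 mF (cmeas_ker _)) _.
  have Iw : `|Im (l^*%C - y *i)| = Im l + y.
    by rewrite !ReImE /= -opprD normrN gtr0_norm//; lra.
  rewrite energy_ker; last by rewrite -normr_gt0 Iw; lra.
  rewrite Iw EFinD; apply: leeD; last by rewrite -EFinM.
  rewrite (EFinM (s / 2) M); apply: lee_wpmul2l; first by rewrite lee_fin; lra.
  by apply: FM; lra.
(* Any point may be named as the exceptional one here, as [g] is differentiable throughout. *)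
apply: (@line_cauchy _ g 'i%C (1 / 2 * M + (2 * 1)^-1 * (pi / Im l))) => //=.
- by move=> z /dg[L]; exact: cdiff_ccont.
- by move=> z /dg.
- move=> y y0; apply: le_trans (B 1 y ltr01 y0) _.
  rewrite lee_fin lerD2l ler_pM2l ?invr_gt0//.
  rewrite ler_pM2l ?pi_gt0// lef_pV2 ?posrE; lra.
- move=> d d0.
  (* The weight first bounds the energy term of [F] by [d / 2], uniformly in the height; a large
     height then bounds the kernel term. *)
  pose s := d / (M + 1).
  have s0 : 0 < s by rewrite divr_gt0//; lra.
  exists (Num.truncn (pi / (s * d))).+1 => N hN.
  apply: le_trans (B s N%:R s0 _) _ => //; rewrite lee_fin.
  have h1 : s / 2 * M <= d / 2.
    rewrite /s mulrAC ler_pM2r ?invr_gt0// mulrAC ler_pdivrMr; last by lra.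
    by rewrite ler_pM2l//; lra.
  have h2 : pi / (s * d) < N%:R.
    by rewrite (lt_le_trans (truncnS_gt _))// ler_nat.
  suff h3 : (2 * s)^-1 * (pi / (Im l + N%:R)) <= d / 2 by lra.
  have N0 : 0 < Im l + N%:R by rewrite ltr_wpDr.
  have -> : (2 * s)^-1 * (pi / (Im l + N%:R)) = (pi / (s * d) / (Im l + N%:R)) * (d / 2).
    by field; rewrite !gt_eqF.
  rewrite ler_piMl//; first by lra.
  by rewrite ler_pdivrMr// mul1r; lra.
Qed.

(** The Poisson kernel up to the factor $\Im z/\pi$. On the line it is the squared modulus of
    [ker z], the product of the Cauchy kernels at $z$ and $\bar z$. *)
Definition pker z (x : R) : R := ((x - Re z) ^+ 2 + Im z ^+ 2)^-1.

Lemma pker_ker z x : Im z != 0 -> (pker z x)%:C = ker z x * ker z^*%C x.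
Proof.
move=> z0.
have h (w : R[i]) : Im w != 0 -> x%:C - w != 0.
  by move=> w0; apply: (@subr_real_neq0 x 0 w); rewrite eq_sym.
rewrite /ker -invfM.
have -> : (x%:C - z) * (x%:C - z^*%C) = ((x - Re z) ^+ 2 + Im z ^+ 2)%:C.
  by apply: complex_ext; rewrite !ReImE; ring.
by rewrite /pker fmorphV.
Qed.

Lemma pker_ge0 z x : 0 <= pker z x.
Proof. by rewrite invr_ge0 addr_ge0// sqr_ge0. Qed.

Lemma pker_int z : 0 < Im z -> (\int[mu]_x (pker z x)%:E = (pi / Im z)%:E)%E.
Proof. by move=> z0; exact: pois_int. Qed.

Lemma normc_ker_le z x : Im z != 0 -> normc (ker z x) <= `|Im z|^-1.
Proof.
move=> z0; rewrite normcV lef_pV2 ?posrE ?normr_gt0//.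
  by have := normc_Im (x%:C - z); rewrite !ReImE add0r normrN.
by rewrite normc_gt0; apply: (@subr_real_neq0 x 0 z); rewrite eq_sym.
Qed.

Lemma normc_kerJ z x : normc (ker z^*%C x) = normc (ker z x).
Proof. by rewrite /ker -[RHS]normcJ_ conjc_inv conjcB conjc_real. Qed.

Lemma L2_pker z : 0 < Im z -> L2 (fun x => (pker z x)%:C).
Proof.
move=> z0; have zn : Im z != 0 by rewrite gt_eqF.
apply: (@L2_le _ _ (fun x => (`|Im z|^-1)%:C * ker z x)).
- under eq_fun do rewrite pker_ker//.
  by apply: cmeasM; exact: cmeas_ker.
- by apply: L2Z; exact: L2_ker.
move=> x; rewrite pker_ker// !normcM normc_real ger0_norm ?invr_ge0// mulrC.
by rewrite ler_wpM2r// normc_kerJ normc_ker_le.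
Qed.

End HardyRep.

Section PoissonRep.
Context {R : realType}.
Notation mu := (@lebesgue_measure R).
Implicit Types (F g : R[i] -> R[i]) (f : R -> R[i]) (z w p l : R[i]).

Lemma cdiff_local F g z L (d : R) : 0 < d ->
  (forall h, normc h < d -> F (z + h) = g (z + h)) -> cdiff F z L -> cdiff g z L.
Proof.
move=> d0 Fg dF e e0; have [d1 d10 H] := dF e e0.
exists (Num.min d d1); first by rewrite lt_min d0.
move=> h; rewrite lt_min => /andP[hd hd1].
rewrite -Fg// -(addr0 z) -Fg ?normc0// addr0; exact: H.
Qed.

Lemma cint_pker z : 0 < Im z -> cint (fun x => (pker z x)%:C) = (pi / Im z)%:C.
Proof. by move=> z0; rewrite cint_real /Rintegral pker_int. Qed.

Lemma cintegrable_pker z : 0 < Im z -> cintegrable (fun x => (pker z x)%:C).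
Proof.
move=> z0; apply: cintegrable_lty; first by have /L2_cmeas := L2_pker z0.
under eq_integral do rewrite normc_real ger0_norm ?pker_ge0//.
by rewrite pker_int// ltry.
Qed.

(** The difference quotient at [z0], completed by [L]. When [L] is the derivative it is continuous
    at [z0], and it is differentiable wherever else [F] is: exactly what [goursat_except] admits. *)
Definition slope F z0 L z := if z == z0 then L else (F z - F z0) / (z - z0).

Lemma slope_ccont F z0 L : cdiff F z0 L -> ccont (slope F z0 L) z0.
Proof.
move=> dF e e0; have e2 : 0 < e / 2 by lra.
have [d d0 H] := dF _ e2; exists d => // h hd.
rewrite /slope eqxx; case: eqVneq => [_|hz]; first by rewrite subrr normc0.
have h0 : h != 0 by apply: contra hz => /eqP ->; rewrite addr0.
have -> : (F (z0 + h) - F z0) / (z0 + h - z0) - L = (F (z0 + h) - F z0 - L * h) / h.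
  by rewrite (addrC z0) addrK; field.
have hn : 0 < normc h by rewrite normc_gt0.
rewrite normc_div ltr_pdivrMr// (le_lt_trans (H h hd))// ltr_pM2r//; lra.
Qed.

Lemma slope_cdiff F z0 L z : z != z0 -> (exists L', cdiff F z L') ->
  exists L', cdiff (slope F z0 L) z L'.
Proof.
move=> zz0 [L' dF].
have n0 : 0 < normc (z - z0) by rewrite normc_gt0 subr_eq0.
eexists; apply: (@cdiff_local (fun z => (F z - F z0) * (z - z0)^-1) _ _ _ (normc (z - z0)) n0); last first.
  apply: cdiffM; last exact: cdiff_inv.
  move=> e e0; have [d d0 H] := dF e e0; exists d => // h hd.
  by rewrite opprB addrA addrNK; exact: H.
move=> h hd; rewrite /slope ifF//; apply/negbTE/eqP => zh.
have hz : h = - (z - z0) by rewrite -zh; ring.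
by move: hd; rewrite hz normcN ltxx.
Qed.

(** Cauchy's theorem [line_cauchy] for $(F(z+ie)-F(z_0+ie))/((z-z_0)(z-\bar z_0))$, completed at
    $z_0$. On the line the inverse of the denominator is the Poisson kernel, whose total mass is
    $\pi/\Im z_0$. Most of the proof bounds the integrals of this function over the lines of height
    $y$ by a constant over $\Im z_0+y$. *)
Lemma poisson_line F (M e : R) z0 : holo_uhp F -> 0 < e -> 0 < Im z0 ->
  (forall y : R, 0 < y -> (energy (fun x => F (x +i* y)) <= M%:E)%E) ->
  cint (fun x => F (x +i* e) * (pker z0 x)%:C) = F (z0 + e *i) * (pi / Im z0)%:C.
Proof.
move=> dF e0 b0 FM; set b := Im z0 in b0 *.
have bn : b != 0 by rewrite gt_eqF.
have M0 : 0 <= M by rewrite -lee_fin (le_trans _ (FM 1 ltr01))// energy_ge0.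
pose Fe z := F (z + e *i).
have dFe z : 0 <= Im z -> exists L, cdiff Fe z L.
  move=> zi; have [L dL] : exists L, cdiff F (z + e *i) L by apply: dF; rewrite ImD /=; lra.
  by exists L; exact: cdiff_shift.
have [L0 dL0] := dFe z0 (ltW b0).
pose D := slope Fe z0 L0.
pose g z := D z * (z - z0^*%C)^-1.
have zJ z : 0 <= Im z -> z != z0^*%C.
  move=> zi; rewrite -subr_eq0; case: z zi => a c /= ci.
  by apply: subr_real_neq0; rewrite ImJ -/b; lra.
have cg z : 0 <= Im z -> ccont g z.
  move=> zi; apply: ccontM; last by apply: cdiff_ccont; apply: cdiff_inv; exact: zJ.
  have [->|zz0] := eqVneq z z0; first exact: slope_ccont.
  by have [L' /cdiff_ccont] := slope_cdiff L0 zz0 (dFe z zi).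
have dg z : 0 <= Im z -> z != z0 -> exists L, cdiff g z L.
  move=> zi zz0; have [L' dL'] := slope_cdiff L0 zz0 (dFe z zi).
  by eexists; apply: (cdiffM dL'); apply: cdiff_inv; exact: zJ.
have [rho rho0 Hr] := slope_ccont dL0 ltr01.
pose C0 := normc L0 + 1.
have Dr z : normc (z - z0) < rho -> normc (D z) <= C0.
  move=> /Hr; rewrite (_ : z0 + (z - z0) = z); last by ring.
  rewrite -/D (_ : D z0 = L0); last by rewrite /D /slope eqxx.
  by move=> h; have := normcBl (D z) L0; rewrite /C0; lra.
(* Outside the disc of radius [rho] around [z0] the triangle inequality gives $|z-\bar z_0|\le
   A\,|z-z_0|$; inside it the quotient [D] is at most [C0]. *)
pose A := 1 + 2 * b / rho.
pose K2 := A * normc (Fe z0) + C0 * (rho + 2 * b).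
have b2 : 0 <= 2 * b by rewrite mulr_ge0// ltW.
have A0 : 0 <= A by rewrite addr_ge0// divr_ge0// ltW.
have C00 : 0 <= C0 by rewrite addr_ge0.
have K20 : 0 <= K2.
  by rewrite addr_ge0 ?mulr_ge0// addr_ge0// ltW.
have zz0 : normc (z0 - z0^*%C) = 2 * b.
  rewrite (_ : z0 - z0^*%C = (2 * b)%:C * 'i%C).
    by rewrite normcM normc_real normc_i mulr1 gtr0_norm// mulr_gt0.
  by apply: complex_ext; rewrite !ReImE -/b; ring.
have gb z : 0 <= Im z -> normc (g z) <= (A * normc (Fe z) + K2) * normc (z - z0^*%C)^-1 ^+ 2.
  move=> zi; rewrite /g normcM normcV.
  have k0 : 0 < normc (z - z0^*%C) by rewrite normc_gt0 subr_eq0 zJ.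
  have tri : normc (z - z0^*%C) <= normc (z - z0) + 2 * b.
    by rewrite -zz0 (le_trans _ (normcD _ _))// addrA subrK.
  rewrite expr2 mulrA ler_wpM2r ?invr_ge0// ler_pdivlMr//.
  have [zr|zr] := ltP (normc (z - z0)) rho.
    have h1 := Dr z zr.
    apply: (@le_trans _ _ (C0 * (rho + 2 * b))).
      by apply: ler_pM => //; lra.
    by rewrite /K2 addrA lerDr addr_ge0// mulr_ge0.
  have zn : 0 < normc (z - z0) by lra.
  rewrite /D /slope ifF; last by apply/negbTE; rewrite -subr_eq0 -normc_gt0.
  rewrite normc_div mulrAC ler_pdivrMr//.
  have tri2 : normc (z - z0^*%C) <= A * normc (z - z0).
    apply: (le_trans tri); have -> : A * normc (z - z0) = normc (z - z0) + 2 * b / rho * normc (z - z0) by rewrite /A; ring.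
    rewrite lerD2l.
    by rewrite mulrAC ler_pdivlMr// ler_wpM2l.
  apply: (@le_trans _ _ ((normc (Fe z) + normc (Fe z0)) * (A * normc (z - z0)))).
    apply: ler_pM => //.
    by rewrite (le_trans (normcD _ _))// normcN.
  rewrite mulrA ler_wpM2r//.
  have : 0 <= C0 * (rho + 2 * b) by rewrite mulr_ge0// addr_ge0// ltW.
  rewrite /K2; lra.
pose Kc := A * (M / 2 + pi / (2 * b)) + K2 * pi.
have mFe (y : R) : 0 <= y -> L2 (fun x => Fe (x +i* y)).
  move=> y0; have := @line_L2 _ F M (y + e) dF _ FM.
  rewrite (_ : (fun x => F (x +i* (y + e))) = (fun x => Fe (x +i* y))); first by apply; lra.
  by apply/funext => x; rewrite /Fe; congr F; apply: complex_ext; rewrite !ReImE; ring.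
(* In the term with [Fe], one factor of the squared kernel is bounded by its supremum $1/(b+y)$ and
   the other is paired with [Fe]; the term with [K2] gives the kernel energy $\pi/(b+y)$. *)
have B (y : R) : 0 <= y -> (\int[mu]_x (normc (g (x +i* y)))%:E <= (Kc / (b + y))%:E)%E.
  move=> y0; pose w := z0^*%C - y *i.
  have Iw : `|Im w| = b + y.
    by rewrite /w !ReImE -/b -opprD normrN gtr0_norm//; lra.
  have w0 : Im w != 0 by rewrite -normr_gt0 Iw; lra.
  have by0 : 0 < b + y by lra.
  pose P x := (A / (b + y)) * normc (Fe (x +i* y) * ker w x) + K2 * normc (ker w x) ^+ 2.
  have mP1 : cmeas (fun x => Fe (x +i* y) * ker w x).
    by apply: cmeasM; [(apply: L2_cmeas; exact: mFe)|exact: cmeas_ker].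
  have m1 : measurable_fun setT (fun x => (normc (Fe (x +i* y) * ker w x))%:E).
    by apply/measurable_EFinP; exact: cmeas_normc.
  have m2 := measurable_energy (cmeas_ker w).
  have Ab0 : 0 <= A / (b + y) by rewrite divr_ge0// ltW.
  apply: (@le_trans _ _ (\int[mu]_x (P x)%:E)%E).
    apply: ge0_le_integral => //.
    - by move=> x _; rewrite lee_fin.
    - by apply/measurable_EFinP; apply: cmeas_normc; apply: continuous_cmeas => x; exact: cg.
    - apply/measurable_EFinP; apply: measurable_funD; apply: measurable_funM => //.
      + exact: cmeas_normc.
      + (apply: cmeas_sqr; exact: cmeas_ker).
    move=> x _; rewrite lee_fin (le_trans (gb _ _))// /P kernel_shift -/w mulrDl lerD2r.
    have kb : normc (ker w x) <= (b + y)^-1 by rewrite -Iw normc_ker_le.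
    have -> : A / (b + y) * normc (Fe (x +i* y) * ker w x) =
      A * (normc (Fe (x +i* y)) * (normc (ker w x) * (b + y)^-1)) by rewrite normcM; ring.
    rewrite -mulrA expr2 ler_wpM2l// ler_wpM2l// ler_wpM2l//.
  have P1 x : (0 <= (A / (b + y) * normc (Fe (x +i* y) * ker w x))%:E)%E.
    by rewrite lee_fin mulr_ge0.
  have P2 x : (0 <= (K2 * normc (ker w x) ^+ 2)%:E)%E by rewrite lee_fin mulr_ge0// sqr_ge0.
  rewrite /P; under eq_integral do rewrite EFinD.
  rewrite ge0_integralD//; last 2 first.
  - by apply/measurable_EFinP; apply: measurable_funM => //; exact: cmeas_normc.
  - by apply/measurable_EFinP; apply: measurable_funM => //; (apply: cmeas_sqr; exact: cmeas_ker).
  under eq_integral do rewrite EFinM.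
  rewrite ge0_integralZl ?lee_fin//; last by move=> x _; rewrite lee_fin.
  under [X in (_ + X)%E]eq_integral do rewrite EFinM.
  rewrite (@ge0_integralZl _ _ _ _ _ _ _ _ K2%:E) ?lee_fin//; last first.
    by move=> x _; rewrite lee_fin sqr_ge0.
  rewrite -/(energy (ker w)) energy_ker// Iw.
  have := int_normcM_le ltr01 (L2_cmeas (mFe y y0)) (cmeas_ker w).
  rewrite energy_ker// Iw => h1.
  apply: (@le_trans _ _ ((A / (b + y))%:E * ((1 / 2 * M)%:E + ((2 * 1)^-1 * (pi / (b + y)))%:E) + K2%:E * (pi / (b + y))%:E)%E).
    apply: leeD => //; apply: lee_wpmul2l; first by rewrite lee_fin.
    apply: (le_trans h1); apply: leeD; last by rewrite EFinM.
    rewrite (EFinM (1 / 2) M); apply: lee_wpmul2l; first by rewrite lee_fin divr_ge0.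
    have := FM (y + e); rewrite (_ : (fun x => F (x +i* (y + e))) = (fun x => Fe (x +i* y))).
      by apply; lra.
    by apply/funext => x; rewrite /Fe; congr F; apply: complex_ext; rewrite !ReImE; ring.
  rewrite -!(EFinD, EFinM) lee_fin.
  have -> : A / (b + y) * (1 / 2 * M + (2 * 1)^-1 * (pi / (b + y))) + K2 * (pi / (b + y)) =
    (A * (M / 2 + pi / (2 * (b + y))) + K2 * pi) / (b + y).
    by field; rewrite gt_eqF.
  rewrite ler_pM2r ?invr_gt0// /Kc lerD2r ler_wpM2l// lerD2l ler_pM2l ?pi_gt0//.
  by rewrite lef_pV2 ?posrE; lra.
have g0 : cint (fun x => g (x +i* 0)) = 0.
  apply: (@line_cauchy _ g z0 (Kc / b)) => //.
  - move=> y y0; apply: le_trans (B y y0) _; rewrite lee_fin ler_wpM2l//.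
      rewrite /Kc addr_ge0// mulr_ge0 ?pi_ge0// addr_ge0// divr_ge0 ?pi_ge0// mulr_ge0// ltW.
    by rewrite lef_pV2 ?posrE; lra.
  - move=> d d0; exists (Num.truncn (Kc / d)).+1 => N hN.
    apply: le_trans (B N%:R _) _ => //; rewrite lee_fin.
    have h2 : Kc / d < N%:R by rewrite (lt_le_trans (truncnS_gt _))// ler_nat.
    have N0 : 0 < b + N%:R by rewrite ltr_wpDr.
    rewrite ler_pdivrMr// mulrC -ler_pdivrMr//; lra.
have gE x : g (x +i* 0) = F (x +i* e) * (pker z0 x)%:C - F (z0 + e *i) * (pker z0 x)%:C.
  rewrite /g /D /slope ifF; last first.
    by apply/negbTE; rewrite -subr_eq0; apply: subr_real_neq0; rewrite eq_sym.
  rewrite pker_ker// -mulrBl /ker -mulrA; congr ((F _ - F _) * _).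
  by apply: complex_ext; rewrite !ReImE /=; ring.
move: g0; rewrite (funext gE).
have Lp := L2_pker b0; have LF := line_L2 dF e0 FM.
rewrite cintB; last 2 first.
- exact: L2M_integrable.
- by apply: cintegrableZ; exact: cintegrable_pker.
by rewrite cintZ ?cint_pker//; [move/eqP; rewrite subr_eq0 => /eqP|exact: cintegrable_pker].
Qed.

End PoissonRep.

(** * The Cauchy integral of a boundary function *)

Section CauchyIntegral.
Context {R : realType}.
Notation mu := (@lebesgue_measure R).
Implicit Types (F : R[i] -> R[i]) (f g : R -> R[i]) (z w l : R[i]).

(** The Cauchy integral of [f] vanishes on the lower half plane. This takes the place of the
    vanishing of the Fourier transform on the negative half-line. *)
Definition vanishing f := forall l, 0 < Im l -> cint (fun x => f x * ker l^*%C x) = 0.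

Definition CI f z : R[i] := ((2 * pi)%:C * 'i%C)^-1 * cint (fun x => f x * ker z x).

Lemma boundary_cint F f (u : R -> R[i]) (M e : R) : holo_uhp F -> L2 f -> L2 u ->
  (forall y : R, 0 < y -> (energy (fun x => F (x +i* y)) <= M%:E)%E) ->
  boundary_value F f -> 0 < e ->
  exists2 d : R, 0 < d & forall y, 0 < y < d ->
    normc (cint (fun x => F (x +i* y) * u x) - cint (fun x => f x * u x)) < e.
Proof.
move=> dF Lf Lu FM bF e0; have [d1 d10 H1] := inner_small Lu e0.
have /boundary_valueP/(_ _ d10)[d d0 H2] := bF.
exists d => // y y0; have LF := line_L2 dF (andP y0).1 FM.
rewrite -cintB; [|exact: L2M_integrable|exact: L2M_integrable].
rewrite (_ : (fun x => _) = (fun x => u x * (F (x +i* y) - f x))); last first.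
  by apply/funext => x; ring.
have LB := L2B LF Lf.
by apply: H1 => //; rewrite -lte_fin -L2_energy//; exact: H2.
Qed.

Lemma normc_lt_eq0 (c : R[i]) : (forall e : R, 0 < e -> normc c < e) -> c = 0.
Proof.
move=> H; apply/eqP; rewrite -normc_eq0; apply/negPn/negP => c0.
have c1 : 0 < normc c by rewrite normc_gt0 -normc_eq0.
by have := H _ c1; rewrite ltxx.
Qed.

Lemma hardy_vanishing F f : L2 f -> hardy_uhp F -> boundary_value F f -> vanishing f.
Proof.
move=> Lf /hardy_uhpP[dF [M FM]] bF l l0; apply: normc_lt_eq0 => e e0.
have ln : Im l^*%C != 0 by rewrite ImJ oppr_eq0 gt_eqF.
have [d d0 H] := boundary_cint dF Lf (L2_ker ln) FM bF e0.
have y0 : 0 < d / 2 < d by lra.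
have := H _ y0; rewrite (vanish_line dF (andP y0).1 l0 FM) sub0r normcN.
by [].
Qed.

(** The limit of [poisson_line] as the height tends to 0: the left side converges by
    [boundary_cint], the right side by continuity of [F] at [z]. *)
Lemma hardy_poisson F f z : L2 f -> hardy_uhp F -> boundary_value F f -> 0 < Im z ->
  cint (fun x => f x * (pker z x)%:C) = F z * (pi / Im z)%:C.
Proof.
move=> Lf /hardy_uhpP[dF [M FM]] bF z0; apply/eqP; rewrite -subr_eq0; apply/eqP.
apply: normc_lt_eq0 => e e0; have e2 : 0 < e / 2 by lra.
have [d d0 H] := boundary_cint dF Lf (L2_pker z0) FM bF e2.
have p0 : 0 < pi / Im z by rewrite divr_gt0// pi_gt0.
have e3 : 0 < e / 2 / (pi / Im z) by rewrite divr_gt0.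
have [L /cdiff_ccont cF] := dF z z0.
have [d' d'0 H'] := ccont_line (normc_i (R := R)) (cF) e3.
pose y := Num.min d d' / 2.
have y0 : 0 < y by rewrite divr_gt0// lt_min d0.
have yd : y < d by rewrite ltr_pdivrMr// gt_min; apply/orP; left; lra.
have yd' : y < d' by rewrite ltr_pdivrMr// gt_min; apply/orP; right; lra.
have := H y; rewrite y0 yd (poisson_line dF y0 z0 FM) => /(_ isT).
have := H' y; rewrite gtr0_norm// => /(_ yd'); rewrite ltr_pdivlMr//.
rewrite (_ : z + y%:C * 'i%C = z + y *i); last by apply: complex_ext; rewrite !ReImE /=; ring.
set c := cint _; set a := F (z + _); set k := (pi / Im z)%:C => h1 h2.
have -> : c - F z * k = (a - F z) * k - (a * k - c) by ring.
rewrite (le_lt_trans (normcD _ _))// normcN normcM {2}/k normc_real gtr0_norm//.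
by rewrite (splitr e) ltrD.
Qed.

Lemma ker_pker z x : 0 < Im z -> ker z x = ker z^*%C x + (2 * Im z)%:C * 'i%C * (pker z x)%:C.
Proof.
move=> z0; rewrite pker_ker ?gt_eqF// /ker.
have h (w : R[i]) : Im w != 0 -> x%:C - w != 0.
  by move=> w0; apply: (@subr_real_neq0 R x 0 w); rewrite eq_sym.
have h1 : x%:C - z != 0 by apply: h; rewrite gt_eqF.
have h2 : x%:C - z^*%C != 0 by apply: h; rewrite ImJ oppr_eq0 gt_eqF.
have -> : (2 * Im z)%:C * 'i%C = (x%:C - z^*%C) - (x%:C - z).
  by apply: complex_ext; rewrite !ReImE; ring.
by field; apply/andP.
Qed.

(** The Cauchy kernels at $z$ and $\bar z$ differ by $2i\,\Im z$ times the Poisson kernel, and the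
    one at $\bar z$ integrates to 0 against [f]. *)
Lemma CI_poisson f z : L2 f -> vanishing f -> 0 < Im z ->
  CI f z = (Im z / pi)%:C * cint (fun x => f x * (pker z x)%:C).
Proof.
move=> Lf vf z0; rewrite /CI.
have ln : Im z^*%C != 0 by rewrite ImJ oppr_eq0 gt_eqF.
rewrite (_ : (fun x => f x * ker z x) = (fun x => f x * ker z^*%C x +
    (2 * Im z)%:C * 'i%C * (f x * (pker z x)%:C))); last first.
  by apply/funext => x; rewrite ker_pker//; ring.
have i1 := L2M_integrable Lf (L2_pker z0).
rewrite cintD; [|apply: L2M_integrable => //; exact: L2_ker|exact: cintegrableZ].
rewrite vf// add0r cintZ// mulrA; congr (_ * _).
have i0 : ('i%C : R[i]) != 0 by rewrite -normc_eq0 normc_i oner_eq0.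
have pn : (pi : R) != 0 by rewrite gt_eqF// pi_gt0.
have c0 : (2 * pi)%:C * 'i%C != 0 :> R[i].
  by rewrite mulf_neq0// -normc_eq0 normc_real gtr0_norm ?gt_eqF// mulr_gt0// pi_gt0.
apply: (mulfI c0); rewrite mulrA mulfV// mul1r.
by apply: complex_ext; rewrite !ReImE; move: pn; generalize (@pi R) => p pn; field.
Qed.

(** Both sides are the Poisson integral of [f]. Hence the extension of a boundary function is unique
    and given by a formula. *)
Lemma hardy_CI F f z : L2 f -> hardy_uhp F -> boundary_value F f -> 0 < Im z ->
  F z = CI f z.
Proof.
move=> Lf hF bF z0; rewrite CI_poisson//; last exact: hardy_vanishing bF.
rewrite (hardy_poisson Lf hF bF z0) mulrCA -rmorphM /=.
rewrite (_ : Im z / pi * (pi / Im z) = 1) ?mulr1//.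
have := pi_gt0 R; generalize (@pi R) => p p0; field; rewrite !gt_eqF//.
Qed.

(** The bound [normc_cintM] with its weight chosen to balance the terms; the cases of zero energy,
    where that choice degenerates, are treated apart. *)
Lemma cauchy_schwarz4 f g : L2 f -> L2 g ->
  normc (cint (fun x => f x * g x)) ^+ 2 <= 4 * fine (energy f) * fine (energy g).
Proof.
move=> Lf Lg; have H s (s0 : 0 < s) := normc_cintM s0 Lf Lg.
move: H (fine_energy_ge0 f) (fine_energy_ge0 g) (normc_ge0 (cint (fun x => f x * g x))).
set X := normc _; set A := fine _; set B := fine _ => H A0 B0 X0.
have [->|Xn] := eqVneq X 0; first by rewrite expr0n /= !mulr_ge0.
have X1 : 0 < X by rewrite lt_def Xn.
have [Ae|An] := eqVneq A 0.
  have [Be|Bn] := eqVneq B 0.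
    by have := H 1 ltr01; rewrite Ae Be !mulr0 addr0; lra.
  have B1 : 0 < B by rewrite lt_def Bn.
  have s0 : 0 < 2 * B / X by rewrite divr_gt0// mulr_gt0.
  have := H _ s0; rewrite Ae mulr0 add0r invf_div.
  have -> : X / (2 * B) * B = X / 2 by field.
  lra.
have A1 : 0 < A by rewrite lt_def An.
have s0 : 0 < X / (2 * A) by rewrite divr_gt0// mulr_gt0.
have := H _ s0; rewrite invf_div.
have -> : X / (2 * A) * A = X / 2 by field.
have -> : 2 * A / X * B = 2 * A * B / X by field.
move=> h; have : X / 2 <= 2 * A * B / X by lra.
by rewrite ler_pdivlMr// expr2; lra.
Qed.

(** Differentiation under the integral. The Cauchy kernels $k$ satisfy
    $k_{z+h}-k_z-hk_z^2=h^2k_{z+h}k_z^2$, and $|k_{z+h}|\le 2/\Im z$ once $|h|<\Im z/2$. *)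
Lemma CI_holo f : L2 f -> holo_uhp (CI f).
Proof.
move=> Lf z z0; set b := Im z in z0.
have bn : b != 0 by rewrite gt_eqF.
pose C0 := ((2 * pi)%:C * 'i%C : R[i])^-1.
pose k2 x := ker z x * ker z x.
have Lk2 : L2 k2.
  apply: (@L2_le _ _ (fun x => (`|b|^-1)%:C * ker z x)).
  - by apply: cmeasM; exact: cmeas_ker.
  - by apply: L2Z; exact: L2_ker.
  - move=> x; rewrite /k2 !normcM normc_real ger0_norm ?invr_ge0//.
    by rewrite ler_wpM2r// normc_ker_le.
exists (C0 * cint (fun x => f x * k2 x)) => e e0.
have ik2 := L2M_integrable Lf Lk2.
have := cintegrable_int_lty ik2.
have : (0 <= \int[mu]_x (normc (f x * k2 x))%:E)%E by apply: integral_ge0 => x _; rewrite lee_fin.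
case E1 : (\int[mu]_x (normc (f x * k2 x))%:E)%E => [M1| |]//; rewrite lee_fin => M10 _.
pose K := normc C0 * (4 / b * M1) + 1.
have K0 : 0 < K by rewrite ltr_wpDl// mulr_ge0// mulr_ge0// divr_ge0// ltW.
exists (Num.min (b / 2) (e / K)); first by rewrite lt_min !divr_gt0.
move=> h; rewrite lt_min => /andP[hb he].
have hI : - (b / 2) < Im h < b / 2.
  by have := normc_Im h; rewrite ler_norml; lra.
have zh0 : 0 < Im (z + h) by rewrite ImD -/b; lra.
have zhn : Im (z + h) != 0 by rewrite gt_eqF.
have i1 := L2M_integrable Lf (L2_ker zhn).
have i2 := L2M_integrable Lf (L2_ker bn).
rewrite /CI -/C0.
have -> : C0 * cint (fun x => f x * ker (z + h) x) - C0 * cint (fun x => f x * ker z x) -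
    C0 * cint (fun x => f x * k2 x) * h =
  C0 * cint (fun x => f x * ker (z + h) x - f x * ker z x - h * (f x * k2 x)).
  rewrite cintB; [|exact: cintegrableB|exact: cintegrableZ].
  by rewrite cintB// cintZ//; ring.
have rE x : f x * ker (z + h) x - f x * ker z x - h * (f x * k2 x) =
    h ^+ 2 * ker (z + h) x * (f x * k2 x).
  have h1 : x%:C - z != 0 by apply: (@subr_real_neq0 R x 0 z); rewrite eq_sym.
  have h2 : x%:C - (z + h) != 0 by apply: (@subr_real_neq0 R x 0 (z + h)); rewrite eq_sym.
  by rewrite /k2 /ker; field; rewrite h1.
have bnd : normc (cint (fun x => f x * ker (z + h) x - f x * ker z x - h * (f x * k2 x))) <=
    2 * (normc h ^+ 2 * (2 / b) * M1).
  apply: normc_cint_le.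
    by have [/cintegrable_cmeas] : cintegrable (fun x => f x * ker (z + h) x - f x * ker z x - h * (f x * k2 x)) /\ True
       by split=> //; apply: cintegrableB; [exact: cintegrableB|exact: cintegrableZ].
  rewrite EFinM -E1 -ge0_integralZl//; last 3 first.
  - by apply/measurable_EFinP; apply: cmeas_normc; exact: cintegrable_cmeas.
  - by move=> x _; rewrite lee_fin.
  - by rewrite lee_fin mulr_ge0 ?sqr_ge0// divr_ge0// ltW.
  apply: ge0_le_integral => //.
  - by move=> x _; rewrite lee_fin.
  - apply/measurable_EFinP; apply: cmeas_normc; apply: cintegrable_cmeas.
    by apply: cintegrableB; [exact: cintegrableB|exact: cintegrableZ].
  - apply/measurable_EFinP; apply: measurable_funM => //; apply: cmeas_normc; exact: cintegrable_cmeas.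
  move=> x _; rewrite rE -EFinM lee_fin normcM ler_wpM2r// normcM normcX ler_wpM2l ?sqr_ge0//.
  rewrite (le_trans (normc_ker_le _ _))// gtr0_norm//.
  rewrite -invf_div lef_pV2 ?posrE ?divr_gt0//.
  by rewrite ImD -/b; lra.
rewrite normcM (le_trans (ler_wpM2l _ bnd))//.
have -> : normc C0 * (2 * (normc h ^+ 2 * (2 / b) * M1)) = (K - 1) * normc h * normc h.
  by rewrite /K; ring.
rewrite ler_wpM2r//; move: he; rewrite ltr_pdivlMr// => he.
have := normc_ge0 h; nra.
Qed.

End CauchyIntegral.

(** * Intrinsic description and closedness of the Hardy space *)

Section HardyClosed.
Context {R : realType}.
Notation mu := (@lebesgue_measure R).
Implicit Types (F : R[i] -> R[i]) (f g h : R -> R[i]) (z w l : R[i]).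

Lemma cmeas_CI_line f (y : R) : L2 f -> 0 < y -> cmeas (fun x => CI f (x +i* y)).
Proof.
move=> Lf y0; apply: continuous_cmeas => x.
by have [L] := CI_holo Lf (y0 : 0 < Im (x +i* y)); exact: cdiff_ccont.
Qed.

Lemma pker_bound z x : 0 < Im z -> pker z x <= (Im z ^+ 2)^-1.
Proof.
move=> z0; have z2 : 0 < Im z ^+ 2 by rewrite exprn_gt0.
by rewrite /pker lef_pV2 ?posrE ?ltr_wpDl ?sqr_ge0// lerDr sqr_ge0.
Qed.

Lemma measurable_pker z : measurable_fun setT (pker z).
Proof.
have [m _] := cmeas_ker z.
rewrite (_ : pker z = fun x => normc (ker z x) ^+ 2).
  by apply: cmeas_sqr; exact: cmeas_ker.
by apply/funext => x; rewrite normc_ker_sqr.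
Qed.

(** The Poisson weight is split evenly as [q x * q x]: Cauchy-Schwarz is applied to $fq$ and $q$,
    and the energy of $q$ is the mass $\pi/\Im z$. *)
Lemma CI_pointwise f z : L2 f -> vanishing f -> 0 < Im z ->
  ((normc (CI f z) ^+ 2)%:E <=
   (4 * (Im z / pi))%:E * \int[mu]_x ((normc (f x) ^+ 2) * pker z x)%:E)%E.
Proof.
move=> Lf vf z0; rewrite CI_poisson//.
have p0 := @pi_gt0 R.
pose q x : R[i] := (Num.sqrt (pker z x))%:C.
have q2 x : q x * q x = (pker z x)%:C by rewrite -rmorphM -expr2 sqr_sqrtr// pker_ge0.
have mq : cmeas q.
  split; last exact: measurable_cst.
  exact: measurableT_comp (continuous_measurable_fun (@sqrt_continuous R)) (measurable_pker z).
have nq x : normc (q x) ^+ 2 = pker z x by rewrite normc_real ger0_norm ?sqrtr_ge0// sqr_sqrtr// pker_ge0.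
have Eq : energy q = (pi / Im z)%:E.
  by rewrite /energy; under eq_integral do rewrite nq; exact: pker_int.
have Lq : L2 q by apply/L2P; split=> //; rewrite Eq ltry.
have Lfq : L2 (fun x => f x * q x).
  apply: (@L2_le _ _ (fun x => (Im z)^-1%:C * f x)).
  - by apply: cmeasM => //; exact: L2_cmeas.
  - exact: L2Z.
  have iz0 : 0 <= (Im z)^-1 by rewrite invr_ge0 ltW.
  move=> x; rewrite !normcM mulrC ler_wpM2r// (normc_real (Im z)^-1) ger0_norm//.
  by rewrite -(ler_pXn2r (n := 2)) ?nnegrE// nq exprVn; exact: pker_bound.
have Efq : energy (fun x => f x * q x) = (\int[mu]_x ((normc (f x) ^+ 2) * pker z x)%:E)%E.
  by apply: eq_integral => x _; rewrite normcM exprMn nq.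
rewrite -Efq (L2_energy Lfq) -EFinM lee_fin normcM exprMn normc_real.
rewrite (_ : (fun x => f x * (pker z x)%:C) = (fun x => (f x * q x) * q x)); last first.
  by apply/funext => x; rewrite -mulrA q2.
rewrite (le_trans (ler_wpM2l _ (cauchy_schwarz4 Lfq Lq)))// ?sqr_ge0// Eq /=.
rewrite gtr0_norm ?divr_gt0// le_eqVlt; apply/orP; left; apply/eqP.
move: p0; generalize (@pi R) => p p0; field; rewrite !gt_eqF//.
Qed.

Lemma measurable_pker2 (y : R) : measurable_fun setT (fun q : R * R => pker (q.1 +i* y) q.2).
Proof.
have m1 : measurable_fun setT (fun q : R * R => (q.2 - q.1) ^+ 2 + y ^+ 2).
  apply: measurable_funD; last exact: measurable_cst.
  by apply: measurable_funX; apply: measurable_funB; [exact: measurable_snd|exact: measurable_fst].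
rewrite (_ : (fun q => _) = (fun q => ((q.2 - q.1) ^+ 2 + y ^+ 2) `^ (-1))); last first.
  by apply/funext => q; rewrite powR_inv1 ?addr_ge0 ?sqr_ge0.
by have := @measurable_powR R (-1) => /measurableT_comp; apply.
Qed.

(* The Cauchy integral is a contraction from the boundary to every horizontal
   line; the constant 4 comes from the crude bound on integrals of complex
   functions and is harmless. *)
Lemma CI_energy_le f (y : R) : L2 f -> vanishing f -> 0 < y ->
  (energy (fun x => CI f (x +i* y)) <= 4%:E * energy f)%E.
Proof.
move=> Lf vf y0; have p0 := @pi_gt0 R.
pose k (q : R * R) := ((normc (f q.2) ^+ 2) * pker (q.1 +i* y) q.2)%:E.
have mf := L2_cmeas Lf.
have mk : measurable_fun setT k.
  apply/measurable_EFinP; apply: measurable_funM; last exact: measurable_pker2.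
  exact: (measurableT_comp (cmeas_sqr mf) measurable_snd).
have k0 q : (0 <= k q)%E by rewrite lee_fin mulr_ge0 ?sqr_ge0// pker_ge0.
have c0 : 0 <= 4 * (y / pi) by rewrite mulr_ge0// divr_ge0// ltW.
apply: (@le_trans _ _ (\int[mu]_x ((4 * (y / pi))%:E * \int[mu]_t k (x, t)))%E).
  apply: ge0_le_integral => //.
  - by move=> x _; rewrite lee_fin sqr_ge0.
  - by apply: measurable_energy; exact: cmeas_CI_line.
  - by apply: measurable_funeM; exact: (@measurable_fun_fubini_tonelli_F _ _ _ _ R mu k mk k0).
  by move=> x _; exact: (CI_pointwise Lf vf (y0 : 0 < Im (x +i* y))).
rewrite ge0_integralZl//; last 2 first.
- exact: (@measurable_fun_fubini_tonelli_F _ _ _ _ R mu k mk k0).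
- by move=> x _; exact: integral_ge0.
rewrite (@fubini_tonelli _ _ _ _ R mu mu k mk k0).
have -> : (\int[mu]_t \int[mu]_x k (x, t) = \int[mu]_t ((pi / y)%:E * (normc (f t) ^+ 2)%:E))%E.
  apply: eq_integral => t _; rewrite /k /=.
  under eq_integral do rewrite EFinM.
  rewrite ge0_integralZl//; last 3 first.
  - apply/measurable_EFinP; exact: (measurableT_comp (measurable_pker2 y) (pair2_measurable t)).
  - by move=> x _; rewrite lee_fin pker_ge0.
  - by rewrite lee_fin sqr_ge0.
  rewrite muleC; congr (_ * _)%E; rewrite -(pker_int (y0 : 0 < Im (t +i* y))).
  by apply: eq_integral => x _; rewrite /pker /= -sqrrN opprB.
rewrite ge0_integralZl//; last 3 first.
- exact: measurable_energy.
- by move=> x _; rewrite lee_fin sqr_ge0.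
- by rewrite lee_fin divr_ge0// ltW.
rewrite muleA -EFinM (_ : 4 * (y / pi) * (pi / y) = 4)//.
by move: p0; generalize (@pi R) => p p0; field; rewrite !gt_eqF.
Qed.

Lemma CI_D f g z : 0 < Im z -> L2 f -> L2 g -> CI (fun x => f x + g x) z = CI f z + CI g z.
Proof.
move=> z0 Lf Lg; have zn : Im z != 0 by rewrite gt_eqF.
have i h : L2 h -> cintegrable (fun x => h x * ker z x).
  by move=> Lh; apply: L2M_integrable => //; exact: L2_ker.
rewrite /CI -mulrDr -cintD; try exact: i.
by congr (_ * _); apply: eq_cint => x; rewrite mulrDl.
Qed.

Lemma CI_Z (c : R[i]) f z : 0 < Im z -> L2 f -> CI (fun x => c * f x) z = c * CI f z.
Proof.
move=> z0 Lf; have zn : Im z != 0 by rewrite gt_eqF.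
have i : cintegrable (fun x => f x * ker z x).
  by apply: L2M_integrable => //; exact: L2_ker.
rewrite /CI mulrCA -(cintZ c i).
by congr (_ * _); apply: eq_cint => x; rewrite mulrA.
Qed.

Lemma CI_B f g z : 0 < Im z -> L2 f -> L2 g -> CI (fun x => f x - g x) z = CI f z - CI g z.
Proof.
move=> z0 Lf Lg; rewrite -mulN1r -CI_Z// -CI_D//; last exact: L2Z.
by congr CI; apply/funext => x; rewrite mulN1r.
Qed.

Lemma CI_small z (e : R) : 0 < Im z -> 0 < e -> exists2 d : R, 0 < d &
  forall g, L2 g -> fine (energy g) < d -> normc (CI g z) < e.
Proof.
move=> z0 e0; have zn : Im z != 0 by rewrite gt_eqF.
pose c := normc ((2 * pi)%:C * 'i%C : R[i])^-1 + 1.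
have c0 : 0 < c by rewrite ltr_wpDl.
have ec : 0 < e / c by rewrite divr_gt0.
have [d d0 H] := inner_small (L2_ker zn) ec.
exists d => // g Lg gd; rewrite /CI normcM.
have := H g Lg gd; rewrite ltr_pdivlMr// => /(le_lt_trans _); apply.
rewrite mulrC (_ : (fun x => ker z x * g x) = (fun x => g x * ker z x)); last first.
  by apply/funext => x; rewrite mulrC.
by rewrite ler_wpM2l// /c lerDl.
Qed.

Lemma vanishing_limit f : L2 f ->
  (forall e : R, 0 < e -> exists g, [/\ L2 g, vanishing g & fine (energy (fun x => f x - g x)) < e]) ->
  vanishing f.
Proof.
move=> Lf H l l0; apply: normc_lt_eq0 => e e0.
have ln : Im l^*%C != 0 by rewrite ImJ oppr_eq0 gt_eqF.
have [d d0 Hd] := inner_small (L2_ker ln) e0.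
have [g [Lg vg fg]] := H _ d0.
have LB := L2B Lf Lg; have := Hd _ LB fg.
rewrite (_ : (fun x => _) = (fun x => f x * ker l^*%C x - g x * ker l^*%C x)); last first.
  by apply/funext => x; ring.
rewrite cintB ?vg// ?subr0//; apply: L2M_integrable => //; exact: L2_ker.
Qed.

(** The extension of a Hardy function can only be its Cauchy integral, by [hardy_CI]. Conversely
    [CI f] is analytic with bounded energies when [f] is [vanishing] ([CI_holo], [CI_energy_le]), so
    it is a Hardy extension as soon as its boundary value is [f]. *)
Lemma H2P f : H2 f <-> [/\ L2 f, vanishing f & boundary_value (CI f) f].
Proof.
split=> [[Lf [F hF bF]]|[Lf vf bf]].
- split=> //; first exact: hardy_vanishing bF.
  apply/boundary_valueP => e e0; have /boundary_valueP/(_ e e0)[d d0 H] := bF.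
  exists d => // y y0; have := H y y0.
  rewrite (_ : (fun x => F (x +i* y) - f x) = (fun x => CI f (x +i* y) - f x))//.
  apply/funext => x; congr (_ - _); apply: hardy_CI hF bF _ => //.
  by case/andP: y0.
- split=> //; exists (CI f) => //; apply/hardy_uhpP; split; first exact: CI_holo.
  exists (4 * fine (energy f)) => y y0; rewrite EFinM -L2_energy//.
  exact: CI_energy_le.
Qed.

Lemma H2_L2 f : H2 f -> L2 f. Proof. by case. Qed.

Lemma H2_vanishing f : H2 f -> vanishing f. Proof. by case/H2P. Qed.

Lemma H2_ext f F z : L2 f -> hardy_uhp F -> boundary_value F f -> 0 < Im z -> CI f z = F z.
Proof. by move=> Lf hF bF z0; rewrite (hardy_CI Lf hF bF z0). Qed.

(** On a low horizontal line [CI f] is close to [CI g], by the energy bound for the Cauchy integral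
    of [f - g]; [CI g] is close to [g] since [g] is a Hardy function, and [g] is close to [f]. *)
Lemma hardy_closed f : L2 f ->
  (forall e : R, 0 < e -> exists g, H2 g /\ fine (energy (fun x => f x - g x)) < e) -> H2 f.
Proof.
move=> Lf H.
have vf : vanishing f.
  apply: vanishing_limit => // e /H[g [Hg ge]]; exists g; split=> //.
    exact: H2_L2.
  exact: H2_vanishing.
apply/H2P; split=> //; apply/boundary_valueP => e e0.
(* Two uses of [energyB_le] give $2\cdot4+2(2+2)=16$ parts of $e/24$. *)
have e1 : 0 < e / 24 by lra.
have [g [Hg ge]] := H _ e1.
have /H2P[Lg vg /boundary_valueP/(_ _ e1)[d d0 Hd]] := Hg.
exists d => // y y0; have y0' := (andP y0).1.
have LB := L2B Lf Lg.
have vB : vanishing (fun x => f x - g x).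
  move=> l l0; have ln : Im l^*%C != 0 by rewrite ImJ oppr_eq0 gt_eqF.
  rewrite (_ : (fun x => _) = (fun x => f x * ker l^*%C x - g x * ker l^*%C x)); last first.
    by apply/funext => x; rewrite mulrBl.
  by rewrite cintB ?vf ?vg ?subr0//; apply: L2M_integrable => //; exact: L2_ker.
have mf := L2_cmeas Lf; have mg := L2_cmeas Lg.
have mCf := cmeas_CI_line Lf y0'; have mCg := cmeas_CI_line Lg y0'.
have h1 : (energy (fun x => CI f (x +i* y) - CI g (x +i* y))%R <= (4 * (e / 24))%:E)%E.
  rewrite (_ : (fun x => CI f (x +i* y) - CI g (x +i* y)) = (fun x => CI (fun t => f t - g t) (x +i* y))).
    apply: le_trans (CI_energy_le LB vB y0') _.
    by rewrite (L2_energy LB) -EFinM lee_fin ler_wpM2l// ltW.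
  by apply/funext => x; rewrite CI_B.
have h2 := ltW (Hd y y0).
have h3 : (energy (fun x => g x - f x)%R <= (e / 24)%:E)%E.
  by rewrite energyC (L2_energy LB) lee_fin ltW.
apply: (@le_lt_trans _ _ (2%:E * (4 * (e / 24))%:E + 2%:E * (2%:E * (e / 24)%:E + 2%:E * (e / 24)%:E))%E).
  apply: le_trans (energyB_le mCf mCg mf) _; apply: leeD; first exact: lee_wpmul2l.
  apply: lee_wpmul2l => //; apply: le_trans (energyB_le mCg mg mf) _.
  by apply: leeD; exact: lee_wpmul2l.
rewrite -!(EFinM, EFinD) lte_fin; lra.
Qed.

End HardyClosed.

(** * Inner functions as multipliers of the Hardy space *)

Section InnerMultipliers.
Context {R : realType}.
Notation mu := (@lebesgue_measure R).
Implicit Types (F Q : R[i] -> R[i]) (f g h : R -> R[i]) (z w l : R[i]).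

(** Membership and the values of [CI] come together, from any analytic candidate: uniqueness of the
    extension identifies the candidate with the Cauchy integral. *)
Lemma H2_ext_intro F f (M : R) : L2 f -> holo_uhp F ->
  (forall y : R, 0 < y -> (energy (fun x => F (x +i* y)) <= M%:E)%E) ->
  (forall e : R, 0 < e -> exists2 d : R, 0 < d & forall y, 0 < y < d ->
    (energy (fun x => F (x +i* y) - f x)%R < e%:E)%E) ->
  H2 f /\ forall z, 0 < Im z -> CI f z = F z.
Proof.
move=> Lf dF FM bF.
have hF : hardy_uhp F by apply/hardy_uhpP; split=> //; exists M.
have bf : boundary_value F f by apply/boundary_valueP.
by split=> [|z z0]; [split=> //; exists F|exact: H2_ext].
Qed.

Lemma H2_lin (c : R[i]) f g : H2 f -> H2 g -> H2 (fun x => c * f x + g x).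
Proof.
move=> Hf Hg; have Lf := H2_L2 Hf; have Lg := H2_L2 Hg; have Lcf := L2Z c Lf.
have Ls : L2 (fun x => c * f x + g x) by exact: L2D.
have /H2P[_ vf /boundary_valueP bf] := Hf; have /H2P[_ vg /boundary_valueP bg] := Hg.
apply/H2P; split=> //.
  move=> l l0; have ln : Im l^*%C != 0 by rewrite ImJ oppr_eq0 gt_eqF.
  have := CI_D; rewrite (_ : (fun x => _) = (fun x => c * (f x * ker l^*%C x) + g x * ker l^*%C x)) => [_|].
    have i h : L2 h -> cintegrable (fun x => h x * ker l^*%C x).
      by move=> Lh; apply: L2M_integrable => //; exact: L2_ker.
    rewrite cintD; [|by apply: cintegrableZ; exact: i|exact: i].
    by rewrite cintZ ?vf ?vg ?mulr0 ?addr0//; exact: i.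
  by apply/funext => x; ring.
apply/boundary_valueP => e e0.
pose K := 2 * normc c ^+ 2 + 2.
have K0 : 0 < K by rewrite ltr_wpDl// mulr_ge0// sqr_ge0.
have eK : 0 < e / K by rewrite divr_gt0.
have [d1 d10 H1] := bf _ eK; have [d2 d20 H2'] := bg _ eK.
exists (Num.min d1 d2); first by rewrite lt_min d10.
move=> y; rewrite lt_min => /andP[y0 /andP[y1 y2]].
have m1 : cmeas (fun x => CI f (x +i* y) - f x).
  by apply: cmeasB; [exact: cmeas_CI_line|exact: L2_cmeas].
have m2 : cmeas (fun x => CI g (x +i* y) - g x).
  by apply: cmeasB; [exact: cmeas_CI_line|exact: L2_cmeas].
rewrite (_ : (fun x => _) = (fun x => c * (CI f (x +i* y) - f x)) \+ (fun x => CI g (x +i* y) - g x)); last first.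
  by apply/funext => x /=; rewrite CI_D ?CI_Z//; ring.
apply: le_lt_trans (energyD (cmeasZ c m1) m2) _.
rewrite energyZ//.
have {}H1 := H1 y; rewrite y0 y1 in H1; have {}H1 := H1 isT.
have {}H2' := H2' y; rewrite y0 y2 in H2'; have {}H2' := H2' isT.
have -> : e%:E = (2%:E * ((normc c ^+ 2)%:E * (e / K)%:E) + 2%:E * (e / K)%:E)%E.
  by rewrite -!(EFinM, EFinD); congr EFin; rewrite /K; field; rewrite gt_eqF.
apply: lee_ltD => //.
- rewrite fin_numM// fin_numM// ge0_fin_numE ?energy_ge0//.
  by apply: lt_trans H1 _; rewrite ltry.
- apply: lee_wpmul2l => //; apply: lee_wpmul2l; first by rewrite lee_fin sqr_ge0.
  exact: ltW.
- by rewrite lte_pmul2l.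
Qed.

Lemma H2_cst0 : @H2 R (fun=> 0).
Proof.
have [] // := @H2_ext_intro (fun=> 0) (fun=> 0) 0 L2_0.
- by move=> z z0; exists 0; exact: cdiff_cst.
- move=> y y0; have := @L2_0 R => /L2_energy; rewrite /energy => _.
  under eq_integral do rewrite normc0 expr0n.
  by rewrite integral0.
- move=> e e0; exists 1 => // y y0; rewrite /energy.
  under eq_integral do rewrite subrr normc0 expr0n.
  by rewrite integral0 lte_fin.
Qed.

Lemma H2Z (c : R[i]) f : H2 f -> H2 (fun x => c * f x).
Proof.
move=> Hf; have := H2_lin c Hf H2_cst0; congr H2.
by apply/funext => x; rewrite addr0.
Qed.

(** The resolvent identity: the difference is $-iy$ times the product of the two kernels, one of
    which is at most $1/\Im l$. *)
Lemma ker_shift_diff l (y x : R) : 0 < Im l -> 0 < y ->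
  normc (ker (l^*%C - y *i) x - ker l^*%C x) <= y / Im l * normc (ker l^*%C x).
Proof.
move=> l0 y0.
have I1 : `|Im (l^*%C - y *i)| = Im l + y.
  by rewrite !ReImE -opprD normrN gtr0_norm//; lra.
have n1 : Im (l^*%C - y *i) != 0 by rewrite -normr_gt0 I1; lra.
have n2 : Im l^*%C != 0 by rewrite ImJ oppr_eq0 gt_eqF.
have h1 : x%:C - (l^*%C - y *i) != 0 by apply: (@subr_real_neq0 R x 0); rewrite eq_sym.
have h2 : x%:C - l^*%C != 0 by apply: (@subr_real_neq0 R x 0); rewrite eq_sym.
have -> : ker (l^*%C - y *i) x - ker l^*%C x = - (y *i) * ker (l^*%C - y *i) x * ker l^*%C x.
  by rewrite /ker; move: h1 h2; generalize (l^*%C) (y *i) => a b h1 h2; field; apply/andP.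
rewrite normcM ler_wpM2r// normcM normcN.
have -> : normc (y *i) = y by rewrite /Normc.normc expr0n /= add0r sqrtr_sqr gtr0_norm.
apply: ler_wpM2l; first exact: ltW.
rewrite (le_trans (normc_ker_le _ n1))// I1.
by rewrite lef_pV2 ?posrE; lra.
Qed.

(** The pole lies below the line, so $(z-\bar l)^{-1}$ is itself the extension; moving up by $y$
    changes the boundary function by a relative error of at most $y/\Im l$. *)
Lemma H2_ker l : 0 < Im l -> H2 (ker l^*%C) /\
  forall z, 0 < Im z -> CI (ker l^*%C) z = (z - l^*%C)^-1.
Proof.
move=> l0; have n2 : Im l^*%C != 0 by rewrite ImJ oppr_eq0 gt_eqF.
have Ln := L2_ker n2.
apply: (@H2_ext_intro (fun z => (z - l^*%C)^-1) (ker l^*%C) (pi / Im l)) => //.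
- move=> z z0; eexists; apply: cdiff_inv; rewrite -subr_eq0; case: z z0 => a b /= b0.
  by apply: subr_real_neq0; rewrite ImJ; lra.
- move=> y y0; under eq_fun do rewrite kernel_shift.
  have I1 : `|Im (l^*%C - y *i)| = Im l + y.
    by rewrite !ReImE -opprD normrN gtr0_norm//; lra.
  rewrite energy_ker -?normr_gt0 ?I1; last by lra.
  by rewrite lee_fin ler_pM2l ?pi_gt0// lef_pV2 ?posrE; lra.
- move=> e e0; pose K := pi / Im l ^+ 3.
  have K0 : 0 < K by rewrite divr_gt0 ?pi_gt0// exprn_gt0.
  exists (Num.min 1 (e / K)); first by rewrite lt_min ltr01 divr_gt0.
  move=> y; rewrite lt_min => /andP[y0 /andP[y1]]; rewrite ltr_pdivlMr// => yK.
  apply: (@le_lt_trans _ _ ((normc (y / Im l)%:C ^+ 2)%:E * energy (ker l^*%C))%E).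
    rewrite -energyZ; last exact: cmeas_ker.
    apply: le_energy.
    - apply: cmeasB; last exact: cmeas_ker.
      by under eq_fun do rewrite kernel_shift; exact: cmeas_ker.
    - by apply: cmeasZ; exact: cmeas_ker.
    have yl0 : 0 <= y / Im l by rewrite divr_ge0// ltW.
    move=> x; rewrite kernel_shift normcM normc_real ger0_norm//.
    exact: ker_shift_diff.
  rewrite energy_ker// ImJ normrN gtr0_norm// -EFinM lte_fin normc_real.
  rewrite real_normK ?num_real//.
  have -> : (y / Im l) ^+ 2 * (pi / Im l) = y * (y * K).
    by rewrite /K; generalize (@pi R) => p; field; rewrite gt_eqF.
  apply: le_lt_trans yK; rewrite ler_piMl//; last exact: ltW.
  by apply: mulr_ge0; exact: ltW.
Qed.

(** A working form of inner function: [Q] is unimodular on the line, and multiplication by it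
    preserves [H2] and multiplies the extension by [Q]. In this form the notion passes to products
    and to pointwise limits. *)
Definition inner_mult Q := [/\ forall x : R, normc (Q x%:C) = 1,
  cmeas (fun x : R => Q x%:C) &
  forall h, H2 h -> H2 (fun x => Q x%:C * h x) /\
    forall z, 0 < Im z -> CI (fun x => Q x%:C * h x) z = Q z * CI h z].

Lemma inner_mult_cst (c : R[i]) : normc c = 1 -> inner_mult (fun=> c).
Proof.
move=> c1; split=> [//||h Hh]; first exact: cmeas_cst.
by split; [exact: H2Z|move=> z z0; rewrite CI_Z//; exact: H2_L2].
Qed.

Lemma inner_multM P Q : inner_mult P -> inner_mult Q -> inner_mult (fun z => P z * Q z).
Proof.
move=> [P1 mP HP] [Q1 mQ HQ]; split=> [x||h Hh].
- by rewrite normcM P1 Q1 mulr1.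
- exact: cmeasM.
have [q1 q2] := HQ h Hh; have [p1 p2] := HP _ q1.
have -> : (fun x : R => P x%:C * Q x%:C * h x) = (fun x : R => P x%:C * (Q x%:C * h x)).
  by apply/funext => x; rewrite mulrA.
by split=> // z z0; rewrite p2// q2// mulrA.
Qed.

Definition blaschke l z := (z - l) / (z - l^*%C).

Lemma blaschke_le1 l z : 0 < Im l -> 0 <= Im z -> normc (blaschke l z) <= 1.
Proof.
move=> l0 z0; rewrite normc_div ler_pdivrMr ?mul1r; last first.
  rewrite normc_gt0; case: z z0 => a b /= b0.
  by apply: subr_real_neq0; rewrite ImJ; lra.
rewrite -(ler_pXn2r (n := 2)) ?nnegrE// !normc_sqr !ReImE lerD2l opprK.
nra.
Qed.

Lemma blaschke_real l (x : R) : Im l != 0 -> normc (blaschke l x%:C) = 1.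
Proof.
move=> l0; rewrite normc_div -(normcJ_ (x%:C - l)) conjcB conjc_real divff//.
rewrite normc_eq0; apply: (@subr_real_neq0 R x 0); rewrite ImJ eq_sym oppr_eq0//.
Qed.

(** Writing the Blaschke factor as $b=1+(\bar l-l)/(z-\bar l)$ shows that $b(x+iy)-b(x)$ is $O(y)$
    uniformly in $x$. Together with $|b|\le1$ this lets the boundary limit for [h] pass to the
    product. *)
Lemma inner_mult_blaschke l : 0 < Im l -> inner_mult (blaschke l).
Proof.
move=> l0; have ln : Im l != 0 by rewrite gt_eqF.
have zl z : 0 <= Im z -> z != l^*%C.
  move=> z0; rewrite -subr_eq0; case: z z0 => a b /= b0.
  by apply: subr_real_neq0; rewrite ImJ; lra.
have mb : cmeas (fun x : R => blaschke l x%:C).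
  by apply: cmeasM; [apply: cmeasB; [exact: cmeas_real|exact: cmeas_cst]|exact: cmeas_ker].
have mbl (y : R) : 0 < y -> cmeas (fun x : R => blaschke l (x +i* y)).
  move=> y0; apply: cmeasM.
    apply: cmeasB; last exact: cmeas_cst.
    by split; [exact: measurable_id|exact: measurable_cst].
  by under eq_fun do rewrite kernel_shift; exact: cmeas_ker.
split=> [x||h Hh]; [exact: blaschke_real|exact: mb|].
have /H2P[Lh vh /boundary_valueP bh] := Hh; have mh := L2_cmeas Lh.
apply: (@H2_ext_intro (fun z => blaschke l z * CI h z) _ (4 * fine (energy h))).
- apply: (L2_le _ Lh); first exact: cmeasM.
  by move=> x; rewrite normcM blaschke_real// mul1r.
- move=> z z0; have [L dL] := CI_holo Lh z0; eexists.
  apply: cdiffM dL; apply: cdiffM; first exact: cdiff_subr.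
  by apply: cdiff_inv; apply: zl; exact: ltW.
- move=> y y0; rewrite EFinM -L2_energy//.
  apply: le_trans (CI_energy_le Lh vh y0); apply: le_energy.
  + by apply: cmeasM; [exact: mbl|exact: cmeas_CI_line].
  + exact: cmeas_CI_line.
  by move=> x; rewrite normcM ler_piMl// blaschke_le1//= ltW.
- move=> e e0; have e4 : 0 < e / 4 by lra.
  have [d d0 Hd] := bh _ e4.
  pose K := 8 / Im l ^+ 2 * fine (energy h) + 1.
  have K0 : 0 < K by rewrite ltr_wpDl// mulr_ge0 ?fine_energy_ge0// divr_ge0// sqr_ge0.
  exists (Num.min d (Num.min 1 (e / 2 / K))).
    by rewrite !lt_min d0 ltr01 !divr_gt0.
  move=> y; rewrite !lt_min => /andP[y0 /andP[yd /andP[y1]]]; rewrite ltr_pdivlMr// => yK.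
  have m1 : cmeas (fun x => CI h (x +i* y) - h x).
    by apply: cmeasB => //; exact: cmeas_CI_line.
  have m2 : cmeas (fun x : R => blaschke l (x +i* y) - blaschke l x%:C).
    by apply: cmeasB => //; exact: mbl.
  rewrite (_ : (fun x => _) = (fun x => blaschke l (x +i* y) * (CI h (x +i* y) - h x)) \+
     (fun x => (blaschke l (x +i* y) - blaschke l x%:C) * h x)); last first.
    by apply/funext => x /=; ring.
  apply: le_lt_trans (energyD _ _) _; [by apply: cmeasM => //; exact: mbl|exact: cmeasM|].
  have B1 : (energy (fun x => blaschke l (x +i* y) * (CI h (x +i* y) - h x))%R < (e / 4)%:E)%E.
    apply: le_lt_trans (Hd y _); last by rewrite y0.
    apply: le_energy => //; first by apply: cmeasM => //; exact: mbl.
    by move=> x; rewrite normcM ler_piMl// blaschke_le1//= ltW.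
  have bE z : 0 <= Im z -> blaschke l z = 1 + (l^*%C - l) * (z - l^*%C)^-1.
    move=> /zl; rewrite -subr_eq0 /blaschke; generalize (l^*%C) => a za.
    by field.
  have B2 : (energy (fun x => (blaschke l (x +i* y) - blaschke l x%:C) * h x)%R <=
      (4 * y ^+ 2 / Im l ^+ 2)%:E * energy h)%E.
    have -> : 4 * y ^+ 2 / Im l ^+ 2 = normc (2 * y / Im l)%:C ^+ 2.
      by rewrite normc_real real_normK ?num_real//; field.
    rewrite -energyZ//; apply: le_energy; [exact: cmeasM|exact: cmeasZ|].
    move=> x; rewrite !normcM ler_wpM2r//.
    rewrite !bE ?lexx//=; last exact: ltW.
    rewrite opprD addrACA subrr add0r -mulrBr normcM.
    have -> : normc (l^*%C - l) = 2 * Im l.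
      rewrite (_ : l^*%C - l = (- (2 * Im l))%:C * 'i%C).
        by rewrite normcM normc_i mulr1 normc_real normrN gtr0_norm// mulr_gt0.
      by apply: complex_ext; rewrite !ReImE; ring.
    rewrite kernel_shift normc_real ger0_norm; last by rewrite divr_ge0 ?mulr_ge0// ltW.
    have := ker_shift_diff x l0 y0; rewrite -/(ker _ x).
    have n2 : Im l^*%C != 0 by rewrite ImJ oppr_eq0.
    have := normc_ker_le x n2; rewrite ImJ normrN gtr0_norm// => k1 k2.
    have k3 : y / Im l * normc (ker l^*%C x) <= y / Im l * (Im l)^-1.
      by rewrite ler_wpM2l// divr_ge0// ltW.
    apply: (@le_trans _ _ (2 * Im l * (y / Im l * (Im l)^-1))).
      by rewrite ler_wpM2l ?mulr_ge0 ?(ltW l0)// (le_trans k2).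
    by rewrite le_eqVlt; apply/orP; left; apply/eqP; field.
  apply: (@le_lt_trans _ _ (2%:E * (e / 4)%:E + 2%:E * ((4 * y ^+ 2 / Im l ^+ 2)%:E * energy h))%E).
    by apply: leeD; apply: lee_wpmul2l => //; exact: ltW.
  rewrite (L2_energy Lh) -!(EFinM, EFinD) lte_fin.
  have -> : 2 * (4 * y ^+ 2 / Im l ^+ 2 * fine (energy h)) = y * (y * (K - 1)).
    by rewrite /K; field.
  have yy : y * (y * (K - 1)) <= y * (K - 1).
    have K1 : 0 <= K - 1.
      by rewrite /K addrK mulr_ge0 ?fine_energy_ge0// divr_ge0// sqr_ge0.
    by rewrite ler_piMl//; [apply: mulr_ge0 => //; exact: ltW|exact: ltW].
  lra.
Qed.

End InnerMultipliers.

Section InnerLimits.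
Context {R : realType}.
Notation mu := (@lebesgue_measure R).
Implicit Types (Q : R[i] -> R[i]) (f g h : R -> R[i]) (z w l : R[i]).

(** Dominated convergence with majorant $4|h|^2$ for the squared differences. *)
Lemma energy_dominated (u : nat -> R -> R[i]) f h : (forall n, cmeas (u n)) -> cmeas f -> L2 h ->
  (forall n x, normc (u n x) <= normc (h x)) -> (forall x, normc (f x) <= normc (h x)) ->
  (forall x, (u ^~ x : nat -> R[i]^o) @ \oo --> (f x : R[i]^o)) ->
  forall e : R, 0 < e -> exists N, forall n, (N <= n)%N ->
    (energy (fun x => u n x - f x)%R < e%:E)%E.
Proof.
move=> mu_ mf Lh uh fh uf e e0.
pose v n (x : R) : \bar R := (normc (u n x - f x) ^+ 2)%:E.
have mv n : measurable_fun setT (v n) by apply: measurable_energy; exact: cmeasB.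
have mh := L2_cmeas Lh.
pose g (x : R) : \bar R := (4%:E * (normc (h x) ^+ 2)%:E)%E.
have ig : mu.-integrable setT g.
  apply/integrableP; split; first by apply: measurable_funeM; exact: measurable_energy.
  under eq_integral do rewrite gee0_abs ?mule_ge0 ?lee_fin ?sqr_ge0//.
  rewrite ge0_integralZl//; last 2 first.
  - exact: measurable_energy.
  - by move=> x _; rewrite lee_fin sqr_ge0.
  by rewrite -/(energy h) (L2_energy Lh) -EFinM ltry.
have cv : (\int[mu]_x v n x)%E @[n --> \oo] --> (\int[mu]_(x in setT) (cst 0 x))%E.
  apply: (@dominated_cvg _ _ _ mu setT _ v (cst 0%E) g) => //.
  - move=> x _; apply/fine_cvgP; split; first exact: nearW.
    have /ccvgP h1 := uf x.
    rewrite /v /= -(mulr0 (0 : R)); under eq_fun do rewrite expr2.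
    exact: cvgM.
  - move=> n x _; rewrite gee0_abs ?lee_fin ?sqr_ge0// /g /=.
    have : normc (u n x - f x) <= 2 * normc (h x).
      rewrite (le_trans (normcD _ _))// normcN.
      by have := uh n x; have := fh x; lra.
    have -> : 4 * normc (h x) ^+ 2 = (2 * normc (h x)) ^+ 2 by ring.
    by move=> h2; rewrite ler_pXn2r ?nnegrE ?mulr_ge0.
rewrite integral_cst//= mul0e in cv.
have /fine_cvgP[[N1 _ fin] /cvgrPdist_lt/(_ _ e0)[N2 _ ce]] := cv.
exists (maxn N1 N2) => n; rewrite geq_max => /andP[n1 n2].
have := fin n n1; have := ce n n2; rewrite /= sub0r normrN => h1 h2.
rewrite -/(energy _) in h1 h2 *.
by rewrite -(fineK h2) lte_fin (le_lt_trans (ler_norm _)).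
Qed.

(** The multipliers being unimodular on the line, dominated convergence gives $Q_nh\to Qh$ in $L^2$.
    Closedness of [H2] then contains $Qh$, and continuity of [CI] at a point ([CI_small]) identifies
    its extension. This is the passage from finite to infinite Blaschke products. *)
Lemma inner_mult_lim (Q_ : nat -> R[i] -> R[i]) Q : (forall n, inner_mult (Q_ n)) ->
  (forall z, 0 <= Im z -> (Q_ ^~ z : nat -> R[i]^o) @ \oo --> (Q z : R[i]^o)) -> inner_mult Q.
Proof.
move=> HQ cQ.
have cx (x : R) : (Q_ ^~ x%:C : nat -> R[i]^o) @ \oo --> (Q x%:C : R[i]^o) by apply: cQ.
have mQ n : cmeas (fun x : R => Q_ n x%:C) by case: (HQ n).
have mQ' : cmeas (fun x : R => Q x%:C) by apply: cmeas_cvg mQ _; exact: cx.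
have nQ n (x : R) : normc (Q_ n x%:C) = 1 by case: (HQ n).
have nQ' (x : R) : normc (Q x%:C) = 1.
  have h : normc (Q_ n x%:C) @[n --> \oo] --> normc (Q x%:C) by apply: cvg_normc; exact: cx.
  rewrite -(cvg_lim (@Rhausdorff R) h); under eq_fun do rewrite nQ.
  by rewrite lim_cst//; exact: Rhausdorff.
split=> // h Hh; have Lh := H2_L2 Hh; have mh := L2_cmeas Lh.
have LQ : L2 (fun x => Q x%:C * h x).
  by apply: (L2_le _ Lh); [exact: cmeasM|move=> x; rewrite normcM nQ' mul1r].
have LQn n : L2 (fun x => Q_ n x%:C * h x).
  by apply: (L2_le _ Lh); [exact: cmeasM|move=> x; rewrite normcM nQ mul1r].
have E (e : R) : 0 < e -> exists N, forall n, (N <= n)%N ->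
    fine (energy (fun x => Q x%:C * h x - Q_ n x%:C * h x)) < e.
  move=> e0; have [|||||N HN] := @energy_dominated (fun n x => Q_ n x%:C * h x)
    (fun x => Q x%:C * h x) h _ _ Lh _ _ _ e e0.
  - by move=> n; exact: cmeasM.
  - exact: cmeasM.
  - by move=> n x; rewrite normcM nQ mul1r.
  - by move=> x; rewrite normcM nQ' mul1r.
  - by move=> x; apply: cvgMl; exact: cx.
  exists N => n /HN; rewrite energyC => hn.
  by rewrite -lte_fin -L2_energy//; exact: L2B.
have HQh : H2 (fun x => Q x%:C * h x).
  apply: hardy_closed => // e /E[N HN]; exists (fun x => Q_ N x%:C * h x).
  by split; [case: (HQ N) => _ _ /(_ h Hh)[]|exact: HN].
split=> // z z0; apply/eqP; rewrite -subr_eq0; apply/eqP; apply: normc_lt_eq0 => e e0.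
have e2 : 0 < e / 2 by lra.
have [d d0 Hd] := CI_small z0 e2.
have [N1 HN1] := E _ d0.
pose c := normc (CI h z) + 1.
have c0 : 0 < c by rewrite ltr_wpDl.
have ec : 0 < e / 2 / c by rewrite divr_gt0.
have /ccvgP/cvg_normc0P/(_ _ ec)[N2 _ HN2] := cQ z (ltW z0).
pose n := maxn N1 N2.
have h1 := Hd _ (L2B LQ (LQn n)) (HN1 n (leq_maxl _ _)).
have := HN2 n (leq_maxr _ _); rewrite /= ltr_pdivlMr// => h2.
rewrite CI_B// in h1.
have hn : CI (fun x => Q_ n x%:C * h x) z = Q_ n z * CI h z.
  by case: (HQ n) => _ _ /(_ h Hh)[_ ->].
rewrite hn in h1.
have -> : CI (fun x => Q x%:C * h x) z - Q z * CI h z =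
  (CI (fun x => Q x%:C * h x) z - Q_ n z * CI h z) + (Q_ n z - Q z) * CI h z by ring.
rewrite (le_lt_trans (normcD _ _))// (splitr e) ltrD// normcM (le_lt_trans _ h2)//.
by rewrite ler_wpM2l// /c lerDl.
Qed.

End InnerLimits.

(** * Infinite products *)

Section Products.
Context {R : realType}.
Implicit Types (u : nat -> R[i]) (a : nat -> R).

(** Induction through $pq-1=(p-1)(q-1)+(p-1)+(q-1)$, compared with the same expansion for
    exponentials, and $1+a\le e^a$. *)
Lemma prod_sub1_le u a n : (forall k, normc (u k - 1) <= a k) ->
  normc (\prod_(k < n) u k - 1) <= expR (\sum_(k < n) a k) - 1.
Proof.
move=> ua; have a0 k : 0 <= a k by exact: le_trans (normc_ge0 _) (ua k).
elim: n => [|n IH]; first by rewrite !big_ord0 expR0 !subrr normc0.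
rewrite !big_ord_recr /= expRD.
set p := \prod_(k < n) _ in IH *; set s := \sum_(k < n) _ in IH *.
have -> : p * u n - 1 = (p - 1) * (u n - 1) + (p - 1) + (u n - 1) by ring.
rewrite (le_trans (normcD _ _))// (le_trans (lerD (normcD _ _) (lexx _)))// normcM.
have un := ua n; have ea := expR_ge1Dx (a n).
have e0 : 0 <= expR s - 1 by apply: le_trans IH.
have : normc (p - 1) * normc (u n - 1) <= (expR s - 1) * (expR (a n) - 1).
  by apply: ler_pM => //; lra.
lra.
Qed.

Lemma prod_norm_le u a n : (forall k, normc (u k - 1) <= a k) ->
  normc (\prod_(k < n) u k) <= expR (\sum_(k < n) a k).
Proof.
move=> ua; have := prod_sub1_le n ua.
by have := normcBl (\prod_(k < n) u k) 1; rewrite normc1; lra.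
Qed.

(** The partial products are bounded by $e^S$, so their successive differences are dominated by
    $e^Sa_k$ and are absolutely summable. *)
Lemma iprod_cvg u a (S : R) : (forall k, normc (u k - 1) <= a k) ->
  (forall n, \sum_(k < n) a k <= S) ->
  ((fun n => \prod_(k < n) u k) : nat -> R[i]^o) @ \oo --> (iprod u : R[i]^o).
Proof.
move=> ua aS; have a0 k : 0 <= a k by exact: le_trans (normc_ge0 _) (ua k).
pose p n := \prod_(k < n) u k.
have pS n : normc (p n.+1 - p n) <= expR S * a n.
  rewrite /p big_ord_recr /= -{2}(mulr1 (\prod_(k < n) u k)) -mulrBr normcM.
  apply: ler_pM => //; rewrite (le_trans (prod_norm_le n ua))//.
  by rewrite ler_expR.
have cs : cvgn (series a).
  apply: nondecreasing_is_cvgn.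
    apply/nondecreasing_seqP => n; rewrite /series /= big_nat_recr//= lerDl//.
  by exists S => _ [n _ <-]; rewrite /series /= big_mkord.
have csb : cvgn (series (fun n => expR S * a n)).
  have -> : series (fun n => expR S * a n) = (fun n => expR S * series a n).
    by apply/funext => n; rewrite /series /= mulr_sumr.
  by apply: is_cvgMr.
have cv (v : nat -> R) : (forall n, `|v n.+1 - v n| <= expR S * a n) -> cvgn v.
  move=> va.
  have c1 : cvgn [normed series (fun n => v n.+1 - v n)].
    apply: series_le_cvg csb => [n|n|n]; [exact: normr_ge0| |exact: va].
    by apply: mulr_ge0 => //; exact: expR_ge0.
  have c2 := normed_cvg c1.
  have -> : v = (fun n => v 0%N + series (fun n => v n.+1 - v n) n).
    by apply/funext => n; rewrite /series /= telescope_sumr// addrC subrK.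
  by apply: is_cvgD => //; exact: is_cvg_cst.
have c1 : cvgn (fun n => Re (p n)).
  by apply: cv => n; rewrite -ReB (le_trans (normc_Re _)).
have c2 : cvgn (fun n => Im (p n)).
  by apply: cv => n; rewrite -ImB (le_trans (normc_Im _)).
have H : (p : nat -> R[i]^o) @ \oo --> ((limn (fun n => Re (p n)) +i* limn (fun n => Im (p n))) : R[i]^o).
  by apply/ccvg_ReIm.
by rewrite /iprod (cseqlim_eq H).
Qed.

Lemma normc_lim_le (v : nat -> R[i]) l (b : R[i]) (M : R) : (v : nat -> R[i]^o) @ \oo --> (l : R[i]^o) ->
  (forall n, normc (v n - b) <= M) -> normc (l - b) <= M.
Proof.
move=> vl vM.
have h : ((fun n => v n - b) : nat -> R[i]^o) @ \oo --> ((l - b) : R[i]^o).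
  by apply: cvgB => //; exact: cvg_cst.
have h2 : normc (v n - b) @[n --> \oo] --> normc (l - b) by apply: cvg_normc; exact: h.
rewrite -(cvg_lim (@Rhausdorff R) h2); apply: limr_le; last exact: nearW.
by apply/cvg_ex; eexists; exact: h2.
Qed.

Lemma iprod_sub1_le u a (S : R) : (forall k, normc (u k - 1) <= a k) ->
  (forall n, \sum_(k < n) a k <= S) -> normc (iprod u - 1) <= expR S - 1.
Proof.
move=> ua aS; apply: (normc_lim_le (iprod_cvg ua aS)) => n.
by rewrite (le_trans (prod_sub1_le n ua))// lerD2r ler_expR.
Qed.

Lemma iprod_recl u (l : R[i]) :
  ((fun n => \prod_(k < n) u k.+1) : nat -> R[i]^o) @ \oo --> (l : R[i]^o) ->
  iprod u = u 0%N * l.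
Proof.
move=> h; apply: cseqlim_eq; rewrite -cvg_shiftS.
under eq_fun do rewrite big_ord_recl.
by apply: cvgMr.
Qed.

Lemma iprodM u (v : nat -> R[i]) (lu lv : R[i]) :
  ((fun n => \prod_(k < n) u k) : nat -> R[i]^o) @ \oo --> (lu : R[i]^o) ->
  ((fun n => \prod_(k < n) v k) : nat -> R[i]^o) @ \oo --> (lv : R[i]^o) ->
  ((fun n => \prod_(k < n) (u k * v k)) : nat -> R[i]^o) @ \oo --> ((lu * lv) : R[i]^o).
Proof.
move=> hu hv; under eq_fun do rewrite big_split /=.
exact: cvgM.
Qed.

Lemma telescope_inv (N n : nat) :
  \sum_(k < n) (((N + k).+1%:R * (N + k).+2%:R)^-1 : R) <= N.+1%:R^-1.
Proof.
suff -> : \sum_(k < n) (((N + k).+1%:R * (N + k).+2%:R)^-1 : R) = N.+1%:R^-1 - (N + n).+1%:R^-1.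
  by rewrite gerBl invr_ge0.
elim: n => [|n IH]; first by rewrite big_ord0 addn0 subrr.
rewrite big_ord_recr /= IH addnS.
have h1 : (N + n).+1%:R != 0 :> R by rewrite pnatr_eq0.
have h2 : (N + n).+2%:R = (N + n).+1%:R + 1 :> R by rewrite natr1.
have h3 : (N + n).+1%:R + 1 != 0 :> R by rewrite -h2 pnatr_eq0.
have E (c x : R) : x != 0 -> x + 1 != 0 -> c - x^-1 + (x * (x + 1))^-1 = c - (x + 1)^-1.
  by move=> x0 x1; field; rewrite x0 x1.
by rewrite h2; exact: E.
Qed.

(** The tail from [m] on is within $e^{1/4}-1<1$ of 1, and only finitely many factors, all nonzero,
    come before it. *)
Lemma iprod_neq0 u a (S : R) (m : nat) : (forall k, normc (u k - 1) <= a k) ->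
  (forall n, \sum_(k < n) a k <= S) -> (forall k, u k != 0) ->
  (forall n, \sum_(k < n) a (m + k)%N <= 4^-1) -> iprod u != 0.
Proof.
move=> ua aS u0 am; pose v k := u (m + k)%N.
have va k : normc (v k - 1) <= a (m + k)%N by exact: ua.
have vn0 : iprod v != 0.
  have := iprod_sub1_le va am; apply: contraTneq => ->.
  rewrite sub0r normcN normc1 -ltNge.
  (* From $e^{-1/4}\ge 3/4$ follows $e^{1/4}\le 4/3<2$. *)
  have := expR_ge1Dx (- 4^-1 : R).
  have : expR (4^-1 : R) * expR (- 4^-1) = 1 by rewrite -expRD subrr expR0.
  have := expR_gt0 (4^-1 : R); nra.
have -> : iprod u = \prod_(k < m) u k * iprod v.
  apply: cseqlim_eq; rewrite -(cvg_shiftn m).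
  have -> : (fun n => \prod_(k < n + m) u k) = (fun n => \prod_(k < m) u k * \prod_(k < n) v k).
    by apply/funext => n; rewrite addnC big_split_ord.
  by apply: cvgMr; exact: iprod_cvg va am.
by rewrite mulf_neq0//; apply/prodf_neq0 => k _; exact: u0.
Qed.

End Products.

(** * The Blaschke products $G$ and $\Delta$ *)

Section GProducts.
Context {R : realType}.
Implicit Types (z w : R[i]) (j J : int).

(** The factor of [G] of index [j]: a Blaschke factor with zero $j+i$, normalised to take the value
    1 at 0. *)
Definition uf j z : R[i] := (j%:~R - 'i%C) / (j%:~R + 'i%C)
                  * ((z - j%:~R - 'i%C) / (z - j%:~R + 'i%C)).

Lemma intC j : (j%:~R : R[i]) = (j%:~R : R)%:C.
Proof. by rewrite rmorph_int. Qed.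

Lemma jpi_neq0 j : j%:~R + 'i%C != 0 :> R[i].
Proof.
by rewrite intC; apply/eqP => /(congr1 (@complex.Im R)); rewrite !ReImE /= add0r => /eqP; rewrite oner_eq0.
Qed.

Lemma jmi_neq0 j : j%:~R - 'i%C != 0 :> R[i].
Proof.
by rewrite intC; apply/eqP => /(congr1 (@complex.Im R)); rewrite !ReImE /= add0r => /eqP; rewrite oppr_eq0 oner_eq0.
Qed.

Lemma zjpi_neq0 j z : 0 <= Im z -> z - j%:~R + 'i%C != 0.
Proof.
move=> z0; rewrite intC; apply/eqP => /(congr1 (@complex.Im R)); rewrite !ReImE /= oppr0 addr0; lra.
Qed.

Lemma normc_jpi j : normc (j%:~R + 'i%C : R[i]) ^+ 2 = 1 + (j%:~R : R) ^+ 2.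
Proof. by rewrite intC normc_sqr !ReImE; ring. Qed.

Lemma normc_jmi j : normc (j%:~R - 'i%C : R[i]) = normc (j%:~R + 'i%C : R[i]).
Proof.
apply/eqP; rewrite -(eqrXn2 (n := 2))//; apply/eqP.
by rewrite normc_jpi intC normc_sqr !ReImE; ring.
Qed.

Definition ubnd z : R := 2 * (3 + normc z) * normc z.

Lemma ubnd_ge0 z : 0 <= ubnd z.
Proof. by rewrite !mulr_ge0// addr_ge0. Qed.

(** The left side is $|2z|/(|j+i|\,|z-j+i|)$, where $|z-j+i|\ge1$ and $|j+i|\le(3+|z|)\,|z-j+i|$ on
    the closed half plane. *)
Lemma uf_sub1 j z : 0 <= Im z -> normc (uf j z - 1) <= ubnd z * (1 + (j%:~R : R) ^+ 2)^-1.
Proof.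
move=> z0; have h1 := jpi_neq0 j; have h2 := zjpi_neq0 j z0.
have -> : uf j z - 1 = - (2 * 'i%C * z) / ((j%:~R + 'i%C) * (z - j%:~R + 'i%C)).
  have E (a c : R[i]) : a + c != 0 -> z - a + c != 0 ->
      (a - c) / (a + c) * ((z - a - c) / (z - a + c)) - 1 = - (2 * c * z) / ((a + c) * (z - a + c)).
    by move=> a1 a2; field; rewrite a1 a2.
  exact: E.
rewrite normc_div normcN 2!normcM normc_i mulr1 (normcM (j%:~R + _)).
have -> : normc (2 : R[i]) = 2.
  by rewrite (_ : 2 = (2 : R)%:C) ?normc_real ?ger0_norm// rmorph_nat.
have p1 : 0 < normc (j%:~R + 'i%C : R[i]) by rewrite normc_gt0.
have p2 : 0 < normc (z - j%:~R + 'i%C) by rewrite normc_gt0.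
have p3 : 1 <= normc (z - j%:~R + 'i%C).
  have := normc_Im (z - j%:~R + 'i%C); rewrite intC !ReImE oppr0 addr0.
  by rewrite ger0_norm; lra.
rewrite -normc_jpi ler_pdivrMr ?mulr_gt0//.
have tri : normc (j%:~R + 'i%C : R[i]) <= normc (z - j%:~R + 'i%C) + (normc z + 2).
  have -> : j%:~R + 'i%C = - (z - j%:~R + 'i%C) + (z + 'i%C + 'i%C) by ring.
  rewrite (le_trans (normcD _ _))// normcN lerD2l (le_trans (normcD _ _))//.
  have := normcD z 'i%C; rewrite normc_i; lra.
have tri2 : normc (j%:~R + 'i%C : R[i]) <= (3 + normc z) * normc (z - j%:~R + 'i%C).
  by have := normc_ge0 z; move: p3 tri; nra.
rewrite /ubnd; move: p1 p2 tri2; set A := normc (j%:~R + _); set B := normc (z - _ + _).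
move=> p1 p2 tri2.
have -> : 2 * (3 + normc z) * normc z * (A ^+ 2)^-1 * (A * B) =
  2 * normc z * ((3 + normc z) * B / A) by field; rewrite gt_eqF.
rewrite ler_peMr ?mulr_ge0// ler_pdivlMr// mul1r//.
Qed.

Lemma normc_uf j z :
  normc (uf j z) = normc (z - j%:~R - 'i%C) / normc (z - j%:~R + 'i%C).
Proof.
rewrite /uf normcM (normc_div (j%:~R - _)) normc_jmi divff ?mul1r ?normc_div//.
by rewrite normc_eq0 jpi_neq0.
Qed.

Lemma uf_le1 j z : 0 <= Im z -> normc (uf j z) <= 1.
Proof.
move=> z0; rewrite normc_uf.
have n0 := zjpi_neq0 j z0; rewrite ler_pdivrMr ?normc_gt0// mul1r.
rewrite -(ler_pXn2r (n := 2)) ?nnegrE// !normc_sqr intC !ReImE.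
by rewrite !subr0 addr0; nra.
Qed.

(** The Blaschke identity $|z-\bar\lambda|^2-|z-\lambda|^2=4\,\Im z\,\Im\lambda$ at $\lambda=j+i$.
    It makes the kernel sum telescope in [normc_CI_phinj], and it keeps [G] away from modulus 1 in
    [G_sqr_le]. *)
Lemma uf_sqr j z : 0 <= Im z ->
  normc (uf j z) ^+ 2 = 1 - 4 * Im z / normc (z - j%:~R + 'i%C) ^+ 2.
Proof.
move=> z0; rewrite normc_uf.
have n0 := zjpi_neq0 j z0.
have n1 : normc (z - j%:~R + 'i%C) ^+ 2 != 0 by rewrite expf_neq0// normc_eq0.
rewrite exprMn exprVn; apply: (mulIf n1).
rewrite mulfVK// mulrBl mulfVK// mul1r !normc_sqr intC !ReImE.
by rewrite !subr0 addr0; ring.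
Qed.

(** [PP J] collects the factors of index below [J] and [RR J] those from [J] on, so that [G] is
    their product for every [J] ([G_RRPP]). Raising [J] by 1 moves one factor across the cut. *)
Definition PP J z := iprod (fun k : nat => uf (J - 1 - k%:Z) z).
Definition RR J z := iprod (fun k : nat => uf (J + k%:Z) z).

(** Comparison with the telescoping series of $1/((k+1)(k+2))$, by $(k+1)(k+2)\le5(1+k^2)$ and
    $1+k^2\le2(1+x^2)(1+(x+k)^2)$. *)
Lemma sum_shift_bound (x : R) n :
  \sum_(k < n) (1 + (x + k%:R) ^+ 2)^-1 <= 10 * (1 + x ^+ 2).
Proof.
have c0 : 0 <= 10 * (1 + x ^+ 2) by rewrite mulr_ge0// addr_ge0// sqr_ge0.
apply: (@le_trans _ _ (\sum_(k < n) 10 * (1 + x ^+ 2) * ((0 + k).+1%:R * (0 + k).+2%:R)^-1)).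
  apply: ler_sum => k _; rewrite add0n.
  have k0 : (0 : R) <= k%:R by [].
  have -> : k.+2%:R = k%:R + 2 :> R by rewrite -addn2 natrD.
  have -> : k.+1%:R = k%:R + 1 :> R by rewrite -natr1.
  have q0 : 0 < (k%:R + 1) * (k%:R + 2) :> R by rewrite mulr_gt0// ltr_wpDl.
  have q1 : 0 < 1 + (x + k%:R) ^+ 2 by rewrite ltr_wpDr// sqr_ge0.
  rewrite -[leLHS]mul1r ler_pdivrMr// mulrAC ler_pdivlMr// mul1r.
  move: k0 {q0 q1}; generalize (k%:R : R) => y y0.
  have h1 : (y + 1) * (y + 2) <= 5 * (1 + y ^+ 2) by nra.
  have h2 : 1 + y ^+ 2 <= 2 * (1 + x ^+ 2) * (1 + (x + y) ^+ 2).
    have -> : 2 * (1 + x ^+ 2) * (1 + (x + y) ^+ 2) = (1 + y ^+ 2) +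
      (1 + (2 * x + y) ^+ 2 + 2 * (x * (x + y)) ^+ 2) by ring.
    have := sqr_ge0 (2 * x + y); have := sqr_ge0 (x * (x + y)); lra.
  lra.
rewrite -mulr_sumr ler_piMr// (le_trans (telescope_inv _ _))// invr1//.
Qed.

Lemma PP_bound J z n : 0 <= Im z ->
  (forall k : nat, normc (uf (J - 1 - k%:Z) z - 1) <= ubnd z * (1 + ((1 - J)%:~R + k%:R : R) ^+ 2)^-1) /\
  \sum_(k < n) (ubnd z * (1 + ((1 - J)%:~R + k%:R : R) ^+ 2)^-1) <= ubnd z * (10 * (1 + (1 - J)%:~R ^+ 2)).
Proof.
move=> z0; split=> [k|].
  rewrite (le_trans (uf_sub1 _ z0))// ler_wpM2l ?ubnd_ge0//.
  rewrite (_ : (J - 1 - k%:Z)%:~R ^+ 2 = ((1 - J)%:~R + k%:R) ^+ 2 :> R)//.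
  by rewrite !rmorphB /= -[k%:R]/(k%:Z%:~R); ring.
by rewrite -mulr_sumr ler_wpM2l ?ubnd_ge0// sum_shift_bound.
Qed.

Lemma RR_bound J z n : 0 <= Im z ->
  (forall k : nat, normc (uf (J + k%:Z) z - 1) <= ubnd z * (1 + (J%:~R + k%:R : R) ^+ 2)^-1) /\
  \sum_(k < n) (ubnd z * (1 + (J%:~R + k%:R : R) ^+ 2)^-1) <= ubnd z * (10 * (1 + J%:~R ^+ 2)).
Proof.
move=> z0; split=> [k|].
  rewrite (le_trans (uf_sub1 _ z0))// ler_wpM2l ?ubnd_ge0//.
  by rewrite rmorphD.
by rewrite -mulr_sumr ler_wpM2l ?ubnd_ge0// sum_shift_bound.
Qed.

Lemma PP_cvg J z : 0 <= Im z ->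
  ((fun n => \prod_(k < n) uf (J - 1 - k%:Z) z) : nat -> R[i]^o) @ \oo --> (PP J z : R[i]^o).
Proof.
by move=> z0; have [H1 _] := PP_bound J 0%N z0; exact: (iprod_cvg H1 (fun n => (PP_bound J n z0).2)).
Qed.

Lemma RR_cvg J z : 0 <= Im z ->
  ((fun n => \prod_(k < n) uf (J + k%:Z) z) : nat -> R[i]^o) @ \oo --> (RR J z : R[i]^o).
Proof.
by move=> z0; have [H1 _] := RR_bound J 0%N z0; exact: (iprod_cvg H1 (fun n => (RR_bound J n z0).2)).
Qed.

Lemma PP_rec J z : 0 <= Im z -> PP (J + 1) z = uf J z * PP J z.
Proof.
move=> z0; rewrite /PP (@iprod_recl _ _ (PP J z)); last first.
  rewrite (_ : (fun n => _) = (fun n => \prod_(k < n) uf (J - 1 - k%:Z) z)).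
    exact: PP_cvg.
  apply/funext => n; apply: eq_bigr => k _; congr uf.
  by rewrite -addn1 PoszD; ring.
by congr (uf _ z * _); ring.
Qed.

Lemma RR_rec J z : 0 <= Im z -> RR J z = uf J z * RR (J + 1) z.
Proof.
move=> z0; rewrite /RR (@iprod_recl _ _ (RR (J + 1) z)); last first.
  rewrite (_ : (fun n => _) = (fun n => \prod_(k < n) uf (J + 1 + k%:Z) z)).
    exact: RR_cvg.
  apply/funext => n; apply: eq_bigr => k _; congr uf.
  by rewrite -addn1 PoszD; ring.
by congr (uf _ z * _); ring.
Qed.

Lemma G_RRPP0 z : G z = RR 0 z * PP 0 z.
Proof.
rewrite /G /zprod /RR /PP; congr (iprod _ * iprod _); apply/funext => k.
  by rewrite (_ : 0 - 1 - k%:Z = Negz k)// NegzE -addn1 PoszD; ring.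
Qed.

Lemma G_RRPP J z : 0 <= Im z -> G z = RR J z * PP J z.
Proof.
move=> z0; have S k : RR k z * PP k z = RR (k + 1) z * PP (k + 1) z.
  by rewrite (RR_rec k z0) (PP_rec k z0); ring.
rewrite G_RRPP0; case: J => n.
  elim: n => [//|n IH]; rewrite IH S; congr (RR _ z * PP _ z); rewrite -addn1 PoszD//.
elim: n => [|n IH]; first by rewrite [RHS]S.
by rewrite IH [RHS]S; congr (RR _ z * PP _ z); rewrite !NegzE -addn1 PoszD; ring.
Qed.

End GProducts.

Section DeltaInner.
Context {R : realType}.
Implicit Types (z w : R[i]) (j J : int).

Lemma Im_scale (s : R) z : Im (s%:C * z) = s * Im z.
Proof. by rewrite !ReImE mul0r addr0. Qed.

Lemma Im_scale_ge0 (s : R) z : 0 <= s -> 0 <= Im z -> 0 <= Im (s%:C * z).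
Proof. by move=> s0 z0; rewrite Im_scale mulr_ge0. Qed.

Lemma expR_sub1_le (x : R) : expR x - 1 <= x * expR x.
Proof.
have h := expR_ge1Dx (- x); have e0 := expR_gt0 x.
have : expR (- x) * expR x = 1 by rewrite -expRD addNr expR0.
by nra.
Qed.

Lemma inner_mult_ext (P Q : R[i] -> R[i]) : P =1 Q -> inner_mult P -> inner_mult Q.
Proof. by move=> /funext ->. Qed.

Lemma inner_mult_prod (u : nat -> R[i] -> R[i]) n : (forall k, inner_mult (u k)) ->
  inner_mult (fun z => \prod_(k < n) u k z).
Proof.
move=> iu; elim: n => [|n IH].
  by apply: (@inner_mult_ext (fun=> 1)) => [z|]; [rewrite big_ord0|apply: inner_mult_cst; exact: normc1].
apply: (@inner_mult_ext (fun z => (\prod_(k < n) u k z) * u n z)) => [z|].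
  by rewrite big_ord_recr.
exact: inner_multM.
Qed.

(** In the scaled variable the zero $j+i$ moves to $(j+i)/s$, and the constant in front is
    unimodular. *)
Lemma uf_blaschke (s : R) j z : 0 < s -> uf j (s%:C * z) =
  (j%:~R - 'i%C) / (j%:~R + 'i%C) * blaschke ((j%:~R / s) +i* s^-1) z.
Proof.
move=> s0; rewrite /uf /blaschke; congr (_ * _).
set l := (j%:~R / s) +i* s^-1.
have sn : s%:C != 0 :> R[i] by rewrite -normc_eq0 normc_real normr_eq0 gt_eqF.
have -> : s%:C * z - j%:~R - 'i%C = s%:C * (z - l).
  rewrite mulrBr -addrA -opprD; congr (_ - _); rewrite intC.
  by apply: complex_ext; rewrite /l !ReImE; field; rewrite gt_eqF.
have -> : s%:C * z - j%:~R + 'i%C = s%:C * (z - l^*%C).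
  rewrite mulrBr -addrA; congr (_ + _); rewrite intC.
  by apply: complex_ext; rewrite /l !ReImE; field; rewrite gt_eqF.
by rewrite -mulf_div divff// mul1r.
Qed.

Lemma normc_uf_cst j : normc ((j%:~R - 'i%C) / (j%:~R + 'i%C) : R[i]) = 1.
Proof. by rewrite normc_div normc_jmi divff// normc_eq0 jpi_neq0. Qed.

Lemma inner_mult_uf (s : R) j : 0 < s -> inner_mult (fun z => uf j (s%:C * z)).
Proof.
move=> s0; apply: (inner_mult_ext (fun z => esym (uf_blaschke j z s0))).
apply: inner_multM; first exact/inner_mult_cst/normc_uf_cst.
by apply: inner_mult_blaschke; rewrite /= invr_gt0.
Qed.

Lemma inner_mult_PP (s : R) J : 0 < s -> inner_mult (fun z => PP J (s%:C * z)).
Proof.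
move=> s0; apply: (@inner_mult_lim _ (fun n z => \prod_(k < n) uf (J - 1 - k%:Z) (s%:C * z))).
  by move=> n; apply: (@inner_mult_prod (fun k z => uf (J - 1 - k%:Z) (s%:C * z))) => k; exact: inner_mult_uf.
by move=> z z0; apply: PP_cvg; exact: Im_scale_ge0 (ltW s0) z0.
Qed.

Lemma inner_mult_RR (s : R) J : 0 < s -> inner_mult (fun z => RR J (s%:C * z)).
Proof.
move=> s0; apply: (@inner_mult_lim _ (fun n z => \prod_(k < n) uf (J + k%:Z) (s%:C * z))).
  by move=> n; apply: (@inner_mult_prod (fun k z => uf (J + k%:Z) (s%:C * z))) => k; exact: inner_mult_uf.
by move=> z z0; apply: RR_cvg; exact: Im_scale_ge0 (ltW s0) z0.
Qed.

Lemma inner_mult_G (s : R) : 0 < s -> inner_mult (fun z => G (s%:C * z)).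
Proof.
move=> s0; apply: (@inner_mult_ext (fun z => RR 0 (s%:C * z) * PP 0 (s%:C * z))) => [z|].
  by rewrite G_RRPP0.
by apply: inner_multM; [exact: inner_mult_RR|exact: inner_mult_PP].
Qed.

Lemma PP_sub1 J z : 0 <= Im z ->
  normc (PP J z - 1) <= expR (ubnd z * (10 * (1 + (1 - J)%:~R ^+ 2))) - 1.
Proof.
move=> z0; have [H1 _] := PP_bound J 0%N z0.
exact: (iprod_sub1_le H1 (fun n => (PP_bound J n z0).2)).
Qed.

Lemma RR_sub1 J z : 0 <= Im z ->
  normc (RR J z - 1) <= expR (ubnd z * (10 * (1 + J%:~R ^+ 2))) - 1.
Proof.
move=> z0; have [H1 _] := RR_bound J 0%N z0.
exact: (iprod_sub1_le H1 (fun n => (RR_bound J n z0).2)).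
Qed.

(** The constant of the linear bound on $|G-1|$ in the half disc of radius [r]: the two
    half-products give exponents 10 and 20 times [ubnd z], and 30 times [ubnd z] is at most
    $60(3+r)|z|$. *)
Definition Kr (r : R) : R := 60 * (3 + r) * expR (60 * (3 + r) * r).

Lemma Kr_ge0 r : 0 <= r -> 0 <= Kr r.
Proof. by move=> r0; rewrite /Kr !mulr_ge0 ?expR_ge0// addr_ge0. Qed.

(** The bound is linear in $|z|$, hence summable along the points $2^{-k}z$; this makes the product
    [Delta] converge. *)
Lemma G_sub1 z r : 0 <= Im z -> normc z <= r -> normc (G z - 1) <= Kr r * normc z.
Proof.
move=> z0 zr; have r0 : 0 <= r := le_trans (normc_ge0 z) zr.
have h1 := RR_sub1 0 z0; have h2 := PP_sub1 0 z0.
rewrite expr0n addr0 mulr1 in h1.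
rewrite subr0 expr1n (_ : 10 * (1 + 1) = 20 :> R) in h2; last by ring.
have u0 := ubnd_ge0 z.
have h3 : normc (G z - 1) <= expR (30 * ubnd z) - 1.
  rewrite G_RRPP0.
  have -> : RR 0 z * PP 0 z - 1 = (RR 0 z - 1) * (PP 0 z - 1) + (RR 0 z - 1) + (PP 0 z - 1) by ring.
  have -> : expR (30 * ubnd z) = expR (ubnd z * 10) * expR (ubnd z * 20).
    by rewrite -expRD; congr expR; ring.
  rewrite (le_trans (normcD _ _))// (le_trans (lerD (normcD _ _) (lexx _)))// normcM.
  have : normc (RR 0 z - 1) * normc (PP 0 z - 1) <=
    (expR (ubnd z * 10) - 1) * (expR (ubnd z * 20) - 1) by apply: ler_pM.
  lra.
have h4 := expR_sub1_le (30 * ubnd z).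
have ub : 30 * ubnd z <= 60 * (3 + r) * normc z.
  rewrite /ubnd !mulrA (_ : 30 * 2 = 60 :> R); last by ring.
  by rewrite ler_wpM2r// ler_wpM2l// lerD2l.
have ub2 : 60 * (3 + r) * normc z <= 60 * (3 + r) * r.
  by rewrite ler_wpM2l// mulr_ge0// addr_ge0.
apply: (le_trans h3); apply: (le_trans h4).
have -> : Kr r * normc z = 60 * (3 + r) * normc z * expR (60 * (3 + r) * r) by rewrite /Kr mulrAC.
apply: ler_pM; [by apply: mulr_ge0|exact: expR_ge0|exact: ub|].
by rewrite ler_expR (le_trans ub).
Qed.

Lemma pow2Negz k : (2 : R[i]) ^ Negz k = ((2 : R) ^- k.+1)%:C.
Proof. by rewrite /exprz fmorphV rmorphXn /= rmorph_nat. Qed.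

Lemma half_sum n : \sum_(k < n) (2 : R) ^- k.+1 <= 1.
Proof.
suff -> : \sum_(k < n) (2 : R) ^- k.+1 = 1 - 2 ^- n by rewrite gerBl invr_ge0 exprn_ge0.
elim: n => [|n IH]; first by rewrite big_ord0 expr0 invr1 subrr.
rewrite big_ord_recr /= IH exprS invfM.
by field; rewrite expf_neq0// pnatr_eq0.
Qed.

Lemma Delta_bound z r : 0 <= Im z -> normc z <= r ->
  (forall k, normc (G (2 ^ Negz k * z) - 1) <= Kr r * normc z * 2 ^- k.+1) /\
  (forall n, \sum_(k < n) (Kr r * normc z * 2 ^- k.+1) <= Kr r * normc z).
Proof.
move=> z0 zr; have r0 : 0 <= r := le_trans (normc_ge0 z) zr.
have K0 := Kr_ge0 r0.
split=> [k|n]; last by rewrite -mulr_sumr ler_piMr ?half_sum// mulr_ge0.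
have p0 : 0 <= (2 : R) ^- k.+1 by rewrite invr_ge0 exprn_ge0.
have p1 : (2 : R) ^- k.+1 <= 1 by rewrite invf_le1 ?exprn_gt0// exprn_ege1// ler1n.
have nz : normc (2 ^ Negz k * z) = normc z * 2 ^- k.+1.
  by rewrite pow2Negz normcM normc_real ger0_norm// mulrC.
rewrite -mulrA -nz; apply: G_sub1.
  by rewrite pow2Negz; exact: Im_scale_ge0.
by rewrite nz (le_trans _ zr)// ler_piMr.
Qed.

Lemma Delta_cvg z : 0 <= Im z ->
  ((fun n => \prod_(k < n) G (2 ^ Negz k * z)) : nat -> R[i]^o) @ \oo --> (Delta z : R[i]^o).
Proof. by move=> z0; have [H1 H2] := Delta_bound z0 (lexx _); exact: (iprod_cvg H1 H2). Qed.

Lemma Delta_sub1 z r : 0 <= Im z -> normc z <= r ->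
  normc (Delta z - 1) <= expR (Kr r * normc z) - 1.
Proof. by move=> z0 zr; have [H1 H2] := Delta_bound z0 zr; exact: (iprod_sub1_le H1 H2). Qed.

(** Doubling the argument shifts the product by one place and brings in the new first factor $G(z)$.
    The nesting of the spaces [Vspace n] rests on this relation. *)
Lemma Delta_rec z : 0 <= Im z -> Delta ((2 : R)%:C * z) = G z * Delta z.
Proof.
move=> z0; have E k : 2 ^ Negz k.+1 * ((2 : R)%:C * z) = 2 ^ Negz k * z.
  rewrite !pow2Negz mulrA -rmorphM; congr ((_%:C) * _).
  by rewrite [in LHS]exprS invfM mulrC mulrA divff ?mul1r.
rewrite /Delta (@iprod_recl _ _ (Delta z)); last first.
  rewrite (_ : (fun n => _) = (fun n => \prod_(k < n) G (2 ^ Negz k * z))); first exact: Delta_cvg.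
  by apply/funext => n; apply: eq_bigr => k _; rewrite E.
congr (G _ * _); rewrite pow2Negz mulrA -rmorphM mulVf ?rmorph1 ?mul1r//.
Qed.

Lemma inner_mult_Delta (s : R) : 0 < s -> inner_mult (fun z => Delta (s%:C * z)).
Proof.
move=> s0; apply: (@inner_mult_lim _ (fun n z => \prod_(k < n) G (2 ^ Negz k * (s%:C * z)))).
  move=> n; apply: (@inner_mult_prod (fun k z => G (2 ^ Negz k * (s%:C * z)))) => k.
  apply: (@inner_mult_ext (fun z => G ((2 ^- k.+1 * s)%:C * z))) => [z|].
    by rewrite pow2Negz mulrA -rmorphM.
  by apply: inner_mult_G; rewrite mulr_gt0// invr_gt0 exprn_gt0.
by move=> z z0; apply: Delta_cvg; exact: Im_scale_ge0 (ltW s0) z0.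
Qed.

Lemma normc_prod_le1 (u : nat -> R[i]) n : (forall k, normc (u k) <= 1) ->
  normc (\prod_(k < n) u k) <= 1.
Proof.
move=> u1; elim: n => [|n IH]; first by rewrite big_ord0 normc1.
by rewrite big_ord_recr normcM mulr_ile1.
Qed.

Lemma PP_le1 J z : 0 <= Im z -> normc (PP J z) <= 1.
Proof.
move=> z0; rewrite -(subr0 (PP J z)); apply: (normc_lim_le (PP_cvg z0)) => n.
by rewrite subr0; apply: (@normc_prod_le1 (fun k => uf (J - 1 - k%:Z) z)) => k; exact: uf_le1.
Qed.

Lemma RR_le1 J z : 0 <= Im z -> normc (RR J z) <= 1.
Proof.
move=> z0; rewrite -(subr0 (RR J z)); apply: (normc_lim_le (RR_cvg z0)) => n.
by rewrite subr0; apply: (@normc_prod_le1 (fun k => uf (J + k%:Z) z)) => k; exact: uf_le1.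
Qed.

Lemma RR_split J z n : 0 <= Im z ->
  RR J z = (\prod_(k < n) uf (J + k%:Z) z) * RR (J + n%:Z) z.
Proof.
move=> z0; elim: n => [|n IH]; first by rewrite big_ord0 mul1r addr0.
rewrite IH big_ord_recr /= -mulrA; congr (_ * _); rewrite RR_rec//; congr (_ * RR _ z).
by rewrite -addn1 PoszD addrA.
Qed.

Lemma G_le1 z : 0 <= Im z -> normc (G z) <= 1.
Proof.
move=> z0; have h1 := @RR_le1 0 z z0; have h2 := @PP_le1 0 z z0.
rewrite G_RRPP0 normcM; exact: (mulr_ile1 (normc_ge0 _) (normc_ge0 _) h1 h2).
Qed.

Lemma Delta_le1 z : 0 <= Im z -> normc (Delta z) <= 1.
Proof.
move=> z0; rewrite -(subr0 (Delta z)); apply: (normc_lim_le (Delta_cvg z0)) => n.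
rewrite subr0; apply: (@normc_prod_le1 (fun k => G (2 ^ Negz k * z))) => k.
by apply: G_le1; rewrite pow2Negz; apply: Im_scale_ge0 => //; rewrite invr_ge0 exprn_ge0.
Qed.

(* Far up the half plane the factors centred in (Re z, Re z + Im z] alone keep
   |G| away from 1, uniformly in z. *)
Lemma G_sqr_le z : 1 <= Im z -> normc (G z) ^+ 2 <= expR (- (2 / 5)).
Proof.
move=> z1; have z0 : 0 <= Im z by lra.
set x := Re z; set y := Im z in z0 z1 *.
pose J := Num.floor x + 1; pose n := Num.truncn y.
have /andP[n1 n2] : n%:R <= y < n.+1%:R by exact: truncn_itv.
have n3 : y / 2 <= n%:R.
  have : (1 <= n)%N by rewrite -ltnS -(ltr_nat R); lra.
  by rewrite -(ler_nat R) -natr1 in n2 *; lra.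
have J1 : x < J%:~R <= x + 1.
  by rewrite /J; have := floor_itv x; rewrite rmorphD /=; lra.
have GP : normc (G z) <= normc (\prod_(k < n) uf (J + k%:Z) z).
  rewrite (G_RRPP J z0) (RR_split J n z0) !normcM -mulrA ler_piMr//.
  exact: (mulr_ile1 (normc_ge0 _) (normc_ge0 _) (@RR_le1 _ z z0) (@PP_le1 _ z z0)).
apply: (@le_trans _ _ (normc (\prod_(k < n) uf (J + k%:Z) z) ^+ 2)).
  by rewrite ler_pXn2r ?nnegrE.
(* The index $J+k$ lies within $y$ of $x$, so $|z-(J+k)+i|^2\le y^2+(y+1)^2\le5y^2$, and
   $4y/(5y^2)=4/(5y)$. *)
have F k : (k < n)%N -> normc (uf (J + k%:Z) z) ^+ 2 <= expR (- (4 / (5 * y))).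
  move=> kn; apply: le_trans (expR_ge1Dx _); rewrite uf_sqr// lerD2l lerN2 -/y.
  have kn1 : k%:R + 1 <= n%:R :> R by rewrite natr1 ler_nat.
  have k0 : (0 : R) <= k%:R by [].
  have n0 := zjpi_neq0 (J + k%:Z) z0.
  have p0 : 0 < normc (z - (J + k%:Z)%:~R + 'i%C) ^+ 2 by rewrite exprn_gt0// normc_gt0.
  rewrite ler_pdivlMr//.
  move: p0; rewrite intC rmorphD /= normc_sqr !ReImE -/x -/y.
  rewrite -[k%:~R]/(k%:R : R) !subr0 !addr0 => p0.
  have q1 : (x - (J%:~R + k%:R)) ^+ 2 <= y ^+ 2.
    rewrite -sqrrN ler_pXn2r ?nnegrE//; lra.
  have q2 : (y + 1) ^+ 2 <= (2 * y) ^+ 2 by rewrite ler_pXn2r ?nnegrE//; lra.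
  rewrite mulrAC ler_pdivrMr; last by lra.
  nra.
have : normc (\prod_(k < n) uf (J + k%:Z) z) ^+ 2 <= expR (- (4 / (5 * y))) ^+ n.
  rewrite normc_prod -prodrXl -[X in _ <= _ ^+ X]card_ord -prodr_const.
  by apply: ler_prod => k _; rewrite sqr_ge0 F.
move=> h; apply: (le_trans h); rewrite -expRM_natl ler_expR.
have -> : n%:R * - (4 / (5 * y)) = - (4 * n%:R / (5 * y)) by ring.
rewrite lerN2 ler_pdivlMr; last by lra.
have -> : 2 / 5 * (5 * y) = 2 * y by field.
lra.
Qed.

End DeltaInner.

(** * The complex exponential and the factors of Euler's limit *)

Section ComplexExp.
Context {R : realType}.
Implicit Types (z w s : R[i]) (a b x : R).

Lemma normr_sin_le b : `|sin b| <= `|b|.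
Proof.
have P x : 0 <= x -> `|sin x| <= x.
  move=> x0; have [c _] := @MVT_segment R sin cos 0 x x0 (fun y _ => is_derive_sin y)
    (continuous_subspaceT (@continuous_sin R)).
  rewrite sin0 !subr0 => ->; rewrite normrM (ger0_norm x0) ler_piMl//; exact: cos_max.
have [b0|b0] := leP 0 b; first by rewrite (ger0_norm b0) P.
by rewrite -normrN -sinN -(normrN b) (ger0_norm (_ : 0 <= - b)) ?P// oppr_ge0 ltW.
Qed.

Lemma cos_sub1_le b : `|cos b - 1| <= b ^+ 2.
Proof.
have P x : 0 <= x -> `|cos x - 1| <= x ^+ 2.
  move=> x0; have [c] := @MVT_segment R cos (fun x => - sin x) 0 x x0
    (fun y _ => is_derive_cos y) (continuous_subspaceT (@continuous_cos R)).
  rewrite in_itv /= => /andP[c0 cx]; rewrite cos0 !subr0 => ->.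
  rewrite normrM normrN (ger0_norm x0) expr2 ler_wpM2r//.
  by rewrite (le_trans (normr_sin_le _))// ger0_norm.
have [b0|b0] := leP 0 b; first by rewrite P.
by rewrite -cosN -sqrrN P// oppr_ge0 ltW.
Qed.

Lemma sin_sub_le b : `|b| <= 1 -> `|sin b - b| <= b ^+ 2.
Proof.
have P x : 0 <= x <= 1 -> `|sin x - x| <= x ^+ 2.
  move=> /andP[x0 x1]; have [c] := @MVT_segment R sin cos 0 x x0 (fun y _ => is_derive_sin y)
    (continuous_subspaceT (@continuous_sin R)).
  rewrite in_itv /= => /andP[c0 cx]; rewrite sin0 !subr0 => ->.
  rewrite -[X in _ - X]mul1r -mulrBl normrM (ger0_norm x0) expr2 ler_wpM2r//.
  apply: le_trans (cos_sub1_le _) _; nra.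
have [b0|b0] := leP 0 b; first by rewrite (ger0_norm b0) => b1; rewrite P// b0.
rewrite -sqrrN ltr0_norm// => b1.
have := P (- b); rewrite b1 oppr_ge0 (ltW b0) sinN => /(_ isT).
have -> : - sin b - - b = - (sin b - b) by ring.
by rewrite normrN.
Qed.

Lemma expR_bounds a : `|a| <= 2^-1 ->
  [/\ expR a <= 2, `|expR a - 1 - a| <= 2 * a ^+ 2 & `|expR a - 1| <= 2 * `|a|].
Proof.
rewrite ler_norml => /andP[a1 a2].
have h1 := expR_ge1Dx a; have h2 := expR_ge1Dx (- a); have e0 := expR_gt0 a.
have h3 : expR (- a) * expR a = 1 by rewrite -expRD addNr expR0.
have h4 : expR a * (1 - a) <= 1 by nra.
have h5 : expR a <= 2 by nra.
have h6 : expR a - 1 - a <= 2 * a ^+ 2 by nra.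
split=> //; first by rewrite ger0_norm; lra.
rewrite ler_norml; have [a0|a0] := leP 0 a.
  by rewrite ger0_norm//; apply/andP; split; nra.
by rewrite ltr0_norm//; apply/andP; split; nra.
Qed.

(** Componentwise, from second-order bounds on the real exponential, the sine and the cosine. *)
Lemma cexp_taylor z : normc z <= 2^-1 -> normc (cexp z - 1 - z) <= 4 * normc z ^+ 2.
Proof.
case: z => a b z1.
have /= a1 : `|a| <= 2^-1 := le_trans (normc_Re (a +i* b)) z1.
have /= b1 : `|b| <= 2^-1 := le_trans (normc_Im (a +i* b)) z1.
have [e1 e2 e3] := expR_bounds a1.
have c1 := cos_sub1_le b; have s1 := normr_sin_le b.
have s2 : `|sin b - b| <= b ^+ 2 by apply: sin_sub_le; lra.
have e0 := expR_gt0 a.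
rewrite (le_trans (normc_leReIm _))// normc_sqr /cexp !ReImE.
have -> : expR a * cos b - 0 * sin b - 1 - a = expR a * (cos b - 1) + (expR a - 1 - a) by ring.
have -> : expR a * sin b + 0 * cos b - 0 - b = (expR a - 1) * sin b + (sin b - b) by ring.
have r1 : `|expR a * (cos b - 1)| <= 2 * b ^+ 2.
  by rewrite normrM (gtr0_norm e0) ler_pM// ltW.
have r2 : `|(expR a - 1) * sin b| <= 2 * `|a| * `|b| by rewrite normrM ler_pM.
have r3 : 2 * `|a| * `|b| <= a ^+ 2 + b ^+ 2.
  have := sqr_ge0 (`|a| - `|b|); rewrite sqrrB !real_normK ?num_real//; lra.
have := ler_normD (expR a * (cos b - 1)) (expR a - 1 - a).
have := ler_normD ((expR a - 1) * sin b) (sin b - b).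
have := sqr_ge0 a.
lra.
Qed.

Lemma cexpD z w : cexp (z + w) = cexp z * cexp w.
Proof.
case: z w => a b [c d]; rewrite /cexp !ReImE expRD cosD sinD.
by apply: complex_ext; rewrite !ReImE; ring.
Qed.

Lemma normc_cexp z : normc (cexp z) = expR (Re z).
Proof.
case: z => a b; rewrite /cexp normcM normc_real ger0_norm ?expR_ge0//=.
by rewrite /Normc.normc cos2Dsin2 sqrtr1 mulr1.
Qed.

Lemma cexp_neq0 z : cexp z != 0.
Proof. by rewrite -normc_gt0 normc_cexp expR_gt0. Qed.

Definition Gseq s (n : nat) : R[i] :=
  n`!%:R * cexp (s * (ln n%:R)%:C) / \prod_(k < n.+1) (s + k%:R).

(** The quotient of the consecutive Euler terms [Gseq s k.+2] and [Gseq s k.+1] ([GseqS]); the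
    indices start where the logarithms are those of positive numbers. *)
Definition Grat s (k : nat) : R[i] := (k.+2)%:R * cexp (s * (ln (k.+2%:R / k.+1%:R))%:C) / (s + k.+2%:R).

Lemma GseqS s k : (forall k : nat, s + k%:R != 0) -> Gseq s k.+2 = Gseq s k.+1 * Grat s k.
Proof.
move=> sk; rewrite /Gseq /Grat [in LHS]big_ord_recr /= factS natrM.
have -> : ln k.+2%:R = ln k.+1%:R + ln (k.+2%:R / k.+1%:R) :> R.
  by rewrite ln_div ?posrE// addrC subrK.
set L1 := ln _; set L2 := ln (_ / _).
have -> : s * (L1 + L2)%:C = s * L1%:C + s * L2%:C by rewrite rmorphD mulrDr.
rewrite cexpD invfM; ring.
Qed.

Lemma natrC (n : nat) : (n%:R : R[i]) = (n%:R : R)%:C. Proof. by rewrite rmorph_nat. Qed.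

(** With $l=\ln((k+2)/(k+1))$ between $1/(k+2)$ and $1/(k+1)$, the numbers $(k+2)e^{sl}$ and $s+k+2$
    agree up to $O(1/k)$; division by $s+k+2$ leaves $O(1/k^2)$. *)
Lemma Grat_sub1 s k : 2 * normc s <= k%:R ->
  normc (Grat s k - 1) <= (2 * normc s + 16 * normc s ^+ 2) * (k.+1%:R * k.+2%:R)^-1.
Proof.
move=> sk; have s0 := normc_ge0 s.
set p : R := k.+2%:R; set q : R := k.+1%:R.
have k0 : (0 : R) <= k%:R by [].
have qE : q = k%:R + 1 by rewrite /q -natr1.
have pE : p = q + 1 by rewrite /p /q -natr1.
have q0 : 0 < q by lra.
have p0 : 0 < p by lra.
set l := ln (p / q).
have l1 : l <= q^-1.
  have := @le_ln1Dx R q^-1; rewrite (_ : 1 + q^-1 = p / q); first by apply; rewrite (lt_trans _ (_ : 0 < q^-1)) ?invr_gt0//; lra.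
  by rewrite pE; field; rewrite gt_eqF.
have l2 : p^-1 <= l.
  have := @le_ln1Dx R (- p^-1); rewrite (_ : 1 + - p^-1 = (p / q)^-1); last first.
    by rewrite pE; field; rewrite !gt_eqF//; lra.
  rewrite lnV ?posrE ?divr_gt0// lerN2; apply; rewrite ltrN2.
  by rewrite invf_lt1//; lra.
have l0 : 0 <= l by rewrite (le_trans _ l2)// invr_ge0 ltW.
have sl : normc (s * l%:C) <= 2^-1.
  rewrite normcM normc_real ger0_norm//.
  apply: (@le_trans _ _ (normc s * q^-1)); first by rewrite ler_wpM2l.
  by rewrite ler_pdivrMr//; lra.
have E := cexp_taylor sl.
set T := cexp (s * l%:C) - 1 - s * l%:C in E.
have ps : p / 2 <= normc (s + k.+2%:R).
  have := normcBl (k.+2%:R : R[i]) (- s); rewrite normcN opprK (addrC _ s) natrC normc_real ger0_norm//.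
  rewrite -/p; lra.
have ps0 : s + k.+2%:R != 0 by rewrite -normc_gt0; lra.
have -> : Grat s k - 1 = (s * (p * l - 1)%:C + p%:C * T) / (s + k.+2%:R).
  rewrite /Grat -/p -/q -/l; apply: (mulIf ps0); rewrite mulrBl !mulfVK//.
  rewrite /T rmorphB rmorphM /= natrC -/p rmorph1; ring.
rewrite normc_div ler_pdivrMr; last by rewrite normc_gt0.
have pl : `|p * l - 1| <= q^-1.
  have h1 : 1 <= p * l by rewrite mulrC -ler_pdivrMr// mul1r.
  rewrite ger0_norm ?subr_ge0// lerBlDr (le_trans (ler_wpM2l (ltW p0) l1))//.
  by rewrite pE mulrDl divff ?gt_eqF// mul1r addrC.
have pT : p * normc T <= 8 * normc s ^+ 2 * q^-1.
  apply: (@le_trans _ _ (p * (4 * normc (s * l%:C) ^+ 2))); first by rewrite ler_wpM2l// ltW.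
  rewrite normcM normc_real ger0_norm// exprMn.
  have h : p * l <= 2.
    have q1 : q^-1 <= 1 by rewrite invf_le1//; lra.
    have h1 := le_trans (ler_norm _) (le_trans pl q1).
    by rewrite -(subrK 1 (p * l)) (_ : 2 = 1 + 1 :> R)// lerD.
  have -> : p * (4 * (normc s ^+ 2 * l ^+ 2)) = 4 * normc s ^+ 2 * ((p * l) * l) by ring.
  rewrite (_ : 8 * normc s ^+ 2 * q^-1 = 4 * normc s ^+ 2 * (2 * q^-1)); last by ring.
  by rewrite ler_wpM2l ?mulr_ge0 ?sqr_ge0// ler_pM// mulr_ge0// ltW.
have N : normc (s * (p * l - 1)%:C + p%:C * T) <= (normc s + 8 * normc s ^+ 2) * q^-1.
  apply: le_trans (normcD _ _) _; rewrite (normcM s) (normcM p%:C) !normc_real (gtr0_norm p0).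
  have -> : (normc s + 8 * normc s ^+ 2) * q^-1 = normc s * q^-1 + 8 * normc s ^+ 2 * q^-1 by ring.
  by apply: lerD => //; exact: ler_wpM2l.
apply: (le_trans N).
have -> : (2 * normc s + 16 * normc s ^+ 2) * (q * p)^-1 * normc (s + k.+2%:R) =
   (normc s + 8 * normc s ^+ 2) * q^-1 * (normc (s + k.+2%:R) / (p / 2)).
  by field; rewrite !gt_eqF.
rewrite ler_peMr//; last by rewrite ler_pdivlMr ?mul1r// divr_gt0.
by rewrite mulr_ge0 ?invr_ge0 ?(ltW q0)// addr_ge0// mulr_ge0// sqr_ge0.
Qed.

End ComplexExp.

(** * The Gamma quotient as a half of the Blaschke product *)

Section GammaPhi.
Context {R : realType}.
Implicit Types (z w s : R[i]) (x t : R).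

Lemma Gseq_neq0 s n : (forall k : nat, s + k%:R != 0) -> Gseq s n != 0.
Proof.
move=> sk; apply: mulf_neq0; last by rewrite invr_eq0; apply/prodf_neq0 => k _.
by apply: mulf_neq0; [rewrite pnatr_eq0 -lt0n fact_gt0|exact: cexp_neq0].
Qed.

Lemma Grat_neq0 s k : (forall k : nat, s + k%:R != 0) -> Grat s k != 0.
Proof.
move=> sk; apply: mulf_neq0; last by rewrite invr_eq0.
by apply: mulf_neq0; [rewrite pnatr_eq0|exact: cexp_neq0].
Qed.

(** From index [m.+1] on, the Euler terms are a nonzero constant times partial products with nonzero
    factors $1+O(1/k^2)$, so [iprod_cvg] and [iprod_neq0] apply. *)
Lemma Gamma_cvg s : (forall k : nat, s + k%:R != 0) ->
  (Gseq s : nat -> R[i]^o) @ \oo --> (Gamma s : R[i]^o) /\ Gamma s != 0.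
Proof.
move=> sk; pose m := (Num.truncn (2 * normc s)).+1.
pose A := 2 * normc s + 16 * normc s ^+ 2.
have A0 : 0 <= A by rewrite addr_ge0// mulr_ge0// sqr_ge0.
pose v k := Grat s (m + k).
pose a k := A * ((m + k).+1%:R * (m + k).+2%:R)^-1.
have va k : normc (v k - 1) <= a k.
  apply: Grat_sub1; rewrite (le_trans (ltW (truncnS_gt (2 * normc s))))//.
  by rewrite ler_nat leq_addr.
have aS n : \sum_(k < n) a k <= A * m.+1%:R^-1.
  by rewrite /a -mulr_sumr ler_wpM2l// telescope_inv.
(* Past [m'] the telescoped tail $A/(m+m'+1)$ is at most $1/4$, as [iprod_neq0] asks. *)
pose m' := Num.truncn (4 * A).
have aT n : \sum_(k < n) a (m' + k)%N <= 4^-1.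
  have -> : \sum_(k < n) a (m' + k)%N = A * \sum_(k < n) (((m + m') + k).+1%:R * ((m + m') + k).+2%:R)^-1.
    by rewrite mulr_sumr; apply: eq_bigr => k _; rewrite /a !addnA.
  apply: (@le_trans _ _ (A * (m + m').+1%:R^-1)); first by rewrite ler_wpM2l// telescope_inv.
  rewrite ler_pdivrMr// mulrC -ler_pdivrMr ?invr_gt0// invrK mulrC.
  rewrite (le_trans (ltW (truncnS_gt (4 * A))))// ler_nat -/m' ltnS leq_addl//.
have v0 k : v k != 0 by exact: Grat_neq0.
have iv0 := iprod_neq0 va aS v0 aT.
have E n : Gseq s (n + m.+1) = Gseq s m.+1 * \prod_(k < n) v k.
  elim: n => [|n IH]; first by rewrite big_ord0 mulr1.
  by rewrite addSn addnS GseqS// -addnS IH big_ord_recr /= mulrA /v addnC.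
have cv : (Gseq s : nat -> R[i]^o) @ \oo --> ((Gseq s m.+1 * iprod v) : R[i]^o).
  rewrite -(cvg_shiftn m.+1); under eq_fun do rewrite E.
  by apply: cvgMr; exact: iprod_cvg va aS.
have -> : Gamma s = Gseq s m.+1 * iprod v by exact: cseqlim_eq cv.
by split=> //; rewrite mulf_neq0// Gseq_neq0.
Qed.

Definition dfac (k : nat) : R[i] := (- k%:R + 'i%C) / (- k%:R - 'i%C).

(** The part of the ratio of two Euler terms that does not depend on [t]: powers of $n$ of total
    modulus 1 for $n>0$, and the inverses [dfac] of the normalising constants of the factors
    [uf]. *)
Definition Dseq (n : nat) : R[i] :=
  cexp ((-1 + 'i%C + 'i%C) * (ln n%:R)%:C) * n%:R * \prod_(k < n.+1) dfac k.

Lemma normc_dfac k : normc (dfac k) = 1.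
Proof.
rewrite normc_div -(normcJ_ (- k%:R + 'i%C)) conjcD conjcN.
have -> : conjc (k%:R : R[i]) = k%:R by rewrite natrC conjc_real.
have -> : conjc ('i%C : R[i]) = - 'i%C by apply: complex_ext; rewrite !ReImE ?oppr0.
rewrite divff// normc_eq0 -opprD oppr_eq0.
by have := jpi_neq0 (R := R) k%:Z.
Qed.

Lemma normc_Dseq n : (0 < n)%N -> normc (Dseq n) = 1.
Proof.
move=> n0; rewrite /Dseq (normcM (_ * _)) (normcM (cexp _)) normc_prod big1 ?mulr1; last by move=> k _; rewrite normc_dfac.
rewrite normc_cexp natrC normc_real ger0_norm// !ReImE mulr0 subr0 !addr0 mulN1r expRN lnK ?posrE ?ltr0n//.
by rewrite mulVf// pnatr_eq0 -lt0n.
Qed.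

(** Up to a constant, the quotient $(t-i+k)/(t+i+k)$ of Euler factors is the Blaschke factor of
    index $-k$; the shift by 1 between $t-1+i$ and $t+i$ leaves the two end terms. *)
Lemma Gseq_ratio t n : (0 < n)%N ->
  Gseq (t%:C - 1 + 'i%C) n * (t%:C - 1 + 'i%C) =
  Dseq n * ((t%:C + 'i%C + n%:R) / n%:R) * \prod_(k < n.+1) uf (1 - 1 - k%:Z) t%:C *
  Gseq (t%:C - 'i%C) n.
Proof.
move=> n0; have nn : n%:R != 0 :> R[i] by rewrite pnatr_eq0 -lt0n.
have Hi (x c : R) : c != 0 -> x%:C + c%:C * 'i%C != 0.
  move=> c0; apply/eqP => /(congr1 (@complex.Im R)); rewrite !ReImE.
  by move/eqP; rewrite mulr1 mul0r !addr0 add0r (negbTE c0).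
have Ha (k : nat) : t%:C + 'i%C + k%:R != 0.
  have := @Hi (t + k%:R) 1 (oner_neq0 _); rewrite natrC; apply: contra => /eqP <-.
  by apply/eqP; apply: complex_ext; rewrite !ReImE; ring.
have Hb (k : nat) : t%:C - 'i%C + k%:R != 0.
  have n1 : -1 != 0 :> R by rewrite oppr_eq0 oner_eq0.
  have := @Hi (t + k%:R) (-1) n1; rewrite natrC; apply: contra => /eqP <-.
  by apply/eqP; apply: complex_ext; rewrite !ReImE; ring.
have Hs (k : nat) : t%:C - 1 + 'i%C + k%:R != 0.
  have := @Hi (t - 1 + k%:R) 1 (oner_neq0 _); rewrite natrC; apply: contra => /eqP <-.
  by apply/eqP; apply: complex_ext; rewrite !ReImE; ring.
set A := \prod_(k < n.+1) (t%:C + 'i%C + k%:R).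
set B := \prod_(k < n.+1) (t%:C - 'i%C + k%:R).
set P := \prod_(k < n.+1) (t%:C - 1 + 'i%C + k%:R).
have A0 : A != 0 by apply/prodf_neq0.
have B0 : B != 0 by apply/prodf_neq0.
have P0 : P != 0 by apply/prodf_neq0.
have E1 : P * (t%:C + 'i%C + n%:R) = (t%:C - 1 + 'i%C) * A.
  have -> : t%:C + 'i%C + n%:R = t%:C - 1 + 'i%C + n.+1%:R by rewrite -natr1; ring.
  transitivity (\prod_(k < n.+2) (t%:C - 1 + 'i%C + k%:R)); first by rewrite [RHS]big_ord_recr.
  rewrite big_ord_recl /= addr0.
  congr (_ * _); apply: eq_bigr => k _; rewrite /bump /= add1n -natr1; ring.
have E2 : \prod_(k < n.+1) dfac k * \prod_(k < n.+1) uf (1 - 1 - k%:Z) t%:C = B / A.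
  rewrite -big_split /= /B /A -prodf_div; apply: eq_bigr => k _.
  rewrite /dfac /uf subrr sub0r rmorphN /= -[k%:~R]/(k%:R : R[i]).
  have h1 : - k%:R + 'i%C != 0 :> R[i] by have := jpi_neq0 (R := R) (- k%:Z); rewrite rmorphN.
  have h2 : - k%:R - 'i%C != 0 :> R[i] by have := jmi_neq0 (R := R) (- k%:Z); rewrite rmorphN.
  have E (u x c : R[i]) : - x + c != 0 -> - x - c != 0 -> u + c + x != 0 ->
    (- x + c) / (- x - c) * ((- x - c) / (- x + c) * ((u - - x - c) / (u - - x + c))) =
    (u - c + x) / (u + c + x).
    move=> c1 c2 c3; have c4 : u - - x + c != 0 by rewrite opprK addrAC.
    by field; rewrite opprK addrAC in c4 *; rewrite c1 c2 c3.
  exact: E h1 h2 (Ha k).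
rewrite /Gseq -/P -/B /Dseq; set L := (ln n%:R)%:C.
have E3 : cexp ((t%:C - 1 + 'i%C) * L) = cexp ((-1 + 'i%C + 'i%C) * L) * cexp ((t%:C - 'i%C) * L).
  by rewrite -cexpD; congr cexp; ring.
rewrite E3; move: E1 E2 B0 A0 P0.
set d := \prod_(k < n.+1) dfac k; set U := \prod_(k < n.+1) uf _ _.
set e1 := cexp _; set e2 := cexp _; set s := t%:C - 1 + 'i%C; set w := t%:C + 'i%C + n%:R.
move=> E1 E2 B0 A0 P0.
have -> : e1 * n%:R * d * (w / n%:R) * U * (n`!%:R * e2 / B) = e1 * e2 * n`!%:R * w * (d * U) / B by field; rewrite ?nn ?B0.
rewrite E2; apply: (mulIf P0).
have -> : e1 * e2 * n`!%:R * w * (B / A) / B * P = e1 * e2 * n`!%:R * (P * w) / A by field; rewrite ?B0 ?A0.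
by rewrite E1; field; rewrite ?P0 ?A0.
Qed.

End GammaPhi.

Section PhiFormula.
Context {R : realType}.
Implicit Types (z w s : R[i]) (x t : R) (j J : int).

Lemma ccvg_unique (u : nat -> R[i]) (a b : R[i]) : (u : nat -> R[i]^o) @ \oo --> (a : R[i]^o) ->
  (u : nat -> R[i]^o) @ \oo --> (b : R[i]^o) -> a = b.
Proof. by move=> /cseqlim_eq <- /cseqlim_eq <-. Qed.

Lemma normc_PP_real J x : normc (PP J x%:C) = 1.
Proof. by have [/(_ x) + _ _] := @inner_mult_PP R 1 J ltr01; rewrite mul1r. Qed.

Lemma shift_ratio_cvg (z : R[i]) :
  ((fun n => (z + n.+1%:R) / n.+1%:R) : nat -> R[i]^o) @ \oo --> (1 : R[i]^o).
Proof.
apply/ccvgP/cvg_normc0P => e e0.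
exists (Num.truncn (normc z / e)) => // n /= hn.
have n0 : 0 < n.+1%:R :> R by [].
have -> : (z + n.+1%:R) / n.+1%:R - 1 = z / n.+1%:R.
  by rewrite mulrDl divff ?addrK// pnatr_eq0.
rewrite normc_div (natrC n.+1) normc_real ger0_norm// ltr_pdivrMr// mulrC -ltr_pdivrMr//.
by rewrite (lt_le_trans (truncnS_gt _))// ler_nat ltnS.
Qed.

Lemma Gamma_arg1 t (k : nat) : t%:C - 1 + 'i%C + k%:R != 0 :> R[i].
Proof.
rewrite natrC; apply/eqP => /(congr1 (@complex.Im R)); rewrite !ReImE /= oppr0 !addr0 add0r.
by move/eqP; rewrite oner_eq0.
Qed.

Lemma Gamma_arg2 t (k : nat) : t%:C - 'i%C + k%:R != 0 :> R[i].
Proof.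
rewrite natrC; apply/eqP => /(congr1 (@complex.Im R)); rewrite !ReImE /= addr0 add0r.
by move/eqP; rewrite oppr_eq0 oner_eq0.
Qed.

(** The limit of [Gseq_ratio]. Solving for [Dseq] shows, for each [t], that it converges to
    [lim_ t]; as the sequence does not involve [t], all these limits are one unimodular constant,
    which is [C]. *)
Lemma phi_eq : exists2 C : R[i], normc C = 1 &
  forall t, phi t%:C = C * PP 1 t%:C / ((Num.sqrt pi)%:C * (t%:C - 1 + 'i%C)).
Proof.
pose s1 t : R[i] := t%:C - 1 + 'i%C; pose s2 t : R[i] := t%:C - 'i%C.
pose lim_ t := Gamma (s1 t) * s1 t / (PP 1 t%:C * Gamma (s2 t)).
have P0 t : PP 1 t%:C != 0 by rewrite -normc_gt0 normc_PP_real.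
have cD t : ((fun n => Dseq n.+1) : nat -> R[i]^o) @ \oo --> (lim_ t : R[i]^o).
  have [c1 g1] := Gamma_cvg (Gamma_arg1 t); have [c2 g2] := Gamma_cvg (Gamma_arg2 t).
  have AE (w U g m D : R[i]) : w != 0 -> m != 0 -> U != 0 -> g != 0 ->
      D = D * (w / m) * U * g / (U * g) / (w / m).
    by move=> w0 m0 U0 g0; field; rewrite w0 m0 U0 g0.
  have E n : Dseq n.+1 = (Gseq (s1 t) n.+1 * s1 t) /
    ((\prod_(k < n.+2) uf (1 - 1 - k%:Z) t%:C) * Gseq (s2 t) n.+1) / ((t%:C + 'i%C + n.+1%:R) / n.+1%:R).
    have w0 : t%:C + 'i%C + n.+1%:R != 0 :> R[i].
      by have := Gamma_arg1 t n.+2; rewrite -natr1 (_ : t%:C - 1 + 'i%C + (n.+1%:R + 1) = t%:C + 'i%C + n.+1%:R)//; ring.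
    have n0 : n.+1%:R != 0 :> R[i] by rewrite pnatr_eq0.
    have u0 : \prod_(k < n.+2) uf (1 - 1 - k%:Z) t%:C != 0.
      apply/prodf_neq0 => k _; rewrite -normc_gt0 normc_uf intC.
      rewrite divr_gt0// normc_gt0; apply/eqP => /(congr1 (@complex.Im R)); rewrite !ReImE oppr0 !add0r.
        by move/eqP; rewrite oppr_eq0 oner_eq0.
      by move/eqP; rewrite oner_eq0.
    have G2 := Gseq_neq0 n.+1 (Gamma_arg2 t).
    rewrite (Gseq_ratio t (ltn0Sn n)); exact: AE.
  under eq_fun do rewrite E.
  have -> : lim_ t = Gamma (s1 t) * s1 t / (PP 1 t%:C * Gamma (s2 t)) / 1 by rewrite divr1.
  apply: cvgM; last first.
    by apply: cvgV; [exact: oner_neq0|exact: shift_ratio_cvg].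
  have d1 : ((fun n => Gseq (s1 t) n.+1) : nat -> R[i]^o) @ \oo --> (Gamma (s1 t) : R[i]^o).
    by rewrite (cvg_shiftS (Gseq (s1 t) : nat -> R[i]^o)); exact: c1.
  have d2 : ((fun n => Gseq (s2 t) n.+1) : nat -> R[i]^o) @ \oo --> (Gamma (s2 t) : R[i]^o).
    by rewrite (cvg_shiftS (Gseq (s2 t) : nat -> R[i]^o)); exact: c2.
  have d3 : ((fun n => \prod_(k < n.+2) uf (1 - 1 - k%:Z) t%:C) : nat -> R[i]^o) @ \oo --> (PP 1 t%:C : R[i]^o).
    have cP : ((fun n => \prod_(k < n) uf (1 - 1 - k%:Z) t%:C) : nat -> R[i]^o) @ \oo --> (PP 1 t%:C : R[i]^o).
      by apply: PP_cvg; rewrite ImC.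
    rewrite -(cvg_shiftS (_ : nat -> R[i]^o)) in cP.
    by rewrite -(cvg_shiftS (_ : nat -> R[i]^o)) in cP.
  have e0 : PP 1 t%:C * Gamma (s2 t) != 0 by rewrite mulf_neq0.
  have d4 : ((fun n => \prod_(k < n.+2) uf (1 - 1 - k%:Z) t%:C * Gseq (s2 t) n.+1) : nat -> R[i]^o) @ \oo
    --> (PP 1 t%:C * Gamma (s2 t) : R[i]^o) by exact: (@cvgM R[i] _ _ _ _ _ _ _ d3 d2).
  have d5 := @cvgV R[i] _ _ (@eventually_filter) _ _ e0 d4.
  have d6 : ((fun n => Gseq (s1 t) n.+1 * s1 t) : nat -> R[i]^o) @ \oo --> (Gamma (s1 t) * s1 t : R[i]^o).
    exact: (@cvgM R[i] _ _ _ _ _ _ _ d1 (cvg_cst _)).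
  exact: (@cvgM R[i] _ _ _ _ _ _ _ d6 d5).
exists (lim_ 0).
  have h : normc (Dseq n.+1 : R[i]) @[n --> \oo] --> normc (lim_ 0) by apply: cvg_normc; exact: cD.
  rewrite -(cvg_lim (@Rhausdorff R) h); under eq_fun do rewrite normc_Dseq//.
  by rewrite lim_cst//; exact: Rhausdorff.
move=> t; rewrite (ccvg_unique (cD 0) (cD t)) /lim_ /phi -/(s1 t) -/(s2 t).
have [_ g2] := Gamma_cvg (Gamma_arg2 t).
have s10 : s1 t != 0 by have := Gamma_arg1 t 0; rewrite addr0.
have pi0 : (Num.sqrt pi)%:C != 0 :> R[i].
  by rewrite -normc_eq0 normc_real normr_eq0 gt_eqF// sqrtr_gt0 pi_gt0.
move: g2 s10 pi0 (P0 t); rewrite -/(s2 t); set p := (Num.sqrt pi)%:C; set g := Gamma (s2 t).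
set g' := Gamma (s1 t); set S := s1 t; set P := PP _ _ => g2 s10 pi0 P0'.
by field; rewrite g2 s10 pi0 P0'.
Qed.

(** Both sides are Blaschke factors in $x$ with zero $m+j+i$, and the constant is fixed at $x=0$.
    Thus an integer translate of a half-product only moves its cut, up to a unimodular constant
    ([PP_shift]). *)
Lemma uf_shift (m j : int) x : uf m (x%:C - j%:~R) = uf (m + j) x%:C * uf m (- j%:~R).
Proof.
have E (u a b c : R[i]) : a + b - c != 0 -> a + b + c != 0 -> a + c != 0 -> u - (a + b) + c != 0 ->
  (a - c) / (a + c) * ((u - b - a - c) / (u - b - a + c)) =
  (a + b - c) / (a + b + c) * ((u - (a + b) - c) / (u - (a + b) + c)) *
  ((a - c) / (a + c) * ((- b - a - c) / (- b - a + c))).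
  move=> h1 h2 h3 h4.
  have h5 : - b - a + c != 0 by rewrite (_ : - b - a + c = - (a + b - c)) ?oppr_eq0//; ring.
  have h6 : u - b - a + c != 0 by rewrite (_ : u - b - a + c = u - (a + b) + c)//; ring.
  field.
  have h7 : u - a - b + c != 0 by rewrite (_ : u - a - b + c = u - (a + b) + c)//; ring.
  have h8 : - b + - a + c != 0 by [].
  by rewrite ?h1 ?h2 ?h3 ?h4 ?h5 ?h6 ?h7 ?h8.
rewrite /uf rmorphD; apply: E.
- by rewrite -rmorphD jmi_neq0.
- by rewrite -rmorphD jpi_neq0.
- exact: jpi_neq0.
- by rewrite -rmorphD; apply: zjpi_neq0; rewrite ImC.
Qed.

Lemma PP_shift (j : int) x : PP 1 (x%:C - j%:~R) = PP (j + 1) x%:C * PP 1 (- j%:~R).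
Proof.
have h1 : ((fun n => \prod_(k < n) uf (j + 1 - 1 - k%:Z) x%:C) : nat -> R[i]^o) @ \oo --> (PP (j + 1) x%:C : R[i]^o).
  by apply: PP_cvg; rewrite ImC.
have h2 : ((fun n => \prod_(k < n) uf (1 - 1 - k%:Z) (- j%:~R : R[i])) : nat -> R[i]^o) @ \oo --> (PP 1 (- j%:~R) : R[i]^o).
  by apply: PP_cvg; rewrite ImN intC ImC oppr0.
have h3 := @iprodM R (fun k => uf (j + 1 - 1 - k%:Z) x%:C) (fun k => uf (1 - 1 - k%:Z) (- j%:~R)) _ _ h1 h2.
apply: cseqlim_eq; rewrite -/(iprod _).
have -> : (fun n => \prod_(k < n) uf (1 - 1 - k%:Z) (x%:C - j%:~R)) =
  (fun n => \prod_(k < n) (uf (j + 1 - 1 - k%:Z) x%:C * uf (1 - 1 - k%:Z) (- j%:~R))).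
  by apply/funext => n; apply: eq_bigr => k _; rewrite uf_shift; congr (uf _ _ * _); ring.
exact: h3.
Qed.

End PhiFormula.

(** * The functions $\phi_{n,j}$ as a Takenaka-Malmquist system *)

Section Phinj.
Context {R : realType}.
Implicit Types (z w : R[i]) (x t : R) (n j J : int).

Definition sc n : R := 2 ^ n.
(** The zero $(j+1+i)/2^n$ of row $n$; the shift by 1 comes from the denominator $x-1+i$ in
    [phi_eq]. [Theta n j] consists of [Delta] at scale $n$ and of the factors of the row that
    precede this zero. *)
Definition lam n j : R[i] := ((j + 1)%:~R / sc n) +i* (sc n)^-1.
Definition Theta n j z : R[i] := Delta ((sc n)%:C * z) * PP (j + 1) ((sc n)%:C * z).

Lemma sc_gt0 n : 0 < sc n. Proof. by rewrite /sc exprz_gt0. Qed.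

Lemma Im_lam n j : 0 < Im (lam n j).
Proof. by rewrite /= invr_gt0 sc_gt0. Qed.

Lemma inner_mult_Theta n j : inner_mult (Theta n j).
Proof. by apply: inner_multM; [apply: inner_mult_Delta|apply: inner_mult_PP]; exact: sc_gt0. Qed.

Lemma phinj_eq n j : exists2 K : R[i], normc K ^+ 2 = (pi * sc n)^-1 &
  forall x, phinj n j x = K * (Theta n j x%:C * ker (lam n j)^*%C x).
Proof.
have [C C1 phiE] := @phi_eq R.
have pi0 : Num.sqrt pi != 0 :> R by rewrite gt_eqF// sqrtr_gt0 pi_gt0.
have s0 := sc_gt0 n.
pose c : R := 2 `^ (n%:~R / 2).
have c2 : c ^+ 2 = sc n.
  by rewrite /c -powR_mulrn ?powR_ge0// -powRrM mulfVK// powR_intmul.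
exists (c%:C * C * PP 1 (- j%:~R) / (Num.sqrt pi)%:C / (sc n)%:C).
  have -> : - j%:~R = (- j%:~R : R)%:C by rewrite rmorphN intC.
  rewrite !normc_div 2!normcM C1 normc_PP_real !normc_real.
  rewrite !mulr1 !ger0_norm ?powR_ge0 ?sqrtr_ge0 ?(ltW s0)//.
  rewrite !expr_div_n c2 sqr_sqrtr ?pi_ge0//.
  have := pi_gt0 R; move: s0; generalize (sc n) (@pi R) => s p s0 p0.
  by field; rewrite !gt_eqF.
move=> x; rewrite /phinj -/c -/(sc n) phiE.
have E1 : (sc n * x - j%:~R)%:C = (sc n * x)%:C - j%:~R by rewrite rmorphB intC.
rewrite E1 PP_shift /Theta /ker -(rmorphM (real_complex R)).
have E2 : x%:C - (lam n j)^*%C = ((sc n * x)%:C - j%:~R - 1 + 'i%C) / (sc n)%:C.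
  apply: complex_ext; rewrite intC -(fmorphV (real_complex R)) !ReImE ?intrD.
    by move: s0; generalize (sc n) => s s0; field; rewrite gt_eqF.
  by rewrite !mulr0 !subr0 add0r opprK !add0r mul1r.
rewrite E2; move: (Delta _) (PP _ _) (PP _ _) => D P1 P2.
have n1 : (sc n * x)%:C - j%:~R - 1 + 'i%C != 0 :> R[i].
  have := Gamma_arg1 (sc n * x - j%:~R) 0; rewrite addr0 E1//.
have n2 : (sc n)%:C != 0 :> R[i] by rewrite -normc_gt0 normc_real gtr0_norm.
have n3 : (Num.sqrt pi)%:C != 0 :> R[i] by rewrite -normc_gt0 normc_real normr_gt0.
move: n1 n2 n3; move: (_ - 1 + 'i%C) (sc n)%:C (Num.sqrt pi)%:C c%:C => a b p d a0 b0 p0.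
by field; rewrite a0 b0 p0.
Qed.

End Phinj.

Section PhinjOrtho.
Context {R : realType}.
Implicit Types (z w : R[i]) (x t : R) (n j J : int) (h f : R -> R[i]).

Lemma kerJ w x : (ker w x)^*%C = ker w^*%C x.
Proof. by rewrite /ker conjc_inv conjcB conjc_real. Qed.

Lemma phinj_spec n j : exists2 K : R[i], normc K ^+ 2 = (pi * sc n)^-1 &
  [/\ forall x, phinj n j x = K * (Theta n j x%:C * ker (lam n j)^*%C x),
      H2 (@phinj R n j) &
      forall z, 0 < Im z -> CI (phinj n j) z = K * (Theta n j z * (z - (lam n j)^*%C)^-1)].
Proof.
have [K K2 phE] := @phinj_eq R n j; exists K => //.
have [_ _ T3] := @inner_mult_Theta R n j; have [Hk Ck] := H2_ker (@Im_lam R n j).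
have [HT CT] := T3 _ Hk.
have E : phinj n j = fun x => K * (Theta n j x%:C * ker (lam n j)^*%C x) by apply/funext.
split=> //; first by rewrite E; exact: H2Z.
move=> z z0; rewrite E CI_Z//; last exact: H2_L2.
by rewrite CT// Ck.
Qed.

Lemma H2_phinj n j : H2 (@phinj R n j).
Proof. by have [K _ []] := phinj_spec n j. Qed.

Lemma L2_phinj n j : L2 (@phinj R n j).
Proof. exact/H2_L2/H2_phinj. Qed.

(** [Theta] is unimodular on the line, so only the kernel counts, and its energy $\pi2^n$ is the
    inverse of $|K|^2$. *)
Lemma energy_phinj n j : energy (@phinj R n j) = 1%E.
Proof.
have [K K2 [phE _ _]] := phinj_spec n j; have s0 := @sc_gt0 R n.
have [T1 _ _] := @inner_mult_Theta R n j.
have -> : phinj n j = fun x => K * (Theta n j x%:C * ker (lam n j)^*%C x) by apply/funext.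
rewrite energyZ; last by apply: cmeasM; [case: (@inner_mult_Theta R n j)|exact: cmeas_ker].
have -> : energy (fun x => Theta n j x%:C * ker (lam n j)^*%C x) = energy (ker (lam n j)^*%C).
  by apply: eq_integral => x _; rewrite normcM T1 mul1r.
rewrite energy_ker; last by rewrite ImJ oppr_eq0 gt_eqF// Im_lam.
rewrite K2 -EFinM ImJ /lam /= normrN ger0_norm ?invr_ge0 ?(ltW s0)// invrK mulVf//.
by rewrite mulf_neq0// gt_eqF// pi_gt0.
Qed.

(** On the line $\Theta\overline\Theta=1$, and the numerator $x-\lambda$ of the Blaschke factor
    cancels the conjugated kernel. What remains is a multiple of $\int h(x)/(x-\bar\lambda)\,dx$,
    which vanishes for Hardy functions. *)
Lemma inner_phinj_blaschke n j h : H2 h ->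
  inner (fun x => Theta n j x%:C * (blaschke (lam n j) x%:C * h x)) (phinj n j) = 0.
Proof.
move=> Hh; have [K _ [phE _ _]] := phinj_spec n j.
have [T1 _ _] := @inner_mult_Theta R n j.
have l0 := @Im_lam R n j; have Lh := H2_L2 Hh.
rewrite inner_cint (@eq_cint _ _ (fun x => K^*%C * (h x * ker (lam n j)^*%C x))); last first.
  move=> x; rewrite phE (conjcM K) (conjcM (Theta n j x%:C)).
  have k1 : (ker (lam n j)^*%C x)^*%C = ker (lam n j) x.
    by rewrite kerJ conjcK.
  have b1 : blaschke (lam n j) x%:C * ker (lam n j) x = ker (lam n j)^*%C x.
    rewrite /blaschke /ker mulrAC divff ?mul1r//.
    by apply: (@subr_real_neq0 R x 0); rewrite eq_sym gt_eqF.
  have t1 : Theta n j x%:C * (Theta n j x%:C)^*%C = 1.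
    by rewrite normc_mulJ T1 expr1n.
  rewrite k1 -[in RHS]b1 -[RHS]mul1r -[in RHS]t1; move: (blaschke _ _) (Theta n j x%:C) => b T; ring.
rewrite cintZ; first by rewrite (H2_vanishing Hh)// mulr0.
by apply: L2M_integrable => //; apply: L2_ker; rewrite ImJ oppr_eq0 gt_eqF.
Qed.

End PhinjOrtho.

(** * The spaces $V_n$ and orthonormality *)

Section Vspaces.
Context {R : realType}.
Implicit Types (z w : R[i]) (x t : R) (n j J : int) (h f g : R -> R[i]).

Lemma PoszS m : m.+1%:Z = m%:Z + 1.
Proof. by rewrite -addn1 PoszD. Qed.

Lemma sc_S n : sc (n + 1) = 2 * sc n :> R.
Proof. by rewrite /sc expfzDr// mulrC. Qed.

Lemma Delta_sc_S n z : 0 <= Im z ->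
  Delta ((sc (n + 1))%:C * z) = Delta ((sc n)%:C * z) * G ((sc n)%:C * z).
Proof.
move=> z0; rewrite sc_S rmorphM -mulrA Delta_rec; first by rewrite mulrC.
by apply: Im_scale_ge0 => //; rewrite ltW// sc_gt0.
Qed.

Lemma VspaceP n f :
  Vspace n f <-> exists2 h, H2 h & f = fun x => Delta ((sc n)%:C * x%:C) * h x.
Proof.
have E (h : R -> R[i]) : (fun x => Delta (2 ^ n * x)%:C * h x) =
    (fun x => Delta ((sc n)%:C * x%:C) * h x).
  by apply/funext => x; rewrite /sc (rmorphM (real_complex R)).
split=> -[h Hh fE]; exists h; [exact: Hh|rewrite -E; exact: esym|exact: Hh|rewrite fE; exact: E].
Qed.

Lemma Vspace_H2 n : @Vspace R n `<=` H2.
Proof.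
move=> f /VspaceP[h Hh ->]; have [_ _ T] := inner_mult_Delta (@sc_gt0 R n).
by have [] := T h Hh.
Qed.

Lemma Vspace_decr n : @Vspace R (n + 1) `<=` @Vspace R n.
Proof.
move=> f /VspaceP[h Hh ->]; apply/VspaceP.
have [_ _ T] := inner_mult_G (@sc_gt0 R n); have [HG _] := T h Hh.
exists (fun x => G ((sc n)%:C * x%:C) * h x); [exact: HG|apply/funext] => x.
by rewrite Delta_sc_S ?ImC// mulrA.
Qed.

Lemma Vspace_le n (m : nat) : @Vspace R (n + m%:Z) `<=` @Vspace R n.
Proof.
elim: m => [|m IH] f; first by rewrite addr0.
by rewrite PoszS addrA => /Vspace_decr; exact: IH.
Qed.

Lemma phinj_Vspace n j : Vspace n (@phinj R n j).
Proof.
have [K K2 [phE _ _]] := @phinj_spec R n j; apply/VspaceP.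
have [Hk _] := H2_ker (@Im_lam R n j).
have [_ _ T] := inner_mult_PP (j + 1) (@sc_gt0 R n); have [HP _] := T _ Hk.
exists (fun x => K * (PP (j + 1) ((sc n)%:C * x%:C) * ker (lam n j)^*%C x)); first exact: H2Z.
apply/funext => x; rewrite phE /Theta; ring.
Qed.

(** Multiplication by [Q] is an isometry inverted on the line by $\overline Q$, so approximations of
    [f] by $Qh$ become approximations of $\overline Qf$ by Hardy functions, and [hardy_closed]
    applies. *)
Lemma inner_mult_closed (Q : R[i] -> R[i]) f : inner_mult Q -> L2 f ->
  (forall e : R, 0 < e -> exists2 h, H2 h & (energy (fun x => f x - Q x%:C * h x)%R < e%:E)%E) ->
  exists2 h, H2 h & f = fun x => Q x%:C * h x.
Proof.
move=> [Q1 Qm _] Lf fQ; pose h x := (Q x%:C)^*%C * f x.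
have QJ x : Q x%:C * (Q x%:C)^*%C = 1 by rewrite normc_mulJ Q1 expr1n.
have Lh : L2 h.
  apply: (@L2_le _ _ f) => // [|x]; last by rewrite /h normcM normcJ_ Q1 mul1r.
  by apply: cmeasM; [exact: cmeasJ|exact: L2_cmeas].
exists h; last by apply/funext => x; rewrite /h mulrA QJ mul1r.
apply: hardy_closed => // e e0; have [g Hg gE] := fQ e e0; exists g; split=> //.
have E : energy (fun x => h x - g x) = energy (fun x => f x - Q x%:C * g x).
  apply: eq_integral => x _; rewrite -[normc (h x - g x)]mul1r -(Q1 x) -normcM mulrBr /h.
  by rewrite mulrA QJ mul1r.
have L : L2 (fun x => h x - g x) by apply: L2B => //; exact: H2_L2.
by rewrite -lte_fin -L2_energy// E.
Qed.

Lemma Vspace_closed n : closed_subspace (@Vspace R n) H2.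
Proof.
have Dm := inner_mult_Delta (@sc_gt0 R n).
split=> [||a f g|f Hf df].
- exact: Vspace_H2.
- by apply/VspaceP; exists (fun=> 0); [exact: H2_cst0|apply/funext => x; rewrite mulr0].
- move=> /VspaceP[h Hh ->] /VspaceP[k Hk ->]; apply/VspaceP.
  exists (fun x => a * h x + k x); first exact: H2_lin.
  by apply/funext => x; rewrite mulrDr mulrCA.
- apply/VspaceP; apply: (inner_mult_closed Dm); first exact: H2_L2.
  move=> e e0; have se : 0 < Num.sqrt e by rewrite sqrtr_gt0.
  have [_ /VspaceP[h Hh ->]] := df f erefl _ se.
  by rewrite L2norm_lt// sqr_sqrtr ?(ltW e0)// => He; exists h.
Qed.

Lemma uf_lam n j z : uf (j + 1) ((sc n)%:C * z) =
  ((j + 1)%:~R - 'i%C) / ((j + 1)%:~R + 'i%C) * blaschke (lam n j) z.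
Proof. by rewrite uf_blaschke// sc_gt0. Qed.

(** The orthogonality relations reduce to this: a function that contains the factors of [Theta n j]
    together with the next one, of index $j+1$, is orthogonal to [phinj n j]. *)
Lemma Theta_orth n j (Q : R[i] -> R[i]) f h : inner_mult Q -> H2 h ->
  (forall x, f x = Theta n j x%:C * (uf (j + 1) ((sc n)%:C * x%:C) * (Q x%:C * h x))) ->
  inner f (phinj n j) = 0.
Proof.
move=> [_ _ T] Hh fE; have [HQ _] := T h Hh.
pose c : R[i] := ((j + 1)%:~R - 'i%C) / ((j + 1)%:~R + 'i%C).
have -> : f = fun x => Theta n j x%:C * (blaschke (lam n j) x%:C * (c * (Q x%:C * h x))).
  by apply/funext => x; rewrite fE uf_lam -/c; ring.
by apply: inner_phinj_blaschke; exact: H2Z.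
Qed.

(** $\Delta(2^{n+1}z)$ contains the whole row $G(2^nz)$, in particular the factor of index $j+1$ on
    top of those in [Theta n j]; the remaining factors form [RR (j + 1 + 1)]. *)
Lemma Vspace_orth n j f : Vspace (n + 1) f -> inner f (phinj n j) = 0.
Proof.
move=> /VspaceP[h Hh ->].
apply: (@Theta_orth n j _ _ h (inner_mult_RR (j + 1 + 1) (@sc_gt0 R n)) Hh) => x.
have x0 : 0 <= Im ((sc n)%:C * x%:C : R[i]) by rewrite Im_scale ImC mulr0.
rewrite Delta_sc_S ?ImC// (G_RRPP (j + 1) x0) (RR_rec (j + 1) x0) /Theta.
by rewrite !mulrA; congr (_ * _); rewrite -!mulrA; congr (_ * _); rewrite mulrCA [RHS]mulrC -!mulrA mulrCA mulrC -!mulrA.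
Qed.

Lemma PP_split J z (m : nat) : 0 <= Im z ->
  PP (J + m%:Z) z = (\prod_(k < m) uf (J + k%:Z) z) * PP J z.
Proof.
move=> z0; elim: m => [|m IH]; first by rewrite addr0 big_ord0 mul1r.
by rewrite PoszS addrA PP_rec// IH big_ord_recr/= mulrA [_ * uf _ _]mulrC.
Qed.

(** The function of larger index contains, beyond [Theta n j], the factors of index $j+1$ up to
    $j+m+1$. *)
Lemma phinj_row_orth n j (m : nat) : inner (@phinj R n (j + m.+1%:Z)) (phinj n j) = 0.
Proof.
have [K K2 [phE _ _]] := @phinj_spec R n (j + m.+1%:Z).
have [Hk _] := H2_ker (@Im_lam R n (j + m.+1%:Z)).
have Qm := @inner_mult_prod R (fun k z => uf (j + 1 + 1 + k%:Z) ((sc n)%:C * z)) m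
  (fun k => inner_mult_uf (j + 1 + 1 + k%:Z) (@sc_gt0 R n)).
apply: (@Theta_orth n j _ _ (fun x => K * ker (lam n (j + m.+1%:Z))^*%C x) Qm (H2Z K Hk)) => x.
have x0 : 0 <= Im ((sc n)%:C * x%:C : R[i]) by rewrite Im_scale ImC mulr0.
rewrite phE /Theta (_ : j + m.+1%:Z + 1 = j + 1 + 1 + m%:Z); last by rewrite PoszS; ring.
rewrite PP_split// PP_rec//.
move: (\prod_(_ < _) _) (ker _ _) (Delta _) (PP _ _) (uf _ _) => a b c d u; ring.
Qed.

Lemma phinj_scale_orth n j j' (m : nat) : inner (@phinj R (n + m.+1%:Z) j') (phinj n j) = 0.
Proof.
apply: Vspace_orth; apply: (@Vspace_le _ m).
by rewrite -addrA [1 + _]addrC -PoszS; exact: phinj_Vspace.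
Qed.

Lemma int_lt_addS (a b : int) : a < b -> exists m : nat, b = a + m.+1%:Z.
Proof.
move=> ab; exists (absz (b - a - 1)%R); have h : 0 <= b - a - 1 by rewrite -addrA -opprD subr_ge0 lezD1.
by rewrite PoszS gez0_abs//; ring.
Qed.

Lemma phinj_orthonormal (p q : int * int) :
  inner (@phinj R p.1 p.2) (phinj q.1 q.2) = (p == q)%:R.
Proof.
have sym n j n' j' : inner (@phinj R n j) (phinj n' j') = 0 -> inner (@phinj R n' j') (phinj n j) = 0.
  by move=> h; rewrite (innerJ (L2_phinj n j)) ?h ?conjc0//; exact: L2_phinj.
case: p q => [n j] [n' j'] /=; rewrite xpair_eqE.
case: (ltgtP n n') => [/int_lt_addS[m ->]|/int_lt_addS[m ->]|->] /=.
- exact/sym/phinj_scale_orth.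
- exact: phinj_scale_orth.
case: (ltgtP j j') => [/int_lt_addS[m ->]|/int_lt_addS[m ->]|->] /=.
- exact/sym/phinj_row_orth.
- exact: phinj_row_orth.
by rewrite inner_energy ?energy_phinj//; exact: L2_phinj.
Qed.

End Vspaces.

(** * The telescoping sum of squared values *)

Section KernelSum.
Context {R : realType}.
Implicit Types (z w : R[i]) (x t : R) (n j J : int).

(** By [uf_sqr] the squared value is proportional to the drop of $|$[PP]$|^2$ when the factor of
    index $j+1$ is adjoined, so sums over $j$ telescope. *)
Lemma normc_CI_phinj n j w : 0 < Im w ->
  normc (CI (@phinj R n j) w) ^+ 2 = (4 * pi * Im w)^-1 * normc (Delta ((sc n)%:C * w)) ^+ 2 *
   (normc (PP (j + 1) ((sc n)%:C * w)) ^+ 2 - normc (PP (j + 1 + 1) ((sc n)%:C * w)) ^+ 2).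
Proof.
move=> w0; have [K K2 [_ _ CIE]] := @phinj_spec R n j; have s0 := @sc_gt0 R n.
have z0 : 0 <= Im ((sc n)%:C * w) by rewrite Im_scale mulr_ge0// ltW.
have l0 := @Im_lam R n j.
have d0 : normc (w - (lam n j)^*%C) != 0.
  rewrite normc_eq0 (_ : w = Re w +i* Im w); last by case: (w).
  apply: subr_real_neq0; rewrite ImJ; lra.
rewrite CIE// (PP_rec (j + 1))// [normc (uf _ _ * _)]normcM exprMn uf_sqr//.
have -> : (sc n)%:C * w - (j + 1)%:~R + 'i%C = (sc n)%:C * (w - (lam n j)^*%C).
  rewrite mulrBr -addrA; congr (_ + _); rewrite intC.
  by apply: complex_ext; rewrite /lam !ReImE; move: s0; generalize (@sc R n) => s s0; field; rewrite gt_eqF.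
rewrite [normc ((sc n)%:C * _)]normcM normc_real gtr0_norm// Im_scale.
rewrite [normc (K * _)]normcM [normc (Theta n j w * _)]normcM [normc (Theta _ _ _)]normcM normcV.
rewrite !exprMn K2 exprVn.
have pi0 := pi_gt0 R.
have AE (p s y d a b : R) : p != 0 -> s != 0 -> y != 0 -> d != 0 ->
  (p * s)^-1 * (a ^+ 2 * b ^+ 2 * (d ^+ 2)^-1) =
  (4 * p * y)^-1 * a ^+ 2 * (b ^+ 2 - (1 - 4 * (s * y) / (s ^+ 2 * d ^+ 2)) * b ^+ 2).
  by move=> p0 s1 y0 d1; field; rewrite p0 s1 y0 d1.
by apply: AE => //; rewrite gt_eqF.
Qed.

Lemma tail_sum_le (N n : nat) :
  \sum_(k < n) (1 + (N.+1%:R + k%:R : R) ^+ 2)^-1 <= 2 / N.+1%:R.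
Proof.
apply: (@le_trans _ _ (2 * \sum_(k < n) (((N + k).+1%:R * (N + k).+2%:R)^-1 : R))); last first.
  by rewrite ler_pM2l//; exact: telescope_inv.
rewrite mulr_sumr; apply: ler_sum => k _.
have -> : (N + k).+2%:R = (N + k).+1%:R + 1 :> R by rewrite -natr1.
have -> : N.+1%:R + k%:R = (N + k).+1%:R :> R by rewrite -natrD addSn.
have m0 : 0 < (N + k).+1%:R :> R by [].
move: m0; set m := (N + k).+1%:R => m0.
have h1 : 0 < m * (m + 1) by rewrite mulr_gt0// addr_gt0.
have h2 : 0 < 1 + m ^+ 2 by rewrite ltr_pwDl// sqr_ge0.
rewrite ler_pdivlMr// mulrC ler_pdivrMr//.
have : 0 <= (m - 1) ^+ 2 by apply: sqr_ge0.
nra.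
Qed.

Lemma PP_tail (N : nat) z : 0 <= Im z ->
  normc (PP (- N%:Z) z - 1) <= expR (ubnd z * (2 / N.+1%:R)) - 1.
Proof.
move=> z0; have h k := (PP_bound (- N%:Z) k z0).
rewrite /PP; apply: (@iprod_sub1_le _ _ _ _ (h 0%N).1) => n.
rewrite -mulr_sumr ler_wpM2l ?ubnd_ge0//.
by have := tail_sum_le N n; rewrite opprK intrD addrC/= natr1.
Qed.

Lemma RR_tail (N : nat) z : 0 <= Im z ->
  normc (RR (N.+1%:Z) z - 1) <= expR (ubnd z * (2 / N.+1%:R)) - 1.
Proof.
move=> z0; have h k := (RR_bound (N.+1%:Z) k z0).
rewrite /RR; apply: (@iprod_sub1_le _ _ _ _ (h 0%N).1) => n.
by rewrite -mulr_sumr ler_wpM2l ?ubnd_ge0//; exact: tail_sum_le.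
Qed.

(** The sum over $j$ from $-N-1$ to $N-1$ telescopes to the values of $|$[PP]$|^2$ at $-N$ and
    $N+1$. The first is close to 1, the second to $|G|^2$ because [RR] at $N+1$ is close to 1; the
    two errors together cost at most [5 * d]. *)
Lemma row_sum (n : int) (N : nat) w (d : R) : 0 < Im w -> 0 < d -> d <= 1 ->
  expR (ubnd ((sc n)%:C * w) * (2 / N.+1%:R)) - 1 <= d ->
  (4 * pi * Im w)^-1 * (normc (Delta ((sc n)%:C * w)) ^+ 2
     - normc (Delta ((sc (n + 1))%:C * w)) ^+ 2 - 5 * d) <=
  \sum_(l < N + N.+1) normc (CI (@phinj R n (l%:Z - N.+1%:Z)) w) ^+ 2.
Proof.
move=> w0 d0 d1 hd; set c := (4 * pi * Im w)^-1; set z := (sc n)%:C * w in hd *.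
have z0 : 0 <= Im z by rewrite Im_scale mulr_ge0 ?ltW// sc_gt0.
have c0 : 0 < c by rewrite invr_gt0 !mulr_gt0// pi_gt0.
pose p (l : nat) := normc (PP (l%:Z - N%:Z) z) ^+ 2.
have S m : \sum_(l < m) normc (CI (@phinj R n (l%:Z - N.+1%:Z)) w) ^+ 2 =
   c * normc (Delta z) ^+ 2 * (p 0%N - p m).
  elim: m => [|m IH]; first by rewrite big_ord0 subrr mulr0.
  rewrite big_ord_recr/= IH normc_CI_phinj// -/c -/z /p.
  have -> : m%:Z - N.+1%:Z + 1 = m%:Z - N%:Z by rewrite !PoszS; ring.
  have -> : m%:Z - N%:Z + 1 = m.+1%:Z - N%:Z by rewrite !PoszS; ring.
  by ring.
rewrite S Delta_sc_S; last exact: ltW.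
rewrite -/z (normcM (Delta z)) -[X in _ <= X]mulrA ler_pM2l// /p.
have -> : (N + N.+1)%:Z - N%:Z = N.+1%:Z by rewrite PoszD; ring.
rewrite sub0r (G_RRPP N.+1%:Z z0) (normcM (RR _ _)).
have P1 := PP_le1 N.+1%:Z z0; have R1 := RR_le1 N.+1%:Z z0; have Dl := Delta_le1 z0.
have hP := le_trans (PP_tail N z0) hd; have hR := le_trans (RR_tail N z0) hd.
have tri (u : R[i]) : normc (u - 1) <= d -> 1 - d <= normc u.
  move=> hu; have := normcD u (1 - u); rewrite addrCA subrr addr0 normc1.
  by rewrite -opprB normcN; lra.
have q1 := PP_le1 (- N%:Z) z0.
have AE (D a b q : R) : 0 <= D <= 1 -> 0 <= a <= 1 -> 0 <= b <= 1 -> 0 <= q <= 1 -> 1 - d <= q -> 1 - d <= a ->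
    D ^+ 2 - (D * (a * b)) ^+ 2 - 5 * d <= D ^+ 2 * (q ^+ 2 - b ^+ 2).
  move=> /andP[D0 D1] /andP[a0 a1] /andP[b0 b1] /andP[q0 qq] dq da.
  have h1 : 1 - q ^+ 2 <= 2 * d by nra.
  have h2 : 1 - a ^+ 2 <= 2 * d by nra.
  have h3 : b ^+ 2 * (1 - a ^+ 2) <= 2 * d.
    apply: le_trans h2; rewrite ler_piMl ?subr_ge0 ?expr_le1//; exact: expr_le1.
  have h4 : D ^+ 2 * (1 - q ^+ 2 + b ^+ 2 * (1 - a ^+ 2)) <= 4 * d.
    have D2 : D ^+ 2 <= 1 by rewrite expr_le1.
    have h5 : 0 <= 1 - q ^+ 2 + b ^+ 2 * (1 - a ^+ 2).
      by rewrite addr_ge0 ?mulr_ge0 ?subr_ge0 ?expr_le1 ?sqr_ge0.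
    by apply: le_trans (ler_piMl h5 D2) _; lra.
  have -> : D ^+ 2 * (q ^+ 2 - b ^+ 2) = D ^+ 2 - (D * (a * b)) ^+ 2
    - D ^+ 2 * (1 - q ^+ 2 + b ^+ 2 * (1 - a ^+ 2)) by ring.
  by lra.
by apply: AE; rewrite ?normc_ge0 ?tri.
Qed.

End KernelSum.

Section KernelSum2.
Context {R : realType}.
Implicit Types (z w : R[i]) (x t : R).

Lemma expR_sub1_small (d : R) : 0 < d -> exists2 t0 : R, 0 < t0 & forall t, t <= t0 -> expR t - 1 <= d.
Proof.
move=> d0; have d1 : 0 < 1 + d by rewrite addr_gt0.
exists (ln (1 + d)); first by rewrite ln_gt0// ltrDl.
by move=> t; rewrite -ler_expR lnK ?posrE//; lra.
Qed.

(** The argument tends to 0, where [Delta] tends to 1 at the rate of [Delta_sub1]. *)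
Lemma Delta_scale_low w (d : R) : 0 < Im w -> 0 < d ->
  exists N : nat, 1 - d <= normc (Delta ((sc (- N%:Z))%:C * w)) ^+ 2.
Proof.
move=> w0 d0; have [t0 t00 H] := @expR_sub1_small (d / 2) ltac:(lra).
pose C := Kr (normc w) * normc w; have C0 : 0 <= C by rewrite mulr_ge0 ?normc_ge0// Kr_ge0// normc_ge0.
exists (Num.truncn (C / t0)); set N := Num.truncn _.
have NE : C / t0 < 2 ^+ N.
  rewrite (lt_le_trans (truncnS_gt _))// -natrX ler_nat; exact: ltn_expl.
have s0 := @sc_gt0 R (- N%:Z).
have sE : sc (- N%:Z) = (2 ^+ N)^-1 :> R by rewrite /sc -exprnN.
have zn : normc ((sc (- N%:Z))%:C * w) = normc w / 2 ^+ N.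
  by rewrite normcM normc_real gtr0_norm// sE mulrC.
have z0 : 0 <= Im ((sc (- N%:Z))%:C * w) by rewrite Im_scale mulr_ge0 ?ltW.
have zr : normc ((sc (- N%:Z))%:C * w) <= normc w.
  by rewrite zn ler_pdivrMr ?exprn_gt0// ler_peMr ?normc_ge0// exprn_ege1// ler1n.
have := Delta_sub1 z0 zr; set D := Delta _ => hD.
have : normc (D - 1) <= d / 2.
  apply: (le_trans hD); apply: H; rewrite zn mulrA -/C ler_pdivrMr ?exprn_gt0//.
  by rewrite mulrC -ler_pdivrMr// ltW.
move=> hd; have : 1 - d / 2 <= normc D.
  have := normcD D (1 - D); rewrite addrCA subrr addr0 normc1.
  by rewrite -opprB normcN; lra.
have := normc_ge0 D; have := sqr_ge0 (1 - normc D); nra.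
Qed.

(** Once the point has height at least 1, each further doubling multiplies $|\Delta|^2$ by $|G|^2\le
    e^{-2/5}$. *)
Lemma Delta_scale_high w (d : R) : 0 < Im w -> 0 < d ->
  exists M : nat, normc (Delta ((sc M%:Z)%:C * w)) ^+ 2 <= d.
Proof.
move=> w0 d0; pose n0 := Num.truncn (Im w)^-1.
have h0 (m : nat) : 1 <= Im ((sc (n0 + m)%:Z)%:C * w).
  rewrite Im_scale /sc -ler_pdivrMr// mul1r.
  apply: (le_trans (ltW (truncnS_gt _))); rewrite -[2 ^ _]/(2 ^+ (n0 + m)) -natrX ler_nat.
  by rewrite (leq_trans (ltn_expl n0 (isT : 1 < 2)%N))// leq_exp2l// leq_addr.
have h (m : nat) : normc (Delta ((sc (n0 + m)%:Z)%:C * w)) ^+ 2 <= expR (- (2 / 5) * m%:R).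
  elim: m => [|m IH].
    rewrite mulr0 expR0 expr_le1 ?normc_ge0// Delta_le1//.
    by rewrite (le_trans _ (h0 0%N)).
  rewrite addnS PoszS Delta_sc_S; last exact: ltW.
  rewrite normcM exprMn -[m.+1%:R]natr1 mulrDr mulr1 expRD.
  by apply: ler_pM; rewrite ?sqr_ge0//; exact: G_sqr_le.
pose m := Num.truncn (5 / (2 * d)); exists (n0 + m)%N; apply: (le_trans (h m)).
rewrite mulNr expRN -[leRHS]invrK lef_pV2 ?posrE ?expR_gt0 ?invr_gt0//.
apply: (le_trans _ (expR_ge1Dx _)).
have : 5 / (2 * d) < m%:R + 1 by rewrite natr1; exact: truncnS_gt.
have -> : 5 / (2 * d) = 5 / 2 * d^-1 by field; rewrite gt_eqF.
by lra.
Qed.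

Lemma ubnd_le z (r : R) : normc z <= r -> ubnd z <= 2 * (3 + r) * r.
Proof. by move=> zr; have z0 := normc_ge0 z; rewrite /ubnd; nra. Qed.

Lemma div5_le (a l : R) : 0 < a -> 0 <= l -> 5 * (a / (5 * (l + 1))) * l <= a.
Proof.
move=> a0 l0; have l1 : 0 < l + 1 by rewrite ltr_wpDl.
rewrite mulrCA -!mulrA ler_piMr ?(ltW a0)// mulrCA ler_pdivrMl ?mulr_gt0//; lra.
Qed.

Lemma telescope_loss (a b u d c e : R) : 0 < c -> 0 < d -> 1 - d <= a -> b <= d -> u <= d -> 4 * c * d <= e ->
  c - e <= c * (a - b - u).
Proof.
move=> c0 d0 ha hb hu hd; have : c * (1 - 3 * d) <= c * (a - b - u) by rewrite ler_pM2l//; lra.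
have : 0 < c * d by rewrite mulr_gt0.
rewrite mulrBr mulr1; lra.
Qed.

(** Rows $-N$ to $M-1$ telescope to $|\Delta(2^{-N}w)|^2-|\Delta(2^Mw)|^2$, which is close to $1-0$.
    The limit $1/(4\pi\Im w)$ is the squared norm of the reproducing kernel ([energy_kap]), so no
    part of the kernel escapes the system. *)
Lemma kernel_sum w (e : R) : 0 < Im w -> 0 < e -> exists2 s : seq (int * int), uniq s &
  (4 * pi * Im w)^-1 - e <= \sum_(p <- s) normc (CI (@phinj R p.1 p.2) w) ^+ 2.
Proof.
move=> w0 e0; set c := (4 * pi * Im w)^-1.
have c0 : 0 < c by rewrite invr_gt0 !mulr_gt0// pi_gt0.
pose d := Num.min 1 (e / (4 * c)).
have d0 : 0 < d by rewrite lt_min ltr01 divr_gt0// mulr_gt0.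
have de : 4 * c * d <= e.
  by rewrite mulrC -ler_pdivlMr ?mulr_gt0// ge_min lexx orbT.
have d1 : d <= 1 by rewrite ge_min lexx.
have [N hN] := Delta_scale_low w0 d0; have [M hM] := Delta_scale_high w0 d0.
(* Each of the [L] rows loses at most [5 * dd]; this choice keeps the total loss at most [d]. *)
pose L := (N + M)%N; pose dd := d / (5 * L.+1%:R).
have dd0 : 0 < dd by rewrite divr_gt0// mulr_gt0.
have dd1 : dd <= 1.
  rewrite ler_pdivrMr ?mulr_gt0// mul1r (le_trans d1)//.
  by rewrite -natrM (ler_nat _ 1).
have ddL : 5 * dd * L%:R <= d.
  by rewrite /dd -[L.+1%:R]natr1; apply: div5_le.
have [t0 t00 Ht] := expR_sub1_small dd0.
(* A bound on $|2^{k-N}w|$ for all rows at once, so that a single cut-off [K] serves them all. *)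
pose r := sc M%:Z * normc w; pose C := 2 * (3 + r) * r.
pose K := Num.truncn (2 * C / t0).
have hK (k : nat) : (k < L)%N -> expR (ubnd ((sc (k%:Z - N%:Z))%:C * w) * (2 / K.+1%:R)) - 1 <= dd.
  move=> kL; apply: Ht; rewrite mulrA ler_pdivrMr//.
  have hC : ubnd ((sc (k%:Z - N%:Z))%:C * w) <= C.
    apply: ubnd_le; rewrite normcM normc_real gtr0_norm ?sc_gt0// ler_wpM2r ?normc_ge0//.
    by rewrite /sc ler_weXz2l// ?ler1n// lerBlDr -PoszD lez_nat addnC ltnW.
  have : 2 * C / t0 < K.+1%:R by exact: truncnS_gt.
  by rewrite ltr_pdivrMr// => hh; lra.
exists [seq (k%:Z - N%:Z, l%:Z - K.+1%:Z) | k <- iota 0 L, l <- iota 0 (K + K.+1)].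
  apply: allpairs_uniq; rewrite ?iota_uniq// => -[a b] [a' b'] _ _ /= [].
  by move=> /addIr[->] /addIr[->].
have io (f : nat -> R) m : \sum_(k <- iota 0 m) f k = \sum_(k < m) f k.
  by rewrite -(big_mkord xpredT) /index_iota subn0.
rewrite big_allpairs_dep io.
under eq_bigr do rewrite io.
pose D (k : nat) := normc (Delta ((sc (k%:Z - N%:Z))%:C * w)) ^+ 2.
have row (k : 'I_L) : true -> c * (D k - D k.+1 - 5 * dd) <=
    \sum_(l < K + K.+1) normc (CI (@phinj R (k%:Z - N%:Z) (l%:Z - K.+1%:Z)) w) ^+ 2.
  move=> _; have := row_sum w0 dd0 dd1 (hK k (ltn_ord k)).
  by rewrite -/c /D (_ : k%:Z - N%:Z + 1 = k.+1%:Z - N%:Z)// PoszS; ring.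
apply: le_trans (ler_sum _ row); rewrite -mulr_sumr.
have tel m : \sum_(k < m) (D k - D k.+1 - 5 * dd) = D 0%N - D m - 5 * dd * m%:R.
  elim: m => [|m IH]; first by rewrite big_ord0 subrr mulr0 subr0.
  rewrite big_ord_recr/= IH -[m.+1%:R]natr1; generalize (D 0%N) (D m) (D m.+1) dd => x y z u.
  by ring.
rewrite tel /D (_ : L%:Z - N%:Z = M%:Z); last by rewrite /L PoszD; ring.
rewrite sub0r; exact: (telescope_loss c0 d0 hN hM ddL de).
Qed.

End KernelSum2.

(** * Bessel's identity, and Fatou's lemma for energies *)

Section Bessel.
Context {R : realType} (I : eqType).
Notation mu := (@lebesgue_measure R).
Implicit Types (f g : R -> R[i]) (s : seq I) (c : I -> R[i]).

Context (e : I -> R -> R[i]) (L2e : forall p, L2 (e p))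
  (eo : forall p q, inner (e p) (e q) = (p == q)%:R).

Definition comb s c x := \sum_(p <- s) c p * e p x.
Definition proj s f := comb s (fun p => inner f (e p)).

Lemma L2_comb s c : L2 (comb s c).
Proof. by apply: L2_sum => p; exact: L2Z. Qed.

Lemma inner_comb s c q : uniq s -> inner (comb s c) (e q) = if q \in s then c q else 0.
Proof.
move=> us; rewrite /comb inner_suml//.
case: ifPn => qs.
  rewrite (bigD1_seq q)//= eo eqxx mulr1 big1 ?addr0// => p /negbTE pq.
  by rewrite eo pq mulr0.
rewrite big_seq big1// => p ps; rewrite eo (_ : p == q = false) ?mulr0//.
by apply/negbTE; apply: contraNneq qs => <-.
Qed.

Lemma inner_comb_orth s c g : L2 g -> (forall q, q \in s -> inner g (e q) = 0) ->
  inner (comb s c) g = 0.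
Proof.
move=> Lg h; rewrite /comb inner_suml// big_seq big1// => p ps.
by rewrite (innerJ Lg)// h// conjc0 mulr0.
Qed.

Lemma energy_comb s c : uniq s ->
  fine (energy (comb s c)) = \sum_(p <- s) normc (c p) ^+ 2.
Proof.
elim: s => [_|p s IH /andP[ps us]].
  rewrite big_nil /comb (_ : (fun x => _) = fun=> 0); last by apply/funext => x; rewrite big_nil.
  by rewrite /energy; under eq_integral do rewrite normc0 expr0n; rewrite integral0.
rewrite big_cons -IH// -(_ : fine (energy (fun x => c p * e p x)) = normc (c p) ^+ 2); last first.
  rewrite energyZ; last exact: L2_cmeas.
  have : (fine (energy (e p)))%:C = 1 :> R[i] by rewrite -inner_energy// eo eqxx.
  by case=> h; rewrite L2_energy// h mule1.
rewrite -energyDo//; [|exact: L2Z|exact: L2_comb|].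
  by congr (fine (energy _)); apply/funext => x; rewrite /comb big_cons.
rewrite innerZl//; last exact: L2_comb.
by rewrite (innerJ (L2_comb s c))// inner_comb// (negbTE ps) conjc0 mulr0.
Qed.

Lemma inner_residual s f q : uniq s -> L2 f -> q \in s ->
  inner (fun x => f x - proj s f x) (e q) = 0.
Proof. by move=> us Lf qs; rewrite innerBl//; [rewrite inner_comb// qs subrr|exact: L2_comb]. Qed.

Lemma bessel s f : uniq s -> L2 f -> fine (energy (fun x => f x - proj s f x)) =
  fine (energy f) - \sum_(p <- s) normc (inner f (e p)) ^+ 2.
Proof.
move=> us Lf; have Lp := L2_comb s (fun p => inner f (e p)).
rewrite -energy_comb//; apply/eqP; rewrite eq_sym subr_eq -energyDo//.
- by apply/eqP; congr (fine (energy _)); apply/funext => x; rewrite /proj subrK.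
- exact: L2B.
rewrite (innerJ Lp); last exact: L2B.
by rewrite inner_comb_orth ?conjc0//; [exact: L2B|move=> q; exact: inner_residual].
Qed.

Lemma bessel_le s f : uniq s -> L2 f ->
  \sum_(p <- s) normc (inner f (e p)) ^+ 2 <= fine (energy f).
Proof. by move=> us Lf; rewrite -subr_ge0 -bessel// fine_energy_ge0. Qed.

(** Self-adjointness of the projection; in [CI_residual] it moves the residual from [f] to the
    kernel. *)
Lemma inner_projC s f g : L2 f -> L2 g -> inner (proj s f) g = inner f (proj s g).
Proof.
move=> Lf Lg; have Lpg := L2_comb s (fun p => inner g (e p)).
rewrite (innerJ Lpg)// /proj /comb !inner_suml// rmorph_sum.
apply: eq_bigr => p _; rewrite (innerJ (L2e p) Lg) [inner f (e p)](innerJ (L2e p) Lf).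
  by rewrite -[RHS]/(conjc (_ * _)) conjcM conjcK mulrC.
Qed.

Lemma sum_subset (a : I -> R) s s' : (forall p, 0 <= a p) -> uniq s -> uniq s' ->
  {subset s <= s'} -> \sum_(p <- s) a p <= \sum_(p <- s') a p.
Proof.
move=> a0 us us' ss; rewrite [leRHS](bigID (mem s))/= -[X in _ <= X + _]big_filter.
rewrite [X in _ <= X + _](perm_big s); first by rewrite lerDl sumr_ge0.
apply: uniq_perm; rewrite ?filter_uniq// => p; rewrite mem_filter.
by apply/andP/idP => [[]//|ps]; split=> //; exact: ss.
Qed.

End Bessel.

Section Fatou.
Context {R : realType}.
Notation mu := (@lebesgue_measure R).

(** Lower semicontinuity of the energy under pointwise convergence: the squared modulus of the limit
    is a lower limit, to which Fatou's lemma applies. *)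
Lemma energy_fatou (u : nat -> R -> R[i]) f (C : \bar R) : (forall n, cmeas (u n)) ->
  (forall x, (u ^~ x : nat -> R[i]^o) @ \oo --> (f x : R[i]^o)) ->
  (forall n, energy (u n) <= C)%E -> (energy f <= C)%E.
Proof.
move=> mu_ uf uC.
have E x : (normc (f x) ^+ 2)%:E = limn_einf (fun n => (normc (u n x) ^+ 2)%:E).
  have h : (normc (u n x) ^+ 2)%:E @[n --> \oo] --> (normc (f x) ^+ 2)%:E.
    apply: cvg_EFin; first exact: nearW.
    have hn : normc (u n x) @[n --> \oo] --> normc (f x) by apply: cvg_normc; exact: uf.
    by rewrite /= ; under eq_fun do rewrite expr2; rewrite expr2; exact: cvgM.
  by rewrite is_cvg_limn_einfE; [exact/esym/cvg_lim|apply/cvg_ex; exists (normc (f x) ^+ 2)%:E].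
rewrite /energy; under eq_integral do rewrite E.
apply: le_trans (fatou _ _ _ _) _ => //.
- by move=> n; exact: measurable_energy.
- by move=> n x _; rewrite lee_fin sqr_ge0.
rewrite limn_einf_lim; apply: lime_le; first exact: is_cvg_einfs.
by apply: nearW => n; apply: le_trans (uC n); apply: ereal_inf_lbound; exists n => /=.
Qed.

End Fatou.

(** * Completeness of the system *)

Section Density.
Context {R : realType}.
Implicit Types (f g h : R -> R[i]) (z : R[i]) (s : seq (int * int)).

Definition ph (p : int * int) : R -> R[i] := phinj p.1 p.2.

Lemma L2_ph p : L2 (ph p). Proof. exact: L2_phinj. Qed.

Lemma ph_orthonormal p q : inner (ph p) (ph q) = (p == q)%:R.
Proof. exact: phinj_orthonormal. Qed.

(** The reproducing kernel of the Hardy space: the vector that represents evaluation of the Cauchy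
    integral at [z] ([CI_inner]). *)
Definition kap z x : R[i] := (((2 * pi)%:C * 'i%C)^-1 * ker z x)^*%C.

Lemma L2_kap z : 0 < Im z -> L2 (kap z).
Proof. by move=> z0; apply/L2J/L2Z/L2_ker; rewrite gt_eqF. Qed.

Lemma CI_inner f z : 0 < Im z -> L2 f -> CI f z = inner f (kap z).
Proof.
move=> z0 Lf; rewrite inner_cint /CI -cintZ.
  by apply: eq_cint => x; rewrite /kap conjcK mulrCA.
by apply: L2M_integrable => //; apply: L2_ker; rewrite gt_eqF.
Qed.

Lemma energy_kap z : 0 < Im z -> fine (energy (kap z)) = (4 * pi * Im z)^-1.
Proof.
move=> z0; rewrite energyJ energyZ; last exact: cmeas_ker.
rewrite energy_ker ?gt_eqF// gtr0_norm//= normcV normcM normc_real normc_i mulr1.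
have p0 := pi_gt0 R; rewrite gtr0_norm ?mulr_gt0//.
by move: p0; generalize (@pi R) => p p0; field; rewrite !gt_eqF.
Qed.

(** The residual of [f] evaluated at [z] is [f] paired with the residual of the kernel, and by
    Bessel's identity the energy of the latter is what the sum in [kernel_sum] still lacks. *)
Lemma CI_residual s f z : 0 < Im z -> uniq s -> L2 f ->
  normc (CI (fun x => f x - proj ph s f x) z) ^+ 2 <= 4 * fine (energy f) *
   ((4 * pi * Im z)^-1 - \sum_(p <- s) normc (CI (ph p) z) ^+ 2).
Proof.
move=> z0 us Lf; have Lk := L2_kap z0.
have Lp g : L2 g -> L2 (proj ph s g) by move=> _; exact: L2_comb L2_ph _ _.
have -> : CI (fun x => f x - proj ph s f x) z = inner f (fun x => kap z x - proj ph s (kap z) x).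
  rewrite CI_inner//; last exact/L2B/Lp.
  rewrite innerBl ?(inner_projC L2_ph)//; last exact: Lp.
  rewrite [RHS]innerJ//; last exact/L2B/Lp.
  rewrite innerBl//; last exact: Lp.
  by rewrite conjcB -!innerJ//; exact: Lp.
rewrite -energy_kap//.
have -> : \sum_(p <- s) normc (CI (ph p) z) ^+ 2 = \sum_(p <- s) normc (inner (kap z) (ph p)) ^+ 2.
  apply: eq_bigr => p _; rewrite CI_inner//; last exact: L2_ph.
  by rewrite (innerJ Lk) ?normcJ_//; exact: L2_ph.
rewrite -(bessel L2_ph ph_orthonormal)// inner_cint -[X in _ <= _ * fine X]energyJ.
apply: cauchy_schwarz4 => //; exact/L2J/L2B/Lp.
Qed.

Lemma CI_residual_small f z (e : R) : 0 < Im z -> L2 f -> 0 < e ->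
  exists s0, forall s, uniq s -> {subset s0 <= s} -> normc (CI (fun x => f x - proj ph s f x) z) < e.
Proof.
move=> z0 Lf e0; pose E := fine (energy f).
have E0 : 0 <= E by exact: fine_energy_ge0.
pose d := e ^+ 2 / (4 * (E + 1)).
have E1 : 0 < 4 * (E + 1) by rewrite mulr_gt0// ltr_wpDl.
have d0 : 0 < d by rewrite divr_gt0// exprn_gt0.
have [s0 us0 hs0] := kernel_sum z0 d0; exists s0 => s us ss.
rewrite -(ltr_pXn2r (_ : 0 < 2)%N) ?nnegrE ?normc_ge0 ?(ltW e0)//.
apply: (le_lt_trans (CI_residual z0 us Lf)); rewrite -/E.
have := sum_subset (a := fun p => normc (CI (ph p) z) ^+ 2) (fun p => sqr_ge0 _) us0 us ss.
move: hs0; rewrite -/(ph _) => hs0 hs.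
apply: (@le_lt_trans _ _ (4 * E * d)); first by rewrite ler_wpM2l ?mulr_ge0//; lra.
by rewrite mulrA ltr_pdivrMr// mulrC ltr_pM2l ?exprn_gt0// ltr_pM2l//; lra.
Qed.

(** A finite exhaustion of the index pairs along their enumeration by [pickle]; it turns unordered
    sums into sequences, as Fatou's lemma requires. *)
Definition box M : seq (int * int) := pmap pickle_inv (iota 0 M).

Lemma box_uniq M : uniq (box M).
Proof. by apply: (pmap_uniq pickle_invK); exact: iota_uniq. Qed.

Lemma mem_box p M : (pickle p < M)%N -> p \in box M.
Proof.
by move=> pM; rewrite mem_pmap; apply/mapP; exists (pickle p); rewrite ?pickleK_inv// mem_iota.
Qed.

Lemma box_exhausts s : exists N, forall M, (N <= M)%N -> {subset s <= box M}.
Proof.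
elim: s => [|p s [N IH]]; first by exists 0%N.
exists (maxn (pickle p).+1 N) => M; rewrite geq_max => /andP[pM NM] q; rewrite inE.
by case/orP => [/eqP ->|]; [exact: mem_box|exact: IH].
Qed.

Lemma H2_comb s c : H2 (comb ph s c).
Proof.
elim: s => [|p s IH]; first by rewrite (_ : comb _ _ _ = fun=> 0); [exact: H2_cst0|apply/funext => x; rewrite /comb big_nil].
rewrite (_ : comb _ _ _ = fun x => c p * ph p x + comb ph s c x); last by apply/funext => x; rewrite /comb big_cons.
by apply: H2_lin => //; exact: H2_phinj.
Qed.

(** Let [s0] nearly exhaust the Bessel sum and let [h] be the residual. The projections [g M] onto
    further indices have small energy, yet their Cauchy integrals converge to that of [h] at each
    point, by [CI_residual_small]. Fatou on a horizontal line passes the smallness to [CI h], and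
    the boundary limit passes it to [h]. *)
Lemma main_density f (e : R) : H2 f -> 0 < e ->
  exists2 s, uniq s & (energy (fun x => f x - proj ph s f x)%R < e%:E)%E.
Proof.
move=> Hf e0; have Lf := H2_L2 Hf.
pose a p := normc (inner f (ph p)) ^+ 2.
pose A := [set t | exists2 s, uniq s & t = \sum_(p <- s) a p].
have supA : has_sup A.
  split; first by exists 0; exists [::]; rewrite ?big_nil.
  by exists (fine (energy f)) => t [s us ->]; exact: (bessel_le L2_ph ph_orthonormal).
(* The final estimate is $2d+2\cdot4d=10d<e$. *)
pose d := e / 11; have d0 : 0 < d by rewrite divr_gt0.
have [_ [s0 us0 ->] hs0] := sup_adherent d0 supA.
exists s0 => //.
pose h x := f x - proj ph s0 f x.
have Hh : H2 h.
  rewrite (_ : h = fun x => (-1) * proj ph s0 f x + f x); last first.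
    by apply/funext => x; rewrite /h mulN1r addrC.
  by apply: H2_lin => //; exact: H2_comb.
have [Lh vh bh] := (H2P h).1 Hh.
pose s' M := [seq p <- box M | p \notin s0].
have us M : uniq (s0 ++ s' M).
  rewrite cat_uniq us0 filter_uniq ?box_uniq//= andbT.
  by apply/hasPn => p; rewrite mem_filter => /andP[].
have us' M : uniq (s' M) by have := us M; rewrite cat_uniq => /and3P[].
pose g M := proj ph (s' M) f.
have Hg M : H2 (g M) by exact: H2_comb.
have Eg M : (energy (g M) <= d%:E)%E.
  rewrite L2_energy; last exact: H2_L2.
  rewrite lee_fin (energy_comb L2_ph ph_orthonormal)//.
  have : \sum_(p <- s0 ++ s' M) a p <= sup A by apply: ub_le_sup; [case: supA|exists (s0 ++ s' M)].
  rewrite big_cat/= -/a; lra.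
have sub M : {subset box M <= s0 ++ s' M}.
  by move=> p pM; rewrite mem_cat mem_filter pM andbT; case: (p \in s0).
have cv z : 0 < Im z -> (CI (g n) z : R[i]^o) @[n --> \oo] --> (CI h z : R[i]^o).
  move=> z0; apply/ccvgP/cvg_normc0P => t t0.
  have [s1 hs1] := CI_residual_small z0 Lf t0; have [N hN] := box_exhausts s1.
  exists N => // n /= Nn; rewrite normcB -CI_B//; try exact: H2_L2.
  have := hs1 _ (us n) (fun p ps => sub n p (hN n Nn p ps)).
  rewrite (_ : (fun x => f x - _) = (fun x => h x - g n x))//.
  by apply/funext => x; rewrite /h /g /proj /comb big_cat/= opprD addrA.
have El y : 0 < y -> (energy (fun x => CI h (x +i* y)) <= (4 * d)%:E)%E.
  move=> y0; apply: (energy_fatou (u := fun n x => CI (g n) (x +i* y))).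
  - by move=> n; apply: cmeas_CI_line => //; exact: H2_L2.
  - by move=> x; exact: cv.
  move=> n; apply: (le_trans (CI_energy_le (H2_L2 (Hg n)) (H2_vanishing (Hg n)) y0)).
  by rewrite EFinM lee_pmul2l//.
have [t t0 ht] := (boundary_valueP _ _).1 bh d d0.
have ty : 0 < t / 2 < t by lra.
have y0 : 0 < t / 2 by lra.
have hy := ht _ ty; have ey := El _ y0.
have mC := cmeas_CI_line Lh y0.
have := energyD (cmeasB (L2_cmeas Lh) mC) mC.
rewrite (_ : (_ \+ _) = h); last by apply/funext => x /=; rewrite subrK.
move=> H; apply: (le_lt_trans H).
rewrite energyC.
apply: (@le_lt_trans _ _ (2%:E * d%:E + 2%:E * (4 * d)%:E)%E).
  by apply: leeD; rewrite lee_pmul2l// ltW.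
by rewrite -!EFinM -EFinD lte_fin /d; lra.
Qed.

End Density.

(** * Intersection, union and the two bases *)

Section Final.
Context {R : realType}.
Notation mu := (@lebesgue_measure R).
Implicit Types (f g h : R -> R[i]) (s : seq (int * int)) (n : int).

Lemma Vspace_lin n (a : R[i]) f g : Vspace n f -> Vspace n g -> Vspace n (fun x => a * f x + g x).
Proof. by have [_ _ + _] := @Vspace_closed R n; exact. Qed.

Lemma Vspace_leq n n' : n <= n' -> @Vspace R n' `<=` @Vspace R n.
Proof.
move=> nn; rewrite (_ : n' = n + (absz (n' - n)%R)%:Z); first exact: Vspace_le.
by rewrite gez0_abs ?subr_ge0//; ring.
Qed.

Lemma inner_Vspace_ph n f p : Vspace n f -> p.1 < n -> inner f (ph p) = 0.
Proof.
move=> Vf pn; apply: Vspace_orth; apply: Vspace_leq Vf.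
by rewrite lezD1.
Qed.

(** The spaces decrease, so the least scale that occurs in the combination works. *)
Lemma comb_Vspace s (c : int * int -> R[i]) : exists n, Vspace n (comb ph s c).
Proof.
elim: s => [|p s [n IH]].
  exists 0; rewrite (_ : comb _ _ _ = fun=> 0); last by apply/funext => x; rewrite /comb big_nil.
  by case: (@Vspace_closed R 0).
exists (Num.min p.1 n).
rewrite (_ : comb _ _ _ = fun x => c p * ph p x + comb ph s c x); last first.
  by apply/funext => x; rewrite /comb big_cons.
apply: Vspace_lin; first by apply: (@Vspace_leq _ p.1); rewrite ?ge_min ?lexx//; exact: phinj_Vspace.
by apply: (Vspace_leq _ IH); rewrite ge_min lexx orbT.
Qed.

Lemma energy_eq0 f : cmeas f -> (forall e : R, 0 < e -> (energy f < e%:E)%E) ->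
  {ae mu, forall x, f x = 0}.
Proof.
move=> mf fe; have E0 : energy f = 0%E.
  apply/eqP; rewrite eq_le energy_ge0 andbT; apply/lee_addgt0Pr => e e0.
  by rewrite add0e ltW// fe.
have /ae_eq_integral_abs : (\int[mu]_(x in setT) `|(normc (f x) ^+ 2)%:E| = 0)%E.
  by rewrite -E0; apply: eq_integral => x _; rewrite gee0_abs// lee_fin sqr_ge0.
move=> /(_ measurableT (measurable_energy mf)).
apply: filterS => x /(_ I) [] /eqP.
by rewrite sqrf_eq0 normc_eq0 => /eqP.
Qed.

Lemma energy_ae0 f : cmeas f -> {ae mu, forall x, f x = 0} -> energy f = 0%E.
Proof.
move=> mf f0; rewrite /energy (ae_eq_integral (fun=> 0%E))//; first by rewrite integral0.
  exact: measurable_energy.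
apply: (@filterS _ _ (ae_filter_ringOfSetsType mu) _ _ _ f0) => x -> _.
by rewrite normc0 expr0n.
Qed.

Lemma H2_proj_dense f (e : R) : H2 f -> 0 < e -> exists s,
  (L2norm (fun x => f x - proj ph s f x)%R < e%:E)%E.
Proof.
move=> Hf e0; have [s _ hs] := main_density Hf (exprn_gt0 2 e0).
by exists s; rewrite L2norm_lt.
Qed.

(** An element of the intersection lies in $V_{m+1}$ for every $m$, so it is orthogonal to every
    $\phi_{m,j}$; its projections vanish, and density makes its energy 0. As elements of [L2] are
    functions, the zero subspace appears as the null functions. *)
Lemma bigcap_Vspace : \bigcap_(n in [set: int]) @Vspace R n =
  [set f | L2 f /\ {ae mu, forall x, f x = 0}].
Proof.
apply/seteqP; split=> [f Vf|f [Lf f0] n _].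
  have Hf : H2 f by apply: (@Vspace_H2 _ 0); exact: Vf.
  split; first exact: H2_L2.
  apply: energy_eq0; first exact/L2_cmeas/H2_L2.
  move=> e e0; have [s _] := main_density Hf e0.
  rewrite (_ : (fun x => f x - _) = f)//; apply/funext => x.
  rewrite /proj /comb big1 ?subr0// => p _.
  by rewrite (@inner_Vspace_ph (p.1 + 1)) ?mul0r ?ltrDl//; exact: Vf.
(* A null function is at distance 0 from the zero function, so closedness puts it in [Vspace n]. *)
apply/VspaceP; apply: (inner_mult_closed (inner_mult_Delta (sc_gt0 n)) Lf) => e e0.
exists (fun=> 0); first exact: H2_cst0.
rewrite (_ : (fun x => f x - _) = f); first by rewrite (energy_ae0 (L2_cmeas Lf) f0) lte_fin.
by apply/funext => x; rewrite mulr0 subr0.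
Qed.

Lemma bigcup_Vspace_dense : dense_in (\bigcup_(n in [set: int]) @Vspace R n) H2.
Proof.
move=> f Hf e e0; have [s hs] := H2_proj_dense Hf e0.
have [n Vn] := comb_Vspace s (fun p => inner f (ph p)).
by exists (proj ph s f) => //; exists n.
Qed.

(** In a projection of [f] onto finitely many $\phi_{m,j}$ the terms with $m<n$ vanish because $f\in
    V_n$, and those with $m>n$ because $f\perp V_{n+1}$. The approximation given by density is
    therefore already a combination of row $n$. *)
Lemma row_basis n : orthonormal_basis (fun j : int => @phinj R n j) (Vspace n ⊖ Vspace (n + 1)).
Proof.
split=> [j|j j'|f [Vf fo] e e0].
- split; first exact: phinj_Vspace.
  move=> g Vg; rewrite (innerJ (H2_L2 (Vspace_H2 Vg)) (L2_phinj n j)).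
  by rewrite Vspace_orth// conjc0.
- by rewrite (@phinj_orthonormal R (n, j) (n, j')) xpair_eqE eqxx.
have [s hs] := H2_proj_dense (Vspace_H2 Vf) e0; exists (proj ph s f) => //.
exists [seq p.2 | p <- s & p.1 == n], (fun j => inner f (phinj n j)).
apply/funext => x; rewrite big_map big_filter /proj /comb [RHS]big_mkcond/=.
apply: eq_bigr => -[m j] _ /=; case: eqP => [->//|/eqP mn].
have [mn'|nm] := ltP m n; first by rewrite (@inner_Vspace_ph n _ (m, j)) ?mul0r.
have {}nm : n < m by rewrite lt_neqAle eq_sym mn.
rewrite (fo (ph (m, j))) ?mul0r//; apply: (@Vspace_leq _ m); rewrite ?lezD1//.
exact: phinj_Vspace.
Qed.

Lemma full_basis : orthonormal_basis (fun p : int * int => @phinj R p.1 p.2) H2.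
Proof.
split=> [p|p q|f Hf e e0]; first exact: H2_phinj.
  exact: phinj_orthonormal.
have [s hs] := H2_proj_dense Hf e0; exists (proj ph s f) => //.
by exists s, (fun p => inner f (ph p)).
Qed.

End Final.

Theorem mainTheorem4 (R : realType) :
  [/\ forall n : int, closed_subspace (@Vspace R n) H2,
      forall n : int, @Vspace R (n + 1) `<=` @Vspace R n,
      \bigcap_(n in [set: int]) @Vspace R n =
        [set f | L2 f /\ {ae (@lebesgue_measure R), forall x, f x = 0}]
    & dense_in (\bigcup_(n in [set: int]) @Vspace R n) H2]
  /\ (forall n : int,
        orthonormal_basis (fun j : int => @phinj R n j)
          (Vspace n ⊖ Vspace (n + 1)))
  /\ orthonormal_basis (fun p : int * int => @phinj R p.1 p.2) H2.
Proof.
split; [split|split].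
- exact: Vspace_closed.
- exact: Vspace_decr.
- exact: bigcap_Vspace.
- exact: bigcup_Vspace_dense.
- exact: row_basis.
- exact: full_basis.
Qed.
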